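(* For any $u\in\mathcal{L}PSH(\mathbb{C})$, $c_\infty(u)=\hat c_\infty(u)=1/\sigma_u$. Moreover, for any nonconstant $u\in\mathcal{L}PSH(\mathbb{C})$, \[ \{c>0:\ e^{-cu}\in L^2(\infty)\}=\{c>0:\ e^{-cu^+}\in L^2(\infty)\}=(1/\sigma_u,+\infty). \]
   Context: $\mathcal{L}PSH(\mathbb{C})$ is the class of subharmonic functions $u$ on $\mathbb{C}$ with finite logarithmic type $\sigma_u=\limsup_{|z|\to\infty}u(z)/\log|z|<\infty$. $g\in L^2(\infty)$ means there is a compact $K\subset\mathbb{C}$ with $\int_{\mathbb{C}\setminus K}|g|^2d\lambda<\infty$ ($d\lambda$ Lebesgue measure). $c_\infty(u)=\inf\{c>0:e^{-cu}\in L^2(\infty)\}$, $u^+=\max\{u,0\}$, and $\hat c_\infty(u)=c_\infty(u^+)=\inf\{c>0: e^{-cu^+}\in L^2(\mathbb{C})\}$; $\inf\emptyset=+\infty$, $1/0=+\infty$. *)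

(* Defs.v *)
From HB Require Import structures.
From mathcomp Require Import all_boot all_order all_algebra.
From mathcomp Require Import all_classical all_reals all_analysis.
Set Implicit Arguments. Unset Strict Implicit. Unset Printing Implicit Defensive.
Import Order.TTheory GRing.Theory Num.Theory.
Import numFieldNormedType.Exports.
Local Open Scope classical_set_scope.
Local Open Scope ring_scope.

Section Defs.
Variable R : realType.
Local Notation C := (R * R)%type.

Definition cmod (z : C) : R := Num.sqrt (z.1 ^+ 2 + z.2 ^+ 2).

Definition leb2 := (@lebesgue_measure R \x @lebesgue_measure R)%E.

Definition usc (u : C -> \bar R) := forall z (a : R), (u z < a%:E)%E ->
  exists2 V, nbhs z V & forall w, V w -> (u w < a%:E)%E.

Definition subharmonic (u : C -> \bar R) : Prop :=
  [/\ forall z, (u z < +oo)%E,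
      usc u,
      exists z, (-oo < u z)%E &
      forall z (r : R), 0 < r ->
        (u z <= ((2 * pi)^-1)%R%:E *
           \int[@lebesgue_measure R]_(t in `[0%R, (2 * pi)%R])
              u (z.1 + r * cos t, z.2 + r * sin t)%R)%E].

Definition logtype (u : C -> \bar R) : \bar R :=
  ereal_inf [set ereal_sup [set (u z * (ln (cmod z))^-1%:E)%E
                           | z in [set z : C | r < cmod z]]
            | r in [set r : R | 1 < r]].

Definition LPSH (u : C -> \bar R) : Prop :=
  subharmonic u /\ (logtype u < +oo)%E.

Definition L2_infty (g : C -> \bar R) : Prop :=
  exists K : set C, compact K /\
    leb2.-integrable (~` K) (fun z => (g z * g z)%E).

Definition L2_exps (u : C -> \bar R) : set R :=
  [set c : R | 0 < c /\ L2_infty (fun z => expeR (- (c%:E * u z)))%E].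

(* c_oo(u) = inf {c > 0 : e^{-c u} in L^2(oo)}  (inf of empty set = +oo) *)
Definition c_infty (u : C -> \bar R) : \bar R :=
  ereal_inf [set c%:E | c in L2_exps u].

Definition uplus (u : C -> \bar R) : C -> \bar R :=
  fun z => maxe (u z) 0%E.

Definition c_hat_infty (u : C -> \bar R) : \bar R := c_infty (uplus u).

(* 1/s on extended reals with 1/0 = +oo, 1/(+oo) = 0
   (sigma_u is always in [0, +oo) for u in LPSH(C); the value at -oo is irrelevant) *)
Definition einv (s : \bar R) : \bar R :=
  match s with
  | r%:E => if r == 0 then +oo%E else (r^-1)%:E
  | _ => 0%E
  end.

End Defs.

(* Main.v *)
Require Import Defs.
From HB Require Import structures.
From mathcomp Require Import all_boot all_order all_algebra.
From mathcomp Require Import all_classical all_reals all_analysis.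
From mathcomp Require Import measurable_realfun.
From mathcomp Require Import ring lra.
Set Implicit Arguments.
Unset Strict Implicit.
Unset Printing Implicit Defensive.
Import Order.TTheory GRing.Theory Num.Theory.
Import numFieldNormedType.Exports.
Local Open Scope classical_set_scope.
Local Open Scope ring_scope.

(* Let s be the logarithmic type of u and M r the maximum of u over |z| = r.
   Comparison with [b + t ln|z|] on annuli gives u z <= M r + s (ln|z| - ln r)
   for |z| >= r > 0.  If s <= 0 this makes u constant.  If s > 0, then |z|^(-2cs)
   is not integrable at infinity for c s <= 1, so that neither is exp(-2c u^+).

   For c s > 1 put R = 4^(k+1) and U z = u (R z) - M (R/4) - s ln 4.  On
   |z| >= 1/4 the gap s ln|z| - U z is nonnegative and superharmonic, and since
   M (4^(k+1)) - M (4^k) tends to s ln 4 it is as small as we please at some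
   point of the unit circle, hence small in mean on 1 <= |z| <= 4 by a Harnack
   chain.  A nonnegative superharmonic function v of small mass delta satisfies
   a John-Nirenberg type bound: its mean over a disc of radius rho is
   O(delta ln(1/rho)), so by comparing v with these means |{v > B k}| = O(2^-k)
   with B = O(delta), and exp (p v) has a bounded integral as soon as p delta is
   small.  Scaling back, the integral of exp(-2c u) over R <= |z| <= 4R is
   O(R^2 exp(-2c (M (R/4) + s ln 4))), which decays geometrically in k. *)

(** The obstacle lies above the critical exponent: a bound of [u] from above says nothing about
    exp(-2cu) near points where [u] is [-oo], and a logarithmic pole of mass m makes this function
    behave like |z - a|^(-2cm) there. Integrability is saved by the fact that the Riesz mass of far
    annuli tends to 0, so that all such poles are eventually too weak to matter. The Riesz measure
    itself never appears: closeness of [u] to its majorant at one point of a circle stands for small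
    mass, and disc means of the gap stand for potential estimates. The first annuli, where the mass
    may be large, are put into the compact set of [L2_infty]; the bounds for the others have to hold
    for all of them at once, so their constants may depend on p = 2c only and not on the function.
    The factor 4 in R/4 leaves room: the discs used around points of 1 <= |z| <= 4 stay in |z| >=
    1/4. At c s = 1 the integral of |z|^-2 still diverges, which makes the interval open at its left
    end. *)

HB.instance Definition _ (R : realType) :=
  Measure.copy (@leb2 R) (@lebesgue_measure R \x @lebesgue_measure R)%E.

(** Tonelli's theorem asks for this when [leb2] is itself a factor: an angle and a point in
    [area_supermean], two points in [cutoff_gap_mean_ge]. *)
Lemma sigma_finite_leb2 (R : realType) : sigma_finite setT (@leb2 R).
Proof.
pose A n : set R := `[- n%:R, n%:R]%classic.
have mA n : measurable (A n) by exact: measurable_itv.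
exists (fun n => A n `*` A n) => [|n].
  apply/esym/seteqP; split => // z _.
  pose m := Num.max `|z.1| `|z.2|.
  exists (Num.truncn m).+1 => //.
  have mn := ltW (truncnS_gt m).
  split; rewrite /A /= in_itv/= -ler_norml (le_trans _ mn)// le_max lexx ?orbT//.
split; first by apply: measurableX; exact: mA.
have -> : leb2 (A n `*` A n) = (@lebesgue_measure R (A n) * @lebesgue_measure R (A n))%E.
  exact: (@product_measure1E _ _ _ _ R (@lebesgue_measure R) (@lebesgue_measure R)
    _ _ (mA n) (mA n)).
have muA : (@lebesgue_measure R (A n) < +oo)%E.
  rewrite /A lebesgue_measure_itv/=; case: ifP => _; last by rewrite ltry.
  by rewrite -EFinB ltry.
by apply: lte_mul_pinfty => //; rewrite ge0_fin_numE.
Qed.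

HB.instance Definition _ (R : realType) :=
  Measure_isSigmaFinite.Build _ _ _ (@leb2 R) (@sigma_finite_leb2 R).

(** * Lebesgue measure on the plane *)

Section PlaneMeasure.
Variable R : realType.
Local Notation C := (R * R)%type.
Local Notation mu := (@lebesgue_measure R).
Local Notation leb2 := (@leb2 R).
Implicit Types (a b r s x y : R) (f : C -> \bar R).


Lemma measurable_affine r a : measurable_fun [set: R] (fun x => r * x + a).
Proof. by apply: measurable_funD => //; exact: measurable_funM. Qed.

(** By uniqueness of Lebesgue measure, the rescaled image measure need only be compared with it on
    half-open intervals. *)
Lemma lebesgue_measure_affine r a (A : set R) : 0 < r -> measurable A ->
  mu A = (r%:E * mu ((fun x => r * x + a)%R @^-1` A))%E.
Proof.
move=> r0 mA.
pose g (x : measurableTypeR R) : measurableTypeR R := r * x + a.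
have mg : measurable_fun setT g by exact: measurable_affine.
have rn0 : 0 <= r by exact: ltW.
pose m :=
  mscale (NngNum rn0) (pushforward mu g).
rewrite (@lebesgue_measure_unique R (m mg))// => _ [[b c]] _ <-.
rewrite /m /mscale/= /mscale/= /pushforward.
have -> : g @^-1` `]b, c] = `](b - a) / r, (c - a) / r]%classic.
  apply/seteqP; split => x /=; rewrite !in_itv/= /g ltr_pdivrMr// ler_pdivlMr// ltrBlDr lerBrDr mulrC //.
rewrite !lebesgue_measure_itv/= !lte_fin ltr_pM2r ?invr_gt0// ltrD2r.
case: ifPn => _; last by rewrite mule0.
by rewrite -!EFinB -EFinM; congr EFin; field; rewrite gt_eqF.
Qed.

Lemma ge0_integral_affine r a (g : R -> \bar R) : 0 < r ->
  measurable_fun setT g -> (forall x, (0 <= g x)%E) ->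
  (\int[mu]_x g x = r%:E * \int[mu]_x g (r * x + a)%R)%E.
Proof.
move=> r0 mg g0.
pose h (x : measurableTypeR R) : measurableTypeR R := r * x + a.
have mh : measurable_fun setT h by exact: measurable_affine.
have rn0 : 0 <= r by exact: ltW.
pose m :=
  mscale (NngNum rn0) (pushforward mu h).
transitivity (\int[m mh]_x g x)%E.
  by apply: eq_measure_integral => A mA _; exact: lebesgue_measure_affine.
rewrite ge0_integral_mscale//=; congr *%E.
by rewrite ge0_integral_pushforward// preimage_setT.
Qed.

Lemma measurable_shear a : measurable_fun [set: C] (fun z : C => (z.1 + a * z.2, z.2)).
Proof.
apply: measurable_fun_pair => //; apply: measurable_funD => //.
exact: measurable_funM.
Qed.

Lemma ge0_integral_leb2_xy f : measurable_fun setT f -> (forall z, (0 <= f z)%E) ->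
  (\int[leb2]_z f z = \int[mu]_x \int[mu]_y f (x, y))%E.
Proof. exact: (fubini_tonelli1 (m1 := mu) (m2 := mu)). Qed.

Lemma ge0_integral_leb2_yx f : measurable_fun setT f -> (forall z, (0 <= f z)%E) ->
  (\int[leb2]_z f z = \int[mu]_y \int[mu]_x f (x, y))%E.
Proof. exact: (fubini_tonelli2 (m1 := mu) (m2 := mu)). Qed.

Lemma measurable_section1 f y : measurable_fun setT f ->
  measurable_fun setT (fun x => f (x, y)).
Proof. by move=> mf; apply: measurableT_comp => //; exact: measurable_fun_pair. Qed.

Lemma measurable_section2 f x : measurable_fun setT f ->
  measurable_fun setT (fun y => f (x, y)).
Proof. by move=> mf; apply: measurableT_comp => //; exact: measurable_fun_pair. Qed.

(** On each horizontal line a shear is a translation, so Tonelli reduces it to one dimension. *)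
Lemma ge0_integral_shear1 a f : measurable_fun setT f -> (forall z, (0 <= f z)%E) ->
  (\int[leb2]_z f (z.1 + a * z.2, z.2)%R = \int[leb2]_z f z)%E.
Proof.
move=> mf f0.
rewrite [RHS]ge0_integral_leb2_yx; [|exact: mf|exact: f0].
rewrite ge0_integral_leb2_yx; [| |by move=> z; exact: f0]; last first.
  by apply: measurableT_comp => //; exact: measurable_shear.
apply: eq_integral => y _ /=.
rewrite [RHS](@ge0_integral_affine 1 (a * y))// ?mul1e//; last first.
  exact: measurable_section1.
by apply: eq_integral => x _; rewrite mul1r.
Qed.

Lemma measurable_swap : measurable_fun [set: C] (fun z : C => (z.2, z.1)).
Proof. exact: measurable_fun_pair. Qed.

Lemma ge0_integral_swap f : measurable_fun setT f -> (forall z, (0 <= f z)%E) ->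
  (\int[leb2]_z f (z.2, z.1) = \int[leb2]_z f z)%E.
Proof.
move=> mf f0.
rewrite [RHS]ge0_integral_leb2_yx// ge0_integral_leb2_xy//.
by apply: measurableT_comp => //; exact: measurable_swap.
Qed.

Lemma ge0_integral_shear2 a f : measurable_fun setT f -> (forall z, (0 <= f z)%E) ->
  (\int[leb2]_z f (z.1, z.2 + a * z.1)%R = \int[leb2]_z f z)%E.
Proof.
move=> mf f0.
rewrite -(ge0_integral_swap mf f0).
rewrite -(@ge0_integral_shear1 a (fun z => f (z.2, z.1)))//; last first.
  by apply: measurableT_comp => //; exact: measurable_swap.
rewrite -[LHS]ge0_integral_swap//.
apply: measurableT_comp => //; apply: measurable_fun_pair => //.
by apply: measurable_funD => //; exact: measurable_funM.
Qed.

Lemma measurable_fun_translate (w : C) : measurable_fun [set: C] (fun z : C => z + w).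
Proof.
have -> : (fun z : C => z + w) = (fun z : C => (z.1 + w.1, z.2 + w.2)) by [].
by apply: measurable_fun_pair; apply: measurable_funD.
Qed.

Lemma measurable_fun_dilate r : measurable_fun [set: C] (fun z : C => (r * z.1, r * z.2)).
Proof. by apply: measurable_fun_pair; exact: measurable_funM. Qed.

Lemma ge0_integral_translate (w : C) f : measurable_fun setT f -> (forall z, (0 <= f z)%E) ->
  (\int[leb2]_z f (z + w)%R = \int[leb2]_z f z)%E.
Proof.
move=> mf f0.
rewrite [RHS]ge0_integral_leb2_xy; [|exact: mf|exact: f0].
rewrite ge0_integral_leb2_xy; [| |by move=> z; exact: f0]; last first.
  by apply: measurableT_comp => //; exact: measurable_fun_translate.
rewrite [RHS](@ge0_integral_affine 1 w.1)// ?mul1e; last 2 first.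
- exact: (measurable_fun_fubini_tonelli_F (m2 := mu)).
- by move=> x; apply: integral_ge0.
apply: eq_integral => x _ /=; rewrite mul1r.
rewrite [RHS](@ge0_integral_affine 1 w.2)// ?mul1e//; last first.
  exact: measurable_section2.
by apply: eq_integral => y _; rewrite mul1r.
Qed.

Lemma ge0_integral_dilate r f : 0 < r ->
  measurable_fun setT f -> (forall z, (0 <= f z)%E) ->
  (\int[leb2]_z f z = (r ^+ 2)%:E * \int[leb2]_z f (r * z.1, r * z.2)%R)%E.
Proof.
move=> r0 mf f0.
have md := measurable_fun_dilate r.
rewrite [LHS]ge0_integral_leb2_xy; [|exact: mf|exact: f0].
rewrite ge0_integral_leb2_xy; [| |by move=> z; exact: f0]; last first.
  by apply: measurableT_comp.
rewrite [LHS](@ge0_integral_affine r 0 _ r0); last 2 first.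
- exact: (measurable_fun_fubini_tonelli_F (m2 := mu)).
- by move=> x; apply: integral_ge0.
rewrite expr2 EFinM -muleA; congr *%E.
rewrite -ge0_integralZl//; last 3 first.
- apply: (@measurable_fun_fubini_tonelli_F _ _ _ _ _ mu (fun z => f (r * z.1, r * z.2))) => //.
  exact: measurableT_comp.
- by move=> x _; apply: integral_ge0.
- by rewrite lee_fin ltW.
apply: eq_integral => x _ /=; rewrite addr0.
rewrite [LHS](@ge0_integral_affine r 0)//; last first.
  exact: measurable_section2.
by congr *%E; apply: eq_integral => y _; rewrite addr0.
Qed.

Lemma measurable_fun_rotate r s :
  measurable_fun [set: C] (fun z : C => (r * z.1 - s * z.2, s * z.1 + r * z.2)).
Proof.
apply: measurable_fun_pair; last by apply: measurable_funD; exact: measurable_funM.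
by apply: measurable_funB; exact: measurable_funM.
Qed.

(* A rotation is a product of three shears, except the half turn, which is the
   square of a quarter turn. *)
Lemma ge0_integral_rotate r s f : r ^+ 2 + s ^+ 2 = 1 ->
  measurable_fun setT f -> (forall z, (0 <= f z)%E) ->
  (\int[leb2]_z f (r * z.1 - s * z.2, s * z.1 + r * z.2)%R = \int[leb2]_z f z)%E.
Proof.
wlog rN1 : r s f / r != -1.
  move=> H rs1 mf f0; have [/eqP rN1|rN1] := boolP (r == -1); last exact: H.
  have s0 : s = 0 by move: rs1; rewrite rN1; move=> h; apply/eqP; rewrite -sqrf_eq0; apply/eqP; lra.
  have mq : measurable_fun setT (fun z : C => f (0 * z.1 - 1 * z.2, 1 * z.1 + 0 * z.2)).
    by apply: measurableT_comp => //; exact: measurable_fun_rotate.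
  have q2 : (0 : R) ^+ 2 + 1 ^+ 2 = 1 by ring.
  have q0 : (0 : R) != -1 by rewrite eq_sym oppr_eq0 oner_eq0.
  rewrite -[RHS](H 0 1 f q0 q2)// -[RHS](H 0 1 _ q0 q2 mq)//.
  by apply: eq_integral => z _ /=; congr (f (_, _)); rewrite rN1 s0; ring.
(* For [r = cos x] and [s = sin x], [t] is - tan (x / 2), the coefficient of the two outer shears;
   the middle one has coefficient [s]. *)
move=> rs1 mf f0; pose t := - s / (1 + r).
have r1 : 1 + r != 0 by rewrite addrC addr_eq0.
rewrite -[RHS](@ge0_integral_shear1 t)//.
pose f1 z := f (z.1 + t * z.2, z.2).
have mf1 : measurable_fun setT f1 by apply: measurableT_comp => //; exact: measurable_shear.
rewrite -[RHS](@ge0_integral_shear2 s f1 mf1 (fun z => f0 _)).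
pose f2 z := f1 (z.1, z.2 + s * z.1).
have mf2 : measurable_fun setT f2.
  apply: measurableT_comp => //; apply: measurable_fun_pair => //.
  by apply: measurable_funD => //; exact: measurable_funM.
rewrite -[RHS](@ge0_integral_shear1 t f2 mf2 (fun z => f0 _)).
have e1 : 1 + s * t = r.
  have -> : s * t = - s ^+ 2 / (1 + r) by rewrite /t; field.
  have -> : s ^+ 2 = 1 - r ^+ 2 by lra.
  by field.
apply: eq_integral => z _; rewrite /f2 /f1 /=; congr (f (_, _)).
  have -> : z.1 + t * z.2 + t * (z.2 + s * (z.1 + t * z.2)) =
    (1 + s * t) * z.1 + t * (1 + (1 + s * t)) * z.2 by ring.
  by rewrite e1 /t; field.
have -> : z.2 + s * (z.1 + t * z.2) = s * z.1 + (1 + s * t) * z.2 by ring.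
by rewrite e1.
Qed.

End PlaneMeasure.

(** * Modulus, topology and circles in the plane *)

Section Plane.
Variable R : realType.
Local Notation C := (R * R)%type.
Local Notation mu := (@lebesgue_measure R).
Local Notation leb2 := (@leb2 R).
Implicit Types (r s t : R) (z w a : C).

Definition circle z r t : C := (z.1 + r * cos t, z.2 + r * sin t).

Lemma cmod_ge0 z : 0 <= cmod z. Proof. exact: sqrtr_ge0. Qed.

Lemma cmod_sqr z : cmod z ^+ 2 = z.1 ^+ 2 + z.2 ^+ 2.
Proof. by rewrite /cmod sqr_sqrtr// addr_ge0// sqr_ge0. Qed.

Lemma cmodN z : cmod (- z) = cmod z.
Proof. by rewrite /cmod/= !sqrrN. Qed.

Lemma cmodC z w : cmod (z - w) = cmod (w - z).
Proof. by rewrite -cmodN opprB. Qed.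

Lemma cmod0 : cmod (0 : C) = 0.
Proof. by rewrite /cmod/= expr0n/= addr0 sqrtr0. Qed.

Lemma cmod_eq0 z : cmod z = 0 -> z = 0.
Proof.
move=> z0; have := cmod_sqr z; rewrite z0 expr0n/= => /esym/eqP.
rewrite paddr_eq0 ?sqr_ge0// !sqrf_eq0 => /andP[/eqP z1 /eqP z2].
by case: z z1 z2 {z0} => /= x y -> ->.
Qed.

Lemma cmod_triangle z w : cmod (z + w) <= cmod z + cmod w.
Proof.
rewrite -ler_sqr ?nnegrE ?addr_ge0 ?cmod_ge0//.
rewrite sqrrD !cmod_sqr/=.
suff : z.1 * w.1 + z.2 * w.2 <= cmod z * cmod w by lra.
have [h|h] := leP (z.1 * w.1 + z.2 * w.2) 0.
  by apply: le_trans h _; rewrite mulr_ge0// cmod_ge0.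
rewrite -ler_sqr ?nnegrE ?mulr_ge0 ?cmod_ge0//; last exact: ltW.
rewrite exprMn !cmod_sqr -subr_ge0.
(* Lagrange's identity, which gives the planar Cauchy-Schwarz inequality. *)
have -> : (z.1 ^+ 2 + z.2 ^+ 2) * (w.1 ^+ 2 + w.2 ^+ 2) - (z.1 * w.1 + z.2 * w.2) ^+ 2
  = (z.1 * w.2 - z.2 * w.1) ^+ 2 by ring.
exact: sqr_ge0.
Qed.

Lemma cmod_dist_triangle w z a : cmod (z - a) <= cmod (z - w) + cmod (w - a).
Proof. by apply: le_trans (cmod_triangle _ _); rewrite addrA subrK. Qed.

Lemma norm_fst_le z : `|z.1| <= cmod z.
Proof.
rewrite -ler_sqr ?nnegrE ?cmod_ge0// cmod_sqr real_normK ?num_real//.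
by rewrite lerDl sqr_ge0.
Qed.

Lemma norm_snd_le z : `|z.2| <= cmod z.
Proof.
rewrite -ler_sqr ?nnegrE ?cmod_ge0// cmod_sqr real_normK ?num_real//.
by rewrite lerDr sqr_ge0.
Qed.

Lemma cmod_le_sum z : cmod z <= `|z.1| + `|z.2|.
Proof.
rewrite -ler_sqr ?nnegrE ?cmod_ge0 ?addr_ge0// cmod_sqr sqrrD !real_normK ?num_real//.
by rewrite -addrA lerD2l lerDr mulrn_wge0// mulr_ge0.
Qed.

Lemma cmod_dilate r z : 0 <= r -> cmod (r * z.1, r * z.2) = r * cmod z.
Proof.
move=> r0; apply/eqP; rewrite -(@eqrXn2 _ 2) ?cmod_ge0 ?mulr_ge0 ?cmod_ge0//.
by rewrite exprMn !cmod_sqr/= !exprMn mulrDr.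
Qed.

Lemma circle_sub z r t : circle z r t - z = (r * cos t, r * sin t).
Proof. by case: z => x y; rewrite /circle/=; congr (_, _) => /=; rewrite addrC addKr. Qed.

Lemma cmod_polar r t : 0 <= r -> cmod (r * cos t, r * sin t) = r.
Proof.
move=> r0; rewrite (cmod_dilate (cos t, sin t) r0).
by rewrite /cmod/= cos2Dsin2 sqrtr1 mulr1.
Qed.

Lemma cmod_circle_sub z r t : 0 <= r -> cmod (circle z r t - z) = r.
Proof. by move=> r0; rewrite circle_sub cmod_polar. Qed.

Lemma cmod_circle_sqr z r t :
  cmod (circle z r t) ^+ 2 = cmod z ^+ 2 + r ^+ 2 + 2 * r * (z.1 * cos t + z.2 * sin t).
Proof.
rewrite !cmod_sqr/=.
have -> : r ^+ 2 = r ^+ 2 * (cos t ^+ 2 + sin t ^+ 2) by rewrite cos2Dsin2 mulr1.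
by ring.
Qed.

Lemma circle_shift z a r t : circle z r t - a = circle (z - a) r t.
Proof. by rewrite /circle; congr (_, _) => /=; ring. Qed.

(** The angle is confined to one period because [integral_periodic] takes shifts in [0, 2 pi], and
    because [annulus_path] bounds differences of angles. *)
Lemma polar z : exists2 t, 0 <= t <= 2 * pi & z = (cmod z * cos t, cmod z * sin t).
Proof.
have [z0|z0] := eqVneq (cmod z) 0.
  exists 0; first by rewrite lexx/= mulr_ge0// pi_ge0.
  by rewrite z0 !mul0r; exact: cmod_eq0.
have zp : 0 < cmod z by rewrite lt_neqAle eq_sym z0 cmod_ge0.
pose x := z.1 / cmod z.
have x1 : -1 <= x <= 1.
  by rewrite -ler_norml normrM normfV (ger0_norm (cmod_ge0 _)) ler_pdivrMr// mul1r norm_fst_le.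
have xE : z.1 = cmod z * x by rewrite /x mulrC divfK.
have c0 := acos_ge0 x1; have cpi := acos_lepi x1.
have y2 : cmod z * sin (acos x) = `|z.2|.
  rewrite sin_acos// -(sqrtr_sqr z.2) -[X in X * _]ger0_norm ?cmod_ge0//.
  rewrite -sqrtr_sqr -sqrtrM ?sqr_ge0//; congr Num.sqrt.
  by rewrite mulrBr mulr1 -exprMn -xE cmod_sqr addrC addKr.
have [z2|z2] := leP 0 z.2.
  exists (acos x); first by rewrite c0/= (le_trans cpi)// ler_peMl ?pi_ge0// ler1n.
  by rewrite acosK ?in_itv//= -xE y2 ger0_norm//; case: (z).
exists (pi *+ 2 - acos x).
  rewrite mulr_natl subr_ge0 gerBl c0 andbT (le_trans cpi)// -mulr_natl ler_peMl// ?pi_ge0//.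
  by rewrite ler1n.
rewrite cosB sinB cos2pi sin2pi !mul0r !mul1r addr0 sub0r acosK ?in_itv//= -xE mulrN y2.
by rewrite ltr0_norm// opprK; case: (z).
Qed.

Lemma nbhs_cmodP z (V : set C) : nbhs z V <->
  exists2 r, 0 < r & forall w, cmod (w - z) < r -> V w.
Proof.
split=> [/nbhs_ballP[r /= r0 rV]|[r r0 rV]].
  exists r => // w wz; apply: rV; split => /=.
    by rewrite -ball_normE/= distrC (le_lt_trans (norm_fst_le (w - z))).
  by rewrite -ball_normE/= distrC (le_lt_trans (norm_snd_le (w - z))).
apply/nbhs_ballP; exists (r / 2) => /=; first by rewrite divr_gt0.
move=> w [/=]; rewrite -!ball_normE/= => w1 w2; apply: rV.
apply: le_lt_trans (cmod_le_sum _) _ => /=; rewrite distrC (distrC w.2).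
by rewrite [ltRHS](splitr r) ltrD.
Qed.

Lemma cmod_dist_norm z w : `|cmod z - cmod w| <= cmod (z - w).
Proof.
rewrite ler_norml lerBlDr.
have h1 := cmod_triangle (z - w) w; rewrite subrK in h1; rewrite h1 andbT.
have h2 := cmod_triangle (w - z) z; rewrite subrK cmodC in h2.
by lra.
Qed.

Lemma continuous_cmod a : continuous (fun z : C => cmod (z - a)).
Proof.
move=> z; apply/cvgrPdist_lt => e e0.
apply/nbhs_cmodP; exists e => // w wz /=.
by apply: le_lt_trans (cmod_dist_norm _ _) _; rewrite opprB addrA subrK cmodC.
Qed.

Lemma closed_cmod_preimage a (A : set R) : closed A -> closed [set z : C | A (cmod (z - a))].
Proof.
by move=> cA; apply: (preimage_closed _ cA) => z _; exact: continuous_cmod.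
Qed.

Lemma open_cmod_preimage a (A : set R) : open A -> open [set z : C | A (cmod (z - a))].
Proof.
by move=> oA; apply: open_comp => // z _; exact: continuous_cmod.
Qed.

Lemma bounded_closed_compact (K : set C) r :
  closed K -> (forall z, K z -> cmod z <= r) -> compact K.
Proof.
move=> cK Kr.
apply: (subclosed_compact cK (compact_setX (@segment_compact R (- r) r) (@segment_compact R (- r) r))).
move=> z /Kr zr; split => /=; rewrite in_itv/= -ler_norml.
  exact: le_trans (norm_fst_le z) zr.
exact: le_trans (norm_snd_le z) zr.
Qed.

Lemma compact_cmod_bounded (K : set C) : compact K -> exists2 r, 0 < r & forall z, K z -> cmod z <= r.
Proof.
move=> cK.
have := @continuous_compact _ _ (fun z : C => cmod (z - 0)) K
  (continuous_subspaceT (@continuous_cmod 0)) cK.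
move=> /compact_bounded [M [_ MK]].
exists (`|M| + 1); first by rewrite ltr_wpDl.
move=> z Kz.
have : `|cmod (z - 0)| <= `|M| + 1.
  by apply: (MK (`|M| + 1)); [rewrite (le_lt_trans (ler_norm _))// ltrDl|exists z].
by rewrite subr0 ger0_norm ?cmod_ge0.
Qed.

(** The sigma-algebra here is the product one, so open sets have to be written as countable unions:
    [U] is the union of the squares with rational centre and half-side 1/(n+1) that it contains. *)
Lemma measurable_open (U : set C) : open U -> measurable U.
Proof.
move=> oU.
pose J := ((rat * rat) * nat)%type.
pose Q (i : J) : set C :=
  `]ratr i.1.1 - i.2.+1%:R^-1, ratr i.1.1 + i.2.+1%:R^-1[%classic `*`
  `]ratr i.1.2 - i.2.+1%:R^-1, ratr i.1.2 + i.2.+1%:R^-1[%classic.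
pose F (i : J) : set C := if `[< Q i `<=` U >] then Q i else set0.
have -> : U = \bigcup_i F i.
  apply/seteqP; split => [z Uz|z [i _]]; last first.
    by rewrite /F; case: asboolP => // QU /QU.
  have /nbhs_ballP[e /= e0 eU] : nbhs z U by exact: open_nbhs_nbhs.
  have [n ne] : exists n, n.+1%:R^-1 < e / 2.
    have [n _ /(_ n (leqnn n))] := near_infty_natSinv_lt (PosNum (divr_gt0 e0 (@ltr0Sn R 1))).
    by exists n.
  pose d : R := n.+1%:R^-1; rewrite -/d in ne.
  have d0 : 0 < d by rewrite invr_gt0.
  have ap (x : R) : exists q : rat, x - d < ratr q < x + d.
    have [q] := @rat_in_itvoo R (x - d) (x + d) (ltac:(lra)).
    by rewrite in_itv/= => h; exists q.
  have [p /andP[p1 p2]] := ap z.1; have [q /andP[q1 q2]] := ap z.2.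
  have Qz : Q ((p, q), n) z.
    by split => /=; rewrite in_itv/= -/d; apply/andP; split; lra.
  exists ((p, q), n) => //; rewrite /F; case: asboolP => // -[].
  move=> w [/=]; rewrite !in_itv/= -!/d => /andP[w1 w2] /andP[w3 w4].
  apply: eU; split => /=; rewrite -ball_normE/= ltr_norml; apply/andP; split; lra.
apply: countable_bigcupT_measurable => [|i]; first exact: countableP.
rewrite /F; case: ifP => // _.
by apply: measurableX.
Qed.

Lemma usc_measurable (u : C -> \bar R) : usc u -> measurable_fun setT u.
Proof.
move=> uu; apply: (measurability _ (ErealGenInftyO.measurableE R)).
move=> /= _ [_ [a ->]] <-; rewrite setTI; apply: measurable_open.
rewrite openE => z /=; rewrite in_itv/= => /uu[V Vz Vu].
by apply: filterS Vz => w /Vu; rewrite /= in_itv.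
Qed.

Lemma continuous_measurable (h : C -> R) : continuous h -> measurable_fun setT h.
Proof.
move=> ch; apply/measurable_EFinP; apply: usc_measurable => z a; rewrite lte_fin => hza.
exists (h @^-1` `]-oo, a[%classic) => [|w /=]; last by rewrite in_itv.
apply: ch; apply: open_nbhs_nbhs; split; first exact: interval_open.
by rewrite /= in_itv.
Qed.

Lemma circle_continuous z r : continuous (circle z r).
Proof.
have h1 : continuous (fun t => z.1 + r * cos t).
  by move=> t; apply: cvgD; [exact: cvg_cst|apply: cvgM; [exact: cvg_cst|exact: continuous_cos]].
have h2 : continuous (fun t => z.2 + r * sin t).
  by move=> t; apply: cvgD; [exact: cvg_cst|apply: cvgM; [exact: cvg_cst|exact: continuous_sin]].
by move=> t; exact: (cvg_pair (h1 t) (h2 t)).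
Qed.

Lemma measurable_circle z r : measurable_fun [set: R] (circle z r).
Proof.
apply: measurable_fun_pair; apply: measurable_funD => //; apply: measurable_funM => //.
  by apply: continuous_measurable_fun; exact: continuous_cos.
by apply: continuous_measurable_fun; exact: continuous_sin.
Qed.

Lemma two_pi_gt0 : 0 < 2 * pi :> R.
Proof. by rewrite mulr_gt0// pi_gt0. Qed.

Lemma ge0_integral_itv_translate (F : R -> \bar R) (b c s : R) :
  measurable_fun setT F -> (forall t, (0 <= F t)%E) ->
  (\int[mu]_(t in `[b, c]) F (t + s)%R = \int[mu]_(t in `[(b + s)%R, (c + s)%R]) F t)%E.
Proof.
move=> mF F0; rewrite integral_mkcond [RHS]integral_mkcond.
rewrite [RHS](@ge0_integral_affine R 1 s)// ?mul1e; last 2 first.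
- by apply/(measurable_restrictT _ _).1 => //; exact: measurable_funTS.
- by move=> t; rewrite patchE; case: ifP.
apply: eq_integral => t _; rewrite !patchE mul1r.
have -> : (t + s \in `[b + s, c + s]%classic) = (t \in `[b, c]%classic) => //.
by apply/idP/idP; rewrite !inE/= !in_itv/= !lerD2r.
Qed.

Lemma ge0_integral_itv_split (F : R -> \bar R) (b c d : R) : b <= c -> c <= d ->
  measurable_fun setT F -> (forall t, (0 <= F t)%E) ->
  (\int[mu]_(t in `[b, d]) F t = \int[mu]_(t in `[b, c]) F t + \int[mu]_(t in `[c, d]) F t)%E.
Proof.
move=> bc cd mF F0.
rewrite (@itv_bndbnd_setU _ _ (BLeft b) (BRight c) (BRight d)) ?bnd_simp//.
rewrite ge0_integral_setU//=; last 2 first.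
- exact: measurable_funTS.
- apply/disj_setPS => x /= []; rewrite !in_itv/= => /andP[_ xc] /andP[cx _].
  by move: (lt_le_trans cx xc); rewrite ltxx.
by congr (_ + _)%E; rewrite integral_itv_obnd_cbnd//; exact: measurable_funTS.
Qed.

Lemma ge0_integral_periodic (F : R -> \bar R) (s : R) : 0 <= s <= 2 * pi ->
  measurable_fun setT F -> (forall t, (0 <= F t)%E) -> (forall t, F (t + 2 * pi) = F t) ->
  (\int[mu]_(t in `[0%R, (2 * pi)%R]) F (t + s)%R = \int[mu]_(t in `[0%R, (2 * pi)%R]) F t)%E.
Proof.
move=> /andP[s0 s2] mF F0 FP.
rewrite ge0_integral_itv_translate// add0r.
rewrite (@ge0_integral_itv_split _ s (2 * pi))//; last by rewrite lerDl.
rewrite [RHS](@ge0_integral_itv_split _ 0 s)// addeC; congr (_ + _)%E.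
rewrite -{1}(add0r (2 * pi)) (addrC (2 * pi) s) -ge0_integral_itv_translate//.
by apply: eq_integral => t _.
Qed.

Lemma integral_periodic (F : R -> \bar R) (s : R) : 0 <= s <= 2 * pi ->
  measurable_fun setT F -> (forall t, F (t + 2 * pi) = F t) ->
  (\int[mu]_(t in `[0%R, (2 * pi)%R]) F (t + s)%R = \int[mu]_(t in `[0%R, (2 * pi)%R]) F t)%E.
Proof.
move=> s02 mF FP; rewrite [LHS]integralE [RHS]integralE.
have mFp : measurable_fun setT F^\+%E by exact: measurable_funepos.
have mFn : measurable_fun setT F^\-%E by exact: measurable_funeneg.
rewrite -(@ge0_integral_periodic F^\+%E s)//; last by move=> t; rewrite !funeposE FP.
rewrite -(@ge0_integral_periodic F^\-%E s)//; last by move=> t; rewrite !funenegE FP.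
by congr (_ - _)%E; apply: eq_integral => t _; rewrite ?funeposE ?funenegE.
Qed.

End Plane.

(** * Circle means of the logarithm *)

Section LogMean.
Variable R : realType.
Local Notation C := (R * R)%type.
Local Notation mu := (@lebesgue_measure R).
Implicit Types (r s t rho phi : R) (z w a : C) (N n : nat).

(** With w = rho e^(i(N t + phi)) this is ln |1 + w|^2. The frequency [N] is a parameter because
    squaring w doubles it. *)
Definition logcos N rho phi t : R := ln (1 + 2 * rho * cos (N%:R * t + phi) + rho ^+ 2).

Definition logcos_integral N rho phi : \bar R :=
  (\int[mu]_(t in `[0%R, (2 * pi)%R]) (logcos N rho phi t)%:E)%E.

Lemma logcos_arg_gt0 rho t : 0 <= rho < 1 -> 0 < 1 + 2 * rho * cos t + rho ^+ 2.
Proof.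
move=> /andP[r0 r1]; have := cos_geN1 t => c1.
have : rho * -1 <= rho * cos t by exact: ler_wpM2l.
have : 0 < (1 - rho) ^+ 2 by rewrite exprn_gt0// subr_gt0.
have -> : (1 - rho) ^+ 2 = 1 - 2 * rho + rho ^+ 2 by ring.
lra.
Qed.

Lemma continuous_logcos N rho phi : 0 <= rho < 1 -> continuous (logcos N rho phi).
Proof.
move=> rho1 t; apply: continuous_comp; last first.
  by apply: continuous_ln; exact: logcos_arg_gt0.
apply: cvgD; last exact: cvg_cst.
apply: cvgD; first exact: cvg_cst.
apply: cvgM; first exact: cvg_cst.
apply: continuous_comp; last exact: continuous_cos.
by apply: cvgD; [apply: cvgM; [exact: cvg_cst|exact: cvg_id]|exact: cvg_cst].
Qed.

Lemma integrable_continuous_itv (h : R -> R) (b c : R) : continuous h ->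
  mu.-integrable `[b, c] (EFin \o h).
Proof.
move=> ch; apply: continuous_compact_integrable; first exact: segment_compact.
exact: continuous_subspaceT.
Qed.

Lemma cosDpi t : cos (t + pi) = - cos t.
Proof. by rewrite cosD cospi sinpi; ring. Qed.

Lemma integral_itv_cst (b c k : R) : b <= c ->
  (\int[mu]_(t in `[b, c]) k%:E = (k * (c - b))%:E)%E.
Proof.
move=> bc; rewrite integral_cst//= lebesgue_measure_itv/= lte_fin.
have [b_c|] := ltP b c; first by rewrite -EFinB -EFinM.
by move=> cb; have -> : c = b by [apply/le_anti; rewrite bc cb]; rewrite subrr mule0 mulr0.
Qed.

(** This integrates ln |1 + w|^2 + ln |1 - w|^2 = ln |1 - w^2|^2. Shifting [t] by [pi / N] turns w
    into -w without changing the integral, and the phase [pi] on the right is the sign of -w^2. *)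
Lemma logcos_integral_double N rho phi : (0 < N)%N -> 0 <= rho < 1 ->
  (logcos_integral N rho phi + logcos_integral N rho phi =
   logcos_integral N.*2 (rho ^+ 2)%R (2 * phi + pi)%R)%E.
Proof.
move=> N0 rho1.
have N0' : (N%:R : R) != 0 by rewrite pnatr_eq0 -lt0n.
have cG := @continuous_logcos N rho phi rho1.
have cG2 := @continuous_logcos N rho (phi + pi) rho1.
have -> : (logcos_integral N rho phi + logcos_integral N rho phi =
    logcos_integral N rho phi + logcos_integral N rho (phi + pi))%E.
  congr (_ + _)%E; rewrite -[LHS](@integral_periodic R _ (pi / N%:R)).
  - apply: eq_integral => t _; rewrite /logcos; congr (ln (_ + _ * cos _ + _))%:E.
    by field.
  - rewrite divr_ge0 ?pi_ge0//= ler_pdivrMr ?ltr0n// (mulrC 2) -mulrA ler_peMr ?pi_ge0//.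
    by rewrite -natrM ler1n muln_gt0 N0.
  - by apply/measurable_EFinP; exact: continuous_measurable_fun.
  - move=> t; rewrite /logcos mulrDr [N%:R * t + _ + phi]addrAC.
    have -> : N%:R * (2 * pi) = (pi *+ 2) *+ N :> R.
      by rewrite mulr_natl (mulr_natl pi 2).
    by rewrite (periodicn (@cosD2pi R)).
rewrite -integralD//; last 2 first.
- exact: (integrable_continuous_itv _ _ cG).
- exact: (integrable_continuous_itv _ _ cG2).
apply: eq_integral => t _; rewrite -EFinD; congr EFin.
have e0 : 0 <= rho ^+ 2 < 1 by move/andP : rho1 => [r0 r1]; rewrite sqr_ge0 expr_lt1.
rewrite /logcos -lnM ?posrE ?logcos_arg_gt0//; congr ln.
have -> : N.*2%:R * t + (2 * phi + pi) = (N%:R * t + phi) *+ 2 + pi.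
  by rewrite -muln2 natrM mulr2n; ring.
by rewrite addrA !cosDpi cos_mulr2n; ring.
Qed.

(** Doubling n times writes the integral as 2^-n times an integral of the same kind, and each of
    those is at most 2 pi ln 4 because the argument of the logarithm stays below 4. This takes the
    place of the mean value property of harmonic functions. *)
Lemma logcos_integral_le0 N rho phi : (0 < N)%N -> 0 <= rho < 1 ->
  (logcos_integral N rho phi <= 0)%E.
Proof.
move=> N0 rho1.
have H n : forall N rho phi, (0 < N)%N -> 0 <= rho < 1 ->
    (logcos_integral N rho phi <= (ln 4 * (2 * pi) * (1 / 2 ^+ n))%:E)%E.
  elim: n => [|n IHn] {N0 rho1}N {}rho {}phi N0 rho1.
    rewrite expr0 divr1 mulr1 -[X in _ * X]subr0.
    rewrite -integral_itv_cst; last exact: ltW (two_pi_gt0 R).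
    apply: le_integral => //=.
    - exact: (integrable_continuous_itv _ _ (@continuous_logcos N rho phi rho1)).
    - by apply: (integrable_continuous_itv _ _ (_ : continuous (cst (ln 4)))) => ?; exact: cvg_cst.
    move=> t _; rewrite lee_fin ler_ln ?posrE ?logcos_arg_gt0//.
    have c1 := cos_le1 (N%:R * t + phi).
    have /andP[r0 r1] := rho1.
    have : rho * cos (N%:R * t + phi) <= rho * 1 by exact: ler_wpM2l.
    have : rho ^+ 2 < 1 by rewrite expr_lt1.
    lra.
  have e0 : 0 <= rho ^+ 2 < 1 by move/andP : rho1 => [r0 r1]; rewrite sqr_ge0 expr_lt1.
  have := IHn N.*2 (rho ^+ 2) (2 * phi + pi) _ e0; rewrite double_gt0 N0 => /(_ isT).
  rewrite -logcos_integral_double//.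
  have -> : ln 4 * (2 * pi) * (1 / 2 ^+ n) = 2 * (ln 4 * (2 * pi) * (1 / 2 ^+ n.+1)) :> R.
    by rewrite exprS; field; rewrite expf_neq0.
  case: (logcos_integral N rho phi) => [x| |] /=; rewrite ?leye_eq ?leNye//.
  by rewrite -EFinD !lee_fin; lra.
apply/lee_addgt0Pr => e e0; rewrite add0e.
have k0 : 0 < ln 4 * (2 * pi) :> R by rewrite mulr_gt0 ?two_pi_gt0// ln_gt0// ltr1n.
have [n _ /(_ n (leqnn n)) /= ne] := near_infty_natSinv_expn_lt (PosNum (divr_gt0 e0 k0)).
apply: le_trans (H n N rho phi N0 rho1) _.
by rewrite lee_fin mulrC -ler_pdivlMr// ltW.
Qed.

Lemma ln_cmod_circle z r t : 0 < cmod z -> 0 <= r < cmod z ->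
  exists phi, forall t, ln (cmod (circle z r t)) =
    ln (cmod z) + 2^-1 * logcos 1 (r / cmod z) phi t.
Proof.
move=> z0 /andP[r0 rz]; have [s _ zE] := polar z.
exists (- s) => {}t.
have rho1 : 0 <= r / cmod z < 1 by rewrite divr_ge0 ?(ltW z0)//= ltr_pdivrMr ?mul1r.
have cE : cmod (circle z r t) ^+ 2 =
  cmod z ^+ 2 * (1 + 2 * (r / cmod z) * cos (1%:R * t - s) + (r / cmod z) ^+ 2).
  rewrite cmod_circle_sqr {2 3}zE/= mul1r cosB; field; exact: lt0r_neq0.
have c0 : 0 < cmod (circle z r t).
  rewrite lt0r cmod_ge0 andbT -sqrf_eq0 cE.
  by rewrite mulf_neq0// ?expf_neq0 ?lt0r_neq0// logcos_arg_gt0.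
apply: (mulfI (_ : 2%:R != 0)); first by rewrite pnatr_eq0.
rewrite mulr_natl -lnXn// cE lnM ?posrE ?exprn_gt0 ?logcos_arg_gt0// lnXn//.
by rewrite -(mulr_natl (ln (cmod z))) [RHS]mulrDr mulVKf ?pnatr_eq0.
Qed.

(** The pole [a] lies outside the closed disc, so ln |z - a| factors out of the integrand and half
    an integral of [logcos] remains. *)
Lemma ln_cmod_supermean z a r : 0 <= r < cmod (z - a) ->
  (\int[mu]_(t in `[0%R, (2 * pi)%R]) (ln (cmod (circle z r t - a)))%:E <=
   (2 * pi * ln (cmod (z - a)))%:E)%E.
Proof.
move=> /andP[r0 rz]; have z0 : 0 < cmod (z - a) by exact: le_lt_trans rz.
have rho1 : 0 <= r / cmod (z - a) < 1 by rewrite divr_ge0 ?(ltW z0)//= ltr_pdivrMr ?mul1r.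
have [|phi cE] := @ln_cmod_circle (z - a) r 0 z0; first by rewrite r0.
under eq_integral do rewrite circle_shift cE EFinD EFinM.
have il := integrable_continuous_itv 0 (2 * pi) (@continuous_logcos 1 _ phi rho1).
rewrite integralD//; last 2 first.
- by apply: (integrable_continuous_itv _ _ (_ : continuous (cst _))) => ?; exact: cvg_cst.
- exact: integrableZl.
rewrite integral_itv_cst; last exact: ltW (two_pi_gt0 R).
rewrite subr0 mulrC integralZl// -[leRHS]adde0 leeD2l// mule_ge0_le0 ?lee_fin//.
exact: logcos_integral_le0.
Qed.

End LogMean.

(** * Maximum principle *)

Section MaximumPrinciple.
Variable R : realType.
Local Notation C := (R * R)%type.
Local Notation mu := (@lebesgue_measure R).
Implicit Types (r s t : R) (z w a p : C) (u : C -> \bar R) (h : C -> R).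

Lemma ereal_real_between (x y : \bar R) : (x < y)%E -> exists q : R, (x < q%:E < y)%E.
Proof.
case: x y => [x| |] [y| |] //.
- rewrite lte_fin => xy; exists ((x + y) / 2); rewrite !lte_fin; apply/andP; split; lra.
- by move=> _; exists (x + 1); rewrite lte_fin ltry ltrDl ltr01.
- by move=> _; exists (y - 1); rewrite ltNyr lte_fin gtrDl ltrN10.
- by move=> _; exists 0; rewrite ltNyr ltry.
Qed.

Lemma le_integral_measurable (D : set R) (f g : R -> \bar R) : measurable D ->
  measurable_fun D f -> measurable_fun D g -> (forall t, D t -> (f t <= g t)%E) ->
  (\int[mu]_(t in D) f t <= \int[mu]_(t in D) g t)%E.
Proof.
move=> mD mf mg fg; rewrite [leLHS]integralE [leRHS]integralE.
apply: leeB; apply: ge0_le_integral => //.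
- exact: measurable_funepos.
- exact: measurable_funepos.
- by move=> t Dt; rewrite !funeposE ge_max le_max fg//= le_max lexx orbT.
- exact: measurable_funeneg.
- exact: measurable_funeneg.
- by move=> t Dt; rewrite !funenegE ge_max le_max leeN2 fg//= le_max lexx orbT.
Qed.

(** If the supremum S is not attained, each point of [K] has a neighbourhood on which [u] stays
    below some real q < S. Compactness along the filter [F] of reals tending to S from below yields
    one such real for all of [K], contradicting the choice of S. *)
Lemma usc_attains_max u (K : set C) : compact K -> K !=set0 ->
  (forall z b, K z -> (u z < b%:E)%E -> \forall w \near z, (u w < b%:E)%E) ->
  exists2 z, K z & forall w, K w -> (u w <= u z)%E.
Proof.
move=> cK [k0 Kk0] uK; apply: contrapT => /forall2NP H.
pose S := ereal_sup (u @` K).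
have uS z : K z -> (u z < S)%E.
  move=> Kz; have [|/existsNP[w /not_implyP[Kw /negP]]] := H z; first by [].
  by rewrite -ltNge => /lt_le_trans; apply; apply: ereal_sup_ubound; exists w.
pose F : set_system R :=
  fun P => exists2 b, (b < S)%E & forall x : R, (b < x%:E)%E -> (x%:E < S)%E -> P x.
have FF : Filter F.
  split.
  - by exists (u k0) => //; exact: uS.
  - move=> P Q [b bS bP] [c cS cQ]; exists (maxe b c); first by rewrite gt_max bS.
    by move=> x; rewrite gt_max => /andP[bx cx] xS; split; [exact: bP|exact: cQ].
  - by move=> P Q PQ [b bS bP]; exists b => // x bx xS; apply: PQ; exact: bP.
move: cK => /compact_near_coveringP /(_ R F (fun x w => (u w <= x%:E)%E) FF) [].
  move=> z Kz; have [q /andP[zq qS]] := ereal_real_between (uS z Kz).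
  exists ([set w | (u w < q%:E)%E], [set x | q <= x]) => /=.
    split; first exact: uK.
    by exists q%:E => // x; rewrite lte_fin => qx _; exact: ltW.
  by move=> [w x] [/= wq qx]; apply: (le_trans (ltW wq)); rewrite lee_fin.
move=> b bS bP; have [x /andP[bx xS]] := ereal_real_between bS.
have : (S <= x%:E)%E by apply: ge_ereal_sup => _ [w Kw <-]; exact: bP.
by rewrite leNgt xS.
Qed.

Lemma subharmonic_circle u z r : subharmonic u -> 0 < r ->
  (u z <= ((2 * pi)^-1)%:E * \int[mu]_(t in `[0%R, (2 * pi)%R]) u (circle z r t))%E.
Proof. by move=> [_ _ _ /(_ z r)]. Qed.

Lemma subharmonic_measurable u : subharmonic u -> measurable_fun setT u.
Proof. by move=> [_ + _ _]; exact: usc_measurable. Qed.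

Lemma subharmonic_measurable_circle u z r : subharmonic u ->
  measurable_fun setT (fun t => u (circle z r t)).
Proof.
move=> /subharmonic_measurable mu'.
by apply: (measurableT_comp mu'); exact: measurable_circle.
Qed.

(* If [u] is not integrable on the circle, then its mean there, hence [u z], is
   [-oo] and the right-hand side is [+oo]. *)
Lemma supermean_sub u h z r : subharmonic u -> 0 < r ->
  continuous (fun t => h (circle z r t)) ->
  (forall t, (u (circle z r t) <= (h (circle z r t))%:E)%E) ->
  (\int[mu]_(t in `[0%R, (2 * pi)%R]) (h (circle z r t))%:E <= (2 * pi * h z)%:E)%E ->
  (\int[mu]_(t in `[0%R, (2 * pi)%R]) ((h (circle z r t))%:E - u (circle z r t)) <=
    (2 * pi)%:E * ((h z)%:E - u z))%E.
Proof.
move=> su r0 ch uh hz; have p0 := two_pi_gt0 R.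
have muc := subharmonic_measurable_circle z r su.
have ih := integrable_continuous_itv 0 (2 * pi) ch.
have uz := subharmonic_circle z su r0.
have [iu|niu] := pselect (mu.-integrable `[0, 2 * pi] (fun t => u (circle z r t))).
  rewrite integralB//.
  have iuf : (\int[mu]_(t in `[0%R, (2 * pi)%R]) u (circle z r t))%E \is a fin_num.
    exact: integrable_fin_num.
  move: uz; rewrite -(fineK iuf).
  set m := fine _ => uz.
  apply: (@le_trans _ _ ((2 * pi * h z)%:E - m%:E)%E).
    by rewrite leeB.
  move: uz; rewrite -EFinM; case: (u z) => [x| |]//; last first.
    by rewrite /= gt0_muley ?lte_fin// leey.
  rewrite !lee_fin mulrBr => uz; rewrite lerB//.
  by rewrite -ler_pdivlMl.
have um : (\int[mu]_(t in `[0%R, (2 * pi)%R]) u (circle z r t) = -oo)%E.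
  rewrite integralE.
  have up : (\int[mu]_(t in `[0%R, (2 * pi)%R]) (fun t => u (circle z r t))^\+ t < +oo)%E.
    apply: le_lt_trans (integral_funepos_lt_pinfty _ ih); last exact: measurable_itv.
    apply: ge0_le_integral => //=.
    - by apply: measurable_funepos; exact: measurable_funTS.
    - by apply: measurable_funepos; apply/measurable_EFinP; apply: measurable_funTS; exact: continuous_measurable_fun.
    - by move=> t _; rewrite !funeposE ge_max le_max uh//= le_max lexx orbT.
  have un : (\int[mu]_(t in `[0%R, (2 * pi)%R]) (fun t => u (circle z r t))^\- t = +oo)%E.
    apply/eqP; rewrite -leye_eq leNgt; apply/negP => un.
    apply: niu; apply/integrableP; split; first exact: measurable_funTS.
    under eq_integral do rewrite -/((abse \o (fun t => u (circle z r t))) _) fune_abse.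
    rewrite ge0_integralD//.
    - by rewrite lte_add_pinfty.
    - by apply: measurable_funepos; exact: measurable_funTS.
    - by apply: measurable_funeneg; exact: measurable_funTS.
  by rewrite un addeNy.
move: uz; rewrite um gt0_muleNy ?lte_fin ?invr_gt0// leeNy_eq => /eqP ->.
by rewrite /= addeC addye// gt0_muley ?lte_fin// leey.
Qed.

(** The excess [r ^+ 2] over the value at the centre is what makes the perturbation in
    [max_principle] strict. The cross term integrates to 0 because a half turn changes its sign. *)
Lemma integral_cmod_sqr_circle z r :
  (\int[mu]_(t in `[0%R, (2 * pi)%R]) (cmod (circle z r t) ^+ 2)%:E =
   (2 * pi * (cmod z ^+ 2 + r ^+ 2))%:E)%E.
Proof.
pose F t := z.1 * cos t + z.2 * sin t.
have cF : continuous F.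
  move=> t; apply: cvgD; (apply: cvgM; first exact: cvg_cst).
    exact: continuous_cos.
  exact: continuous_sin.
have iF := integrable_continuous_itv 0 (2 * pi) cF.
have F0 : (\int[mu]_(t in `[0%R, (2 * pi)%R]) (F t)%:E = 0)%E.
  have E : (\int[mu]_(t in `[0%R, (2 * pi)%R]) (F t)%:E = - \int[mu]_(t in `[0%R, (2 * pi)%R]) (F t)%:E)%E.
    rewrite -[LHS](@integral_periodic R _ pi).
    - rewrite -integralN; last exact: integrable_add_def.
      apply: eq_integral => t _; rewrite -EFinN; congr EFin.
      by rewrite /F cosDpi sinD cospi sinpi; ring.
    - by rewrite pi_ge0/= ler_peMl ?pi_ge0// ler1n.
    - by apply/measurable_EFinP; exact: continuous_measurable_fun.
    - move=> t; rewrite /F (mulr_natl pi 2); congr (_ * _ + _ * _)%:E; [exact: cosD2pi|exact: sinD2pi].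
  have : (\int[mu]_(t in `[0%R, (2 * pi)%R]) (F t)%:E)%E \is a fin_num.
    exact: integrable_fin_num.
  move: E; rewrite /=; case: (integral _ _ _) => [x| |]//.
  by rewrite -EFinN => -[xx] _; congr EFin; lra.
under eq_integral do rewrite cmod_circle_sqr EFinD (EFinM (2 * r)).
rewrite integralD//; last 2 first.
- by apply: (integrable_continuous_itv _ _ (_ : continuous (cst _))) => ?; exact: cvg_cst.
- exact: integrableZl.
rewrite integral_itv_cst ?(ltW (two_pi_gt0 R))// integralZl//.
by rewrite [X in (_ + _ * X)%E]F0 mule0 adde0 subr0 mulrC.
Qed.

(** Adding [eta * (L ^+ 2 - cmod z ^+ 2)] to [h] makes the supermean inequality strict. A positive
    maximum of the difference at a point of [U] is then refuted by one circle inside [K], so nothing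
    has to be propagated along [U]; finally [eta] tends to 0. *)
Theorem max_principle u h (K U : set C) : subharmonic u -> compact K ->
  (forall z, K z -> {for z, continuous h}) ->
  (forall z, K z -> ~ U z -> (u z <= (h z)%:E)%E) ->
  (forall z, K z -> U z -> exists r, [/\ 0 < r, forall t, K (circle z r t) &
    (\int[mu]_(t in `[0%R, (2 * pi)%R]) (h (circle z r t))%:E <= (2 * pi * h z)%:E)%E]) ->
  forall z, K z -> (u z <= (h z)%:E)%E.
Proof.
move=> su cK ch uh hU.
have [L L0 KL] := compact_cmod_bounded cK.
suff H eta z : 0 < eta -> K z -> (u z <= (h z + eta * (L ^+ 2 - cmod z ^+ 2))%:E)%E.
  move=> z Kz; apply/lee_addgt0Pr => e e0.
  apply: le_trans (H (e / L ^+ 2) z _ Kz) _; first by rewrite divr_gt0// exprn_gt0.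
  rewrite lee_fin lerD2l mulrBr divfK ?expf_neq0 ?lt0r_neq0//.
  by rewrite gerBl mulr_ge0// ?sqr_ge0// divr_ge0// ?sqr_ge0// ltW.
move=> eta0; pose g w := h w + eta * (L ^+ 2 - cmod w ^+ 2).
have cg w : K w -> {for w, continuous g}.
  move=> Kw; apply: cvgD; first exact: ch.
  apply: cvgM; first exact: cvg_cst.
  apply: cvgB; first exact: cvg_cst.
  have cc : continuous (fun w : C => cmod w).
    have -> : (fun w : C => cmod w) = (fun w => cmod (w - 0)) by apply/funext => x; rewrite subr0.
    exact: continuous_cmod.
  by apply: cvgM; exact: cc.
have hg w : K w -> h w <= g w.
  move=> Kw; rewrite lerDl mulr_ge0 ?(ltW eta0)// subr_ge0 ler_sqr ?nnegrE ?cmod_ge0 ?KL// ltW//.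
have [_ uu _ _] := su; have [ult _ _ _] := su.
move=> Kz.
have [||z0 Kz0 zmax] := @usc_attains_max (fun w => (u w - (g w)%:E)%E) K cK.
- by exists z.
- move=> w b Kw; rewrite lteBlDr// -EFinD => /ereal_real_between[q /andP[uq qb]].
  have [V nV Vq] := uu w q uq.
  rewrite lte_fin in qb.
  have : \forall x \near w, g w - (g w + b - q) / 2 < g x.
    by apply: (cvgr_gt (g w) (cg w Kw)); rewrite gtrBl divr_gt0// subr_gt0 addrC.
  apply: filterS2 nV => x Vx gx.
  rewrite lteBlDr// -EFinD; apply: lt_trans (Vq _ Vx) _.
  by rewrite lte_fin; lra.
rewrite leNgt; apply/negP => gu.
have m0 : (0 < u z0 - (g z0)%:E)%E.
  by apply: lt_le_trans (zmax _ Kz); rewrite sube_gt0.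
have [x ux] : exists x, u z0 = x%:E.
  move: m0 (ult z0); case: (u z0) => [x| |]//; first by exists x.
rewrite ux -EFinB lte_fin in m0; pose m := x - g z0.
have Uz0 : U z0.
  apply: contrapT => /(uh _ Kz0); rewrite ux lee_fin => /le_trans /(_ (hg _ Kz0)).
  by rewrite leNgt -subr_gt0 m0.
have [r [r0 Kr hr]] := hU z0 Kz0 Uz0.
have chc : continuous (fun t => h (circle z0 r t)).
  by move=> t; apply: continuous_comp; [exact: circle_continuous|exact: ch].
have csc : continuous (fun t => cmod (circle z0 r t) ^+ 2).
  move=> t; have cc : {for t, continuous (fun t => cmod (circle z0 r t))}.
    apply: continuous_comp; first exact: circle_continuous.
    have -> : cmod (R := R) = (fun w => cmod (w - 0)) by apply/funext => y; rewrite subr0.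
    exact: continuous_cmod.
  by apply: cvgM; exact: cc.
pose k := eta * L ^+ 2 + m.
have ih := integrable_continuous_itv 0 (2 * pi) chc.
have isq := integrable_continuous_itv 0 (2 * pi) csc.
have ik : mu.-integrable `[0, 2 * pi] (fun t => (- eta)%:E * (cmod (circle z0 r t) ^+ 2)%:E + k%:E)%E.
  apply: integrableD => //; first exact: integrableZl.
  by apply: (integrable_continuous_itv _ _ (_ : continuous (cst _))) => ?; exact: cvg_cst.
(* On the circle [u] is at most [g + m], with equality at the centre, where the value is [x].
   Averaging [g] loses [eta * r ^+ 2]. *)
have I1 : (\int[mu]_(t in `[0%R, (2 * pi)%R]) u (circle z0 r t) <=
    (2 * pi * (x - eta * r ^+ 2))%:E)%E.
  apply: (@le_trans _ _ (\int[mu]_(t in `[0%R, (2 * pi)%R])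
    ((h (circle z0 r t))%:E + ((- eta)%:E * (cmod (circle z0 r t) ^+ 2)%:E + k%:E)))%E).
    apply: le_integral_measurable => //.
    - by apply: measurable_funTS; exact: subharmonic_measurable_circle.
    - apply: emeasurable_funD; [exact: measurable_int ih|exact: measurable_int ik].
    - move=> t _; have := zmax _ (Kr t); rewrite ux -EFinB -/m leeBlDr// => /le_trans; apply.
      by rewrite -EFinM -!EFinD lee_fin /g /k; lra.
  rewrite integralD//= integralD//; last 2 first.
  - exact: integrableZl.
  - by apply: (integrable_continuous_itv _ _ (_ : continuous (cst _))) => ?; exact: cvg_cst.
  rewrite integralZl// integral_cmod_sqr_circle integral_itv_cst ?(ltW (two_pi_gt0 R))//.
  apply: le_trans (leeD2r _ hr) _.
  rewrite -EFinM -!EFinD lee_fin /k /m /g.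
  by rewrite le_eqVlt; apply/orP; left; apply/eqP; ring.
have := subharmonic_circle z0 su r0; rewrite ux => /le_trans.
have p0 := two_pi_gt0 R.
have pV : (0 <= ((2 * pi)^-1)%:E :> \bar R)%E by rewrite lee_fin invr_ge0 ltW.
move=> /(_ _ (lee_wpmul2l pV I1)).
rewrite -EFinM mulKf ?lt0r_neq0// lee_fin lerDl oppr_ge0 leNgt.
by rewrite mulr_gt0// exprn_gt0.
Qed.

Lemma ln_cmod_continuous a z : z != a -> {for z, continuous (fun w : C => ln (cmod (w - a)))}.
Proof.
move=> za; apply: continuous_comp; first exact: continuous_cmod.
apply: continuous_ln; rewrite lt0r cmod_ge0 andbT; apply: contra za.
by move=> /eqP/cmod_eq0/eqP; rewrite subr_eq0.
Qed.

Lemma cmod_circle_le z a r t : 0 <= r -> cmod (circle z r t - a) <= r + cmod (z - a).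
Proof.
by move=> r0; apply: le_trans (cmod_dist_triangle z _ _) _; rewrite cmod_circle_sub.
Qed.

Lemma cmod_circle_ge z a r t : 0 <= r -> cmod (z - a) - r <= cmod (circle z r t - a).
Proof.
move=> r0; rewrite lerBlDl; apply: le_trans (cmod_dist_triangle (circle z r t) _ _) _.
by rewrite cmodC cmod_circle_sub.
Qed.

Lemma compact_annulus a (r1 r2 : R) : compact [set z : C | r1 <= cmod (z - a) <= r2].
Proof.
apply: (@bounded_closed_compact R _ (r2 + cmod a)).
  rewrite (_ : [set _ | _] = [set z : C | `[r1, r2]%classic (cmod (z - a))]).
    by apply: closed_cmod_preimage; exact: interval_closed.
  by apply/seteqP; split => z /=; rewrite in_itv.
move=> z /= /andP[_ z2]; rewrite -[z](subrK a).
by apply: le_trans (cmod_triangle _ _) _; rewrite lerD2r.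
Qed.

(* The comparison functions are [b + s ln|z - a| + s' ln|z - p|], with the pole
   [p] outside the annulus. *)
Lemma annulus_principle u a p (r1 r2 b s s' : R) : subharmonic u ->
  0 < r1 -> 0 <= s -> 0 <= s' ->
  (forall z, r1 <= cmod (z - a) <= r2 -> z != p) ->
  (forall z, cmod (z - a) = r1 \/ cmod (z - a) = r2 ->
    (u z <= (b + s * ln (cmod (z - a)) + s' * ln (cmod (z - p)))%:E)%E) ->
  forall z, r1 <= cmod (z - a) <= r2 ->
    (u z <= (b + s * ln (cmod (z - a)) + s' * ln (cmod (z - p)))%:E)%E.
Proof.
move=> su r10 s0 s'0 Hp Hb.
have Ha z : r1 <= cmod (z - a) <= r2 -> z != a.
  by move=> /andP[za _]; apply: contraTneq (lt_le_trans r10 za) => ->; rewrite subrr cmod0 ltxx.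
apply: (@max_principle u (fun z => b + s * ln (cmod (z - a)) + s' * ln (cmod (z - p)))
  [set z | r1 <= cmod (z - a) <= r2] [set z | r1 < cmod (z - a) < r2] su).
- exact: compact_annulus.
- move=> z Kz; apply: cvgD; last first.
    by apply: cvgM; [exact: cvg_cst|apply: ln_cmod_continuous; exact: Hp].
  apply: cvgD; first exact: cvg_cst.
  by apply: cvgM; [exact: cvg_cst|apply: ln_cmod_continuous; exact: Ha].
- move=> z /= /andP[z1 z2] nU; apply: Hb.
  move: nU z1 z2; rewrite !le_eqVlt => nU /orP[/eqP ->|z1]; first by left.
  by move=> /orP[/eqP ->|z2]; [right|exfalso; apply: nU; rewrite z1].
move=> z /= Kz /andP[z1 z2].
have cp : 0 < cmod (z - p).
  rewrite lt0r cmod_ge0 andbT; apply: contra (Hp z Kz).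
  by move=> /eqP/cmod_eq0/eqP; rewrite subr_eq0.
(* The first two terms keep the circle in the annulus, hence away from [a]; the third keeps the pole
   [p] outside it. *)
pose r := Num.min (Num.min (cmod (z - a) - r1) (r2 - cmod (z - a))) (cmod (z - p) / 2).
have r0 : 0 < r by rewrite !lt_min !subr_gt0 z1 z2 divr_gt0.
have ra1 : r <= cmod (z - a) - r1 by rewrite /r !ge_min lexx.
have ra2 : r <= r2 - cmod (z - a) by rewrite /r !ge_min lexx orbT.
have rp : r < cmod (z - p) by rewrite /r gt_min; apply/orP; right; rewrite ltr_pdivrMr// ltr_pMr// ltr1n.
have ra : r < cmod (z - a) by lra.
have Kc t : r1 <= cmod (circle z r t - a) <= r2.
  apply/andP; split.
    by apply: le_trans (cmod_circle_ge _ _ _ (ltW r0)); lra.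
  by apply: le_trans (cmod_circle_le _ _ _ (ltW r0)) _; lra.
exists r; split => //.
have c1 q : (forall t, circle z r t != q) -> continuous (fun t => ln (cmod (circle z r t - q))).
  move=> Hq t.
  apply: (@continuous_comp _ _ _ (circle z r) (fun w => ln (cmod (w - q))) t).
    exact: circle_continuous.
  exact: ln_cmod_continuous.
have i1 q : (forall t, circle z r t != q) ->
    mu.-integrable `[0, 2 * pi] (fun t => (ln (cmod (circle z r t - q)))%:E).
  by move=> Hq; exact: (integrable_continuous_itv _ _ (c1 q Hq)).
have ia := i1 a (fun t => Ha _ (Kc t)); have ip := i1 p (fun t => Hp _ (Kc t)).
under eq_integral do rewrite !EFinD !EFinM.
rewrite integralD//; last 2 first.
- apply: integrableD => //; last exact: integrableZl.
  by apply: (integrable_continuous_itv _ _ (_ : continuous (cst _))) => ?; exact: cvg_cst.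
- exact: integrableZl.
rewrite integralD//; last 2 first.
- by apply: (integrable_continuous_itv _ _ (_ : continuous (cst _))) => ?; exact: cvg_cst.
- exact: integrableZl.
rewrite integral_itv_cst ?(ltW (two_pi_gt0 R))// !integralZl//.
rewrite [leRHS](_ : _ = ((b * (2 * pi - 0))%:E + s%:E * (2 * pi * ln (cmod (z - a)))%:E +
  s'%:E * (2 * pi * ln (cmod (z - p)))%:E)%E); last by rewrite -!EFinM -!EFinD; congr EFin; ring.
apply: leeD; first apply: leeD => //; apply: lee_wpmul2l; rewrite ?lee_fin//.
  by apply: ln_cmod_supermean; rewrite (ltW r0).
by apply: ln_cmod_supermean; rewrite (ltW r0).
Qed.

Lemma disc_principle u (r b : R) : subharmonic u -> 0 < r ->
  (forall z, cmod z = r -> (u z <= b%:E)%E) ->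
  forall z, cmod z <= r -> (u z <= b%:E)%E.
Proof.
move=> su r0 ub; apply: (@max_principle u (cst b) [set z | cmod z <= r] [set z | cmod z < r] su).
- apply: (@bounded_closed_compact R _ r) => //.
  rewrite (_ : [set _ | _] = [set z : C | `]-oo, r]%classic (cmod (z - 0)%R)]).
    by apply: closed_cmod_preimage; exact: interval_closed.
  by apply/seteqP; split => z /=; rewrite in_itv/= subr0.
- by move=> z _; exact: cvg_cst.
- move=> z /= zr zNr; apply: ub; apply/le_anti; rewrite zr/= leNgt; exact/negP.
move=> z /= _ zr; exists (r - cmod z); split; first by rewrite subr_gt0.
  move=> t; have := @cmod_circle_le z 0 (r - cmod z) t; rewrite !subr0 subrK; apply.
  by rewrite subr_ge0 ltW.
by rewrite integral_itv_cst ?(ltW (two_pi_gt0 R))// subr0 mulrC.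
Qed.

End MaximumPrinciple.

(** * Logarithmic growth *)

Section Growth.
Variable R : realType.
Local Notation C := (R * R)%type.
Local Notation mu := (@lebesgue_measure R).
Implicit Types (r s t : R) (z w a p : C) (u : C -> \bar R).

Lemma logtype_lt u s : (logtype u < s%:E)%E ->
  exists2 r, 1 < r & forall z, r < cmod z -> (u z <= (s * ln (cmod z))%:E)%E.
Proof.
move=> /ereal_inf_lt[_ [r /= r1 <-] us]; exists r => // z rz.
have l0 : 0 < ln (cmod z) by apply: ln_gt0; exact: lt_trans r1 rz.
have : (u z * (ln (cmod z))^-1%:E <= s%:E)%E.
  by apply: le_trans (ltW us); apply: ereal_sup_ubound; exists z.
by rewrite lee_pdivrMr// EFinM.
Qed.

Lemma logtype_le u r s b : 1 < r ->
  (forall z, r < cmod z -> (u z <= (s * ln (cmod z) + b)%:E)%E) -> (logtype u <= s%:E)%E.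
Proof.
move=> r1 H; apply/lee_addgt0Pr => e e0; rewrite -EFinD.
pose r' := Num.max r (expR (`|b| / e)).
apply: (@le_trans _ _ (ereal_sup [set (u z * (ln (cmod z))^-1%:E)%E | z in [set z : C | r' < cmod z]])).
  by apply: ereal_inf_lbound; exists r' => //=; rewrite /r' lt_max r1.
apply: ge_ereal_sup => _ [z /= + <-]; rewrite gt_max => /andP[rz ez].
have z1 := lt_trans r1 rz; have z0 := lt_trans ltr01 z1.
have l0 : 0 < ln (cmod z) by apply: ln_gt0.
rewrite lee_pdivrMr//; apply: le_trans (H z rz) _.
rewrite -EFinM lee_fin mulrDl lerD2l (le_trans (ler_norm _))//.
rewrite mulrC -ler_pdivrMr// ltW// -ltr_expR lnK//.
Qed.

(** A Phragmen-Lindelof argument: a type below [s] leaves a surplus (s - s') ln L on the circle of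
    radius [L], which absorbs every constant once [L] is large, so that the bound on the inner
    circle decides. *)
Lemma growth_lt u a s r0 b : subharmonic u -> 0 < s -> (logtype u < s%:E)%E -> 0 < r0 ->
  (forall w, cmod (w - a) = r0 -> (u w <= b%:E)%E) ->
  forall z, r0 <= cmod (z - a) -> (u z <= (b + s * (ln (cmod (z - a)) - ln r0))%:E)%E.
Proof.
move=> su s0 us r00 ub z rz.
have [s' /andP[]] : exists s', (maxe (logtype u) 0 < s'%:E < s%:E)%E.
  by apply: ereal_real_between; rewrite gt_max us lte_fin.
rewrite gt_max !lte_fin => /andP[us' s'0] ss'.
have [r r1 ur] := logtype_lt us'.
(* On the outer circle |w| <= 2 L, so the boundary condition there reads s' ln (2 L) <= b + s (ln L
   - ln r0), that is, [q <= (s - s') * ln L]. *)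
pose q := s * ln r0 - b + s' * ln 2.
pose L := Num.max (cmod (z - a)) (Num.max (r + cmod a + 1) (expR (`|q| / (s - s')))).
have L1 : cmod (z - a) <= L by rewrite le_max lexx.
have L2 : r + cmod a + 1 <= L by rewrite !le_max lexx orbT.
have L3 : expR (`|q| / (s - s')) <= L by rewrite !le_max lexx !orbT.
have a0 := cmod_ge0 a.
have L0 : 0 < L by apply: lt_le_trans L2; lra.
have lnL : q <= (s - s') * ln L.
  rewrite mulrC -ler_pdivrMr ?subr_gt0//.
  apply: le_trans (_ : `|q| / (s - s') <= _).
    by rewrite ler_pM2r ?ler_norm// invr_gt0 subr_gt0.
  by rewrite -(expRK (`|q| / (s - s'))) ler_ln ?posrE ?expR_gt0.
have := @annulus_principle R u a a r0 L (b - s * ln r0) s 0 su r00 (ltW s0) (lexx 0) _ _ z.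
rewrite rz L1 => /(_ _ _ isT) H.
rewrite (_ : b + _ = b - s * ln r0 + s * ln (cmod (z - a)) + 0 * ln (cmod (z - a))); last by ring.
apply: H => [w /andP[wa _]|w [wa|wa]].
- by apply: contraTneq (lt_le_trans r00 wa) => ->; rewrite subrr cmod0 ltxx.
- by rewrite wa mul0r addr0 subrK; exact: ub.
have w1 : r < cmod w.
  have := cmod_triangle w (- a); rewrite cmodN wa; lra.
have w2 : cmod w <= 2 * L.
  have := cmod_triangle (w - a) a; rewrite subrK wa; lra.
apply: le_trans (ur w w1) _; rewrite lee_fin wa mul0r addr0.
have w0 : 0 < cmod w by lra.
have : ln (cmod w) <= ln 2 + ln L.
  by rewrite -lnM ?posrE// ler_ln ?posrE// mulr_gt0.
rewrite -(ler_pM2l s'0) => /le_trans; apply.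
by move: lnL; rewrite /q; lra.
Qed.

Lemma growth_le u a s r0 b : subharmonic u -> 0 <= s -> (logtype u <= s%:E)%E -> 0 < r0 ->
  (forall w, cmod (w - a) = r0 -> (u w <= b%:E)%E) ->
  forall z, r0 <= cmod (z - a) -> (u z <= (b + s * (ln (cmod (z - a)) - ln r0))%:E)%E.
Proof.
move=> su s0 us r00 ub z rz; apply/lee_addgt0Pr => e e0.
pose l := ln (cmod (z - a)) - ln r0.
have z0 := lt_le_trans r00 rz.
have l0 : 0 <= l by rewrite subr_ge0 ler_ln ?posrE.
have l1 : 0 < l + 1 by lra.
have d0 : 0 < e / (l + 1) by rewrite divr_gt0.
have s'0 : 0 < s + e / (l + 1) by lra.
have us' : (logtype u < (s + e / (l + 1))%:E)%E.
  by apply: le_lt_trans us _; rewrite lte_fin ltrDl.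
apply: le_trans (growth_lt su s'0 us' r00 ub rz) _.
rewrite -EFinD lee_fin -/l mulrDl addrA lerD2l.
by rewrite -mulrA ler_piMr ?(ltW e0)// mulrC ler_pdivrMr// mul1r; lra.
Qed.

(** With slope 0, [growth_le] bounds [u] outside a small circle about [a] by its values on that
    circle, and upper semicontinuity brings these as close to [u a] from above as desired. *)
Lemma liouville u z a : subharmonic u -> (logtype u <= 0)%E -> (u z <= u a)%E.
Proof.
move=> su us; rewrite leNgt; apply/negP => /ereal_real_between[q /andP[aq qz]].
have [_ uu _ _] := su; have [V /nbhs_cmodP[r r0 rV] Vu] := uu a q aq.
have za : 0 < cmod (z - a).
  rewrite lt0r cmod_ge0 andbT; apply/eqP => /cmod_eq0/eqP; rewrite subr_eq0 => /eqP za.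
  by have := lt_trans aq qz; rewrite za ltxx.
pose r1 := Num.min (r / 2) (cmod (z - a)).
have r10 : 0 < r1 by rewrite lt_min za divr_gt0.
have r1r : r1 < r by rewrite gt_min ltr_pdivrMr// ltr_pMr// ltr1n.
have := @growth_le u a 0 r1 q su (lexx 0) us r10 _ z; rewrite mul0r addr0 => H.
have : (u z <= q%:E)%E.
  apply: H; last by rewrite ge_min lexx orbT.
  by move=> w wa; apply/ltW/Vu/rV; rewrite wa.
by rewrite leNgt qz.
Qed.

Lemma cmod_real r : 0 <= r -> cmod ((r, 0) : C) = r.
Proof. by move=> r0; rewrite /cmod/= expr0n/= addr0 sqrtr_sqr ger0_norm. Qed.

(** Once [u] is known to be constant, this turns [logtype u <= 0] into equality, so that [einv]
    takes the value [+oo]. *)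
Lemma logtype_cst (k : R) : logtype (fun _ : C => k%:E) = 0%E.
Proof.
apply/le_anti/andP; split.
  by apply: (@logtype_le _ 2 0 k); rewrite ?ltr1n// => z _; rewrite mul0r add0r.
apply: le_ereal_inf_tmp => _ [r /= r1 <-]; apply/lee_addgt0Pr => e e0.
pose x := Num.max (r + 1) (expR (`|k| / e)).
have x1 : r < x by rewrite lt_max ltrDl ltr01.
have x0 : 0 < x by lra.
have l0 : 0 < ln x by apply: ln_gt0; lra.
apply: (@le_trans _ _ ((k%:E * (ln x)^-1%:E) + e%:E)%E); last first.
  apply: leeD2r; apply: ereal_sup_ubound; exists (x, 0) => /=; rewrite cmod_real ?(ltW x0)//.
rewrite -EFinM -EFinD lee_fin.
suff : `|k| / ln x <= e.
  have := ler_norm (- k); rewrite normrN => h1 h2.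
  have : - k / ln x <= `|k| / ln x by rewrite ler_pM2r ?invr_gt0.
  by rewrite mulNr; lra.
rewrite ler_pdivrMr// mulrC -ler_pdivrMr//.
by rewrite -(expRK (`|k| / e)) ler_ln ?posrE ?expR_gt0// le_max lexx orbT.
Qed.

Lemma circle_attains_max u r : subharmonic u -> 0 < r ->
  exists2 z, cmod z = r & forall w, cmod w = r -> (u w <= u z)%E.
Proof.
move=> su r0; have [_ uu _ _] := su.
have cK : compact [set z : C | cmod z = r].
  rewrite (_ : [set _ | _] = [set z : C | r <= cmod (z - 0) <= r]); first exact: compact_annulus.
  by apply/seteqP; split => z /=; rewrite subr0; [move=> ->; rewrite lexx|move=> /le_anti].
have [||z zr zmax] := @usc_attains_max R u _ cK.
- by exists (r, 0); rewrite /= cmod_real// ltW.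
- by move=> z b _ /uu[V nV Vu]; apply: filterS nV.
- by exists z.
Qed.

(** This makes the circle maxima real. If [u] were [-oo] on the circle, [growth_le] with arbitrarily
    negative [b] would make it [-oo] everywhere outside. *)
Lemma subharmonic_infty_circle u s r : subharmonic u -> 0 <= s -> (logtype u <= s%:E)%E ->
  0 < r -> ~ (forall w, cmod w = r -> u w = -oo%E).
Proof.
move=> su s0 us r0 ur.
have [ult _ [z0 uz0] _] := su.
have uo z : r <= cmod z -> u z = -oo%E.
  move=> rz; case uzE : (u z) (ult z) => [x| |]// _.
  pose c := s * (ln (cmod z) - ln r).
  have := @growth_le u 0 s r (x - c - 1) su s0 us r0 _ z; rewrite subr0 uzE lee_fin -/c => H.
  have : x <= x - c - 1 + c by apply: H => // w; rewrite subr0 => /ur ->; rewrite leNye.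
  by move=> ?; exfalso; lra.
(* The circle of this radius about [z0], where [u] exceeds [-oo], lies entirely in the region |z| >=
   r. *)
have rr : 0 < cmod z0 + r by rewrite ltr_wpDl ?cmod_ge0.
have := subharmonic_circle z0 su rr.
have -> : (\int[mu]_(t in `[0%R, (2 * pi)%R]) u (circle z0 (cmod z0 + r) t) = -oo)%E.
  rewrite (eq_integral (cst -oo%E)) => [|t _]; last first.
    apply: uo; have := @cmod_triangle R (circle z0 (cmod z0 + r) t) (- z0).
    by rewrite cmodN cmod_circle_sub ?(ltW rr)//; lra.
  rewrite integral_cst//= lebesgue_measure_itv/= lte_fin two_pi_gt0/= -EFinB subr0.
  by rewrite gt0_mulNye// lte_fin two_pi_gt0.
rewrite gt0_muleNy ?lte_fin ?invr_gt0 ?two_pi_gt0// leeNy_eq => /eqP uz.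
by rewrite uz in uz0.
Qed.

Lemma circle_max_exists u s : subharmonic u -> 0 <= s -> (logtype u <= s%:E)%E ->
  exists M : R -> R, forall r, 0 < r ->
    (exists2 z, cmod z = r & u z = (M r)%:E) /\ forall w, cmod w = r -> (u w <= (M r)%:E)%E.
Proof.
move=> su s0 us; have [ult _ _ _] := su.
have /choice[M HM] : forall r, exists x : R, 0 < r ->
    (exists2 z, cmod z = r & u z = x%:E) /\ forall w, cmod w = r -> (u w <= x%:E)%E.
  move=> r; have [r0|] := ltP 0 r; last by exists 0.
  have [z zr zmax] := circle_attains_max su r0.
  case uzE : (u z) (ult z) => [x| |]// _; first by exists x => _; rewrite -uzE; split => //; exists z.
  exfalso; apply: (subharmonic_infty_circle su s0 us r0) => w wr.
  by apply/eqP; rewrite -leeNy_eq -uzE zmax.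
by exists M.
Qed.

Lemma expr4_interval (x : R) : 1 <= x -> exists k : nat, 4 ^+ k <= x <= 4 ^+ k.+1.
Proof.
move=> x1.
have [n xn] : exists n : nat, x < 4 ^+ n.
  exists (Num.truncn x).+1; apply: lt_le_trans (truncnS_gt x) _.
  rewrite -natrX ler_nat; apply: ltnW; exact: ltn_expl.
have H : exists n : nat, x < 4 ^+ n by exists n.
case: (ex_minnP H) => -[|k] xk kmin; first by move: xk; rewrite expr0 ltNge x1.
exists k; rewrite (ltW xk) andbT leNgt; apply/negP => /kmin; rewrite ltnn//.
Qed.

(* The limit slope of the convex function [M] is the type [s]. *)
Lemma circle_max_growth u s : subharmonic u -> 0 < s -> logtype u = s%:E ->
  exists M : R -> R, [/\ forall r, 0 < r -> exists2 z, cmod z = r & u z = (M r)%:E,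
    forall r z, 0 < r -> r <= cmod z -> (u z <= (M r + s * (ln (cmod z) - ln r))%:E)%E &
    forall e, 0 < e -> exists k0, forall k, (k0 <= k)%N ->
      M (4 ^+ k) + s * ln 4 - e <= M (4 ^+ k.+1)].
Proof.
move=> su s0 us.
have us' : (logtype u <= s%:E)%E by rewrite us.
have [M HM] := circle_max_exists su (ltW s0) us'.
exists M.
have G r z : 0 < r -> r <= cmod z -> (u z <= (M r + s * (ln (cmod z) - ln r))%:E)%E.
  move=> r0 rz; have := @growth_le u 0 s r (M r) su (ltW s0) us' r0 _ z.
  by rewrite subr0; apply => // w; rewrite subr0 => /(HM r r0).2.
split => //.
  by move=> r r0; exact: (HM r r0).1.
have p4 k : 0 < 4 ^+ k :> R by rewrite exprn_gt0.
have l4 : 0 < ln 4 :> R by rewrite ln_gt0// ltr1n.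
have lnp k : ln (4 ^+ k.+1) = ln (4 ^+ k) + ln 4 :> R by rewrite exprSr lnM// posrE.
have lnk k : ln (4 ^+ k) = k%:R * ln 4 :> R by rewrite lnXn// mulr_natl.
have p4S k : 4 ^+ k < 4 ^+ k.+1 :> R by rewrite exprS ltr_pMl// ltr1n.
pose d k := M (4 ^+ k.+1) - M (4 ^+ k).
have d0 k : 0 <= d k.
  rewrite subr_ge0 -lee_fin; have [[z zr <-] _] := HM _ (p4 k).
  apply: (disc_principle su (p4 k.+1)); first exact: (HM _ (p4 k.+1)).2.
  by rewrite zr ltW.
(* Hadamard's three circles theorem. The comparison function is affine in ln |z| with the values of
   [M] on the two outer circles; on the middle one it is their average. Its slope [m] is nonnegative
   by [d0]. *)
have dS k : d k <= d k.+1.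
  have [[z zr uz] _] := HM _ (p4 k.+1).
  pose m := (M (4 ^+ k.+2) - M (4 ^+ k)) / (2 * ln 4).
  have m0 : 0 <= m.
    rewrite divr_ge0 ?mulr_ge0 ?(ltW l4)//.
    by have := d0 k; have := d0 k.+1; rewrite /d; lra.
  have mE : m * ln 4 = (M (4 ^+ k.+2) - M (4 ^+ k)) / 2 by rewrite /m; field; exact: lt0r_neq0.
  have := @annulus_principle R u 0 0 (4 ^+ k) (4 ^+ k.+2) (M (4 ^+ k) - m * ln (4 ^+ k)) m 0
    su (p4 k) m0 (lexx 0) _ _ z.
  rewrite subr0 zr uz lee_fin lnp mul0r addr0 => H.
  suff : M (4 ^+ k.+1) <= M (4 ^+ k) - m * ln (4 ^+ k) + m * (ln (4 ^+ k) + ln 4).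
    by rewrite mulrDr mE /d; lra.
  apply: H; last by rewrite !ltW// exprS.
  - move=> w /andP[wk _]; apply: contraTneq (lt_le_trans (p4 k) wk) => ->.
    by rewrite subrr cmod0 ltxx.
  - move=> w; rewrite subr0 mul0r addr0 => -[wr|wr]; rewrite wr.
      by rewrite subrK; exact: (HM _ (p4 k)).2.
    apply: le_trans ((HM _ (p4 k.+2)).2 w wr) _; rewrite lee_fin !lnp !mulrDr mE; lra.
have dle i k : (i <= k)%N -> d i <= d k.
  elim: k => [|k IH]; first by rewrite leqn0 => /eqP ->.
  by rewrite leq_eqVlt => /orP[/eqP ->//|]; rewrite ltnS => /IH/le_trans; apply.
(* The increments [d] grow with [k], so if infinitely many of them stay below [s * ln 4 - e], all
   do. Then [u] grows at most like (D / ln 4) ln |z|, which contradicts the type [s]. *)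
move=> e e0; apply: contrapT => /forallNP H.
pose D := s * ln 4 - e.
have dD k : d k <= D.
  have /existsNP[n /not_implyP[kn /negP]] := H k.
  by rewrite -ltNge => Hn; apply: le_trans (dle _ _ kn) _; rewrite /d /D; lra.
have MD k : M (4 ^+ k) <= M 1 + k%:R * D.
  elim: k => [|k IH]; first by rewrite expr0 mul0r addr0.
  have -> : k.+1%:R = k%:R + 1 :> R by rewrite natr1.
  by have := dD k; rewrite /d mulrDl mul1r; lra.
have D0 : 0 <= D := le_trans (d0 0%N) (dD 0%N).
have : (logtype u <= (D / ln 4)%:E)%E.
  apply: (@logtype_le u 2 (D / ln 4) (M 1 + s * ln 4)); first by rewrite ltr1n.
  move=> z z2; have z1 : 1 <= cmod z by lra.
  have [k /andP[k1 k2]] := expr4_interval z1.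
  apply: le_trans (G _ _ (p4 k) k1) _; rewrite lee_fin.
  have z0 : 0 < cmod z by lra.
  have h1 : ln (cmod z) - ln (4 ^+ k) <= ln 4.
    by rewrite lerBlDl -lnp ler_ln ?posrE.
  have h2 : k%:R * ln 4 <= ln (cmod z) by rewrite -lnk ler_ln ?posrE.
  have : k%:R * D <= D / ln 4 * ln (cmod z).
    by rewrite mulrAC ler_pdivlMr// mulrAC mulrC ler_wpM2l.
  rewrite -(ler_pM2l s0) in h1.
  have := MD k; lra.
by rewrite us lee_fin ler_pdivlMr// /D; lra.
Qed.

End Growth.

(** * Integrability at infinity *)

Section Integrability.
Variable R : realType.
Local Notation C := (R * R)%type.
Local Notation mu := (@lebesgue_measure R).
Local Notation leb2 := (@leb2 R).
Implicit Types (r s t c : R) (z w a p : C) (u g : C -> \bar R).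

Lemma measurable_expeR : measurable_fun [set: \bar R] (@expeR R).
Proof.
apply: (measurability _ (ErealGenInftyO.measurableE R)).
move=> /= _ [_ [r ->]] <-; rewrite setTI.
have [r0|r0] := leP r 0.
  rewrite (_ : _ @^-1` _ = set0)//; apply/seteqP; split => x //=.
  by rewrite in_itv/= ltNge (le_trans _ (expeR_ge0 x))// lee_fin.
rewrite (_ : _ @^-1` _ = `]-oo, (ln r)%:E[%classic); last first.
  apply/seteqP; split => x /=; rewrite !in_itv/=.
    by rewrite -[r in X in X -> _]lnK// -[_%:E]/(expeR (ln r)%:E) lte_expeR.
  by rewrite -[r in X in _ -> X]lnK// -[(expR _)%:E]/(expeR (ln r)%:E) lte_expeR.
exact: emeasurable_itv.
Qed.

Lemma expeR_sqr (x : \bar R) : (expeR x * expeR x = expeR (x + x))%E.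
Proof. by rewrite expeRD. Qed.

Definition expL2 c u z : \bar R := expeR (- (c%:E * u z)).

Lemma measurable_expL2 c u : measurable_fun setT u -> measurable_fun setT (expL2 c u).
Proof.
move=> mu'; apply: (measurableT_comp measurable_expeR).
by apply: measurableT_comp => //; exact: measurable_funeM.
Qed.

Lemma expL2_sqr_ge0 c u z : (0 <= expL2 c u z * expL2 c u z)%E.
Proof. by rewrite mule_ge0// expeR_ge0. Qed.

Lemma expL2_sqrE c u z x : u z = x%:E ->
  (expL2 c u z * expL2 c u z)%E = (expR (- (2 * c * x)))%:E.
Proof.
move=> ux; rewrite expeR_sqr ux -EFinM -EFinN -EFinD.
rewrite -[LHS]/(expR _)%:E; congr (expR _)%:E; ring.
Qed.

Lemma measurable_expL2_sqr c u : measurable_fun setT u ->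
  measurable_fun setT (fun z => (expL2 c u z * expL2 c u z)%E).
Proof. by move=> mu'; apply: emeasurable_funM; exact: measurable_expL2. Qed.

Lemma expL2_sqr_le c u1 u2 z : 0 < c -> (u1 z <= u2 z)%E ->
  (expL2 c u2 z * expL2 c u2 z <= expL2 c u1 z * expL2 c u1 z)%E.
Proof.
move=> c0 uz; rewrite lee_pmul ?expeR_ge0// lee_expeR leeN2 lee_wpmul2l ?lee_fin ?(ltW c0)//.
Qed.

Lemma compact_measurable (K : set C) : compact K -> measurable K.
Proof.
move=> cK; rewrite -[K]setCK; apply: measurableC; apply: measurable_open.
by apply: closed_openC; apply: compact_closed => //; exact: norm_hausdorff.
Qed.

Lemma L2_infty_le c u1 u2 : 0 < c -> measurable_fun setT u2 ->
  (forall z, (u1 z <= u2 z)%E) -> L2_infty (expL2 c u1) -> L2_infty (expL2 c u2).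
Proof.
move=> c0 mu2 u12 [K [cK iK]]; exists K; split => //.
have mK := compact_measurable cK.
apply: (le_integrable _ _ _ iK).
- exact: measurableC.
- by apply: measurable_funTS; exact: measurable_expL2_sqr.
- by move=> z _; rewrite !gee0_abs ?expL2_sqr_ge0//; exact: expL2_sqr_le.
Qed.

Lemma leb2_setX (A B : set R) : measurable A -> measurable B ->
  leb2 (A `*` B) = (mu A * mu B)%E.
Proof. by move=> mA mB; exact: (@product_measure1E _ _ _ _ R mu mu A B mA mB). Qed.

Lemma measurable_setX_R2 (A B : set R) : measurable A -> measurable B ->
  measurable (A `*` B : set C).
Proof. exact: measurableX. Qed.

Lemma ge0_integral_ge_cst (D : set C) (f : C -> \bar R) (k : R) : measurable D ->
  measurable_fun D f -> 0 <= k -> (forall z, D z -> (k%:E <= f z)%E) ->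
  (k%:E * leb2 D <= \int[leb2]_(z in D) f z)%E.
Proof.
move=> mD mf k0 fk; rewrite -integral_cst//; exact: ge0_le_integral.
Qed.

Lemma ge0_le_integral_subset (A B : set C) (f : C -> \bar R) : measurable A -> measurable B ->
  measurable_fun setT f -> (forall z, (0 <= f z)%E) -> A `<=` B ->
  (\int[leb2]_(z in A) f z <= \int[leb2]_(z in B) f z)%E.
Proof.
move=> mA mB mf f0 AB.
exact: (ge0_subset_integral leb2 mA mB (measurable_funTS mf) (fun z _ => f0 z) AB).
Qed.

Lemma ge0_integral_leb2_setU (A B : set C) (f : C -> \bar R) : measurable A -> measurable B ->
  measurable_fun setT f -> (forall z, (0 <= f z)%E) -> [disjoint A & B] ->
  (\int[leb2]_(z in A `|` B) f z = \int[leb2]_(z in A) f z + \int[leb2]_(z in B) f z)%E.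
Proof.
move=> mA mB mf f0 AB.
exact: (ge0_integral_setU leb2 mA mB (measurable_funTS mf) (fun z _ => f0 z) AB).
Qed.

(* The squares ]2^k, 2^(k+1)] x [0, 2^k] all carry the same amount of |z|^-2. *)
Lemma not_L2_infty c u s b : measurable_fun setT u -> 0 < c -> 0 <= s -> c * s <= 1 ->
  (forall z, 1 <= cmod z -> (u z <= (s * ln (cmod z) + b)%:E)%E) ->
  ~ L2_infty (expL2 c u).
Proof.
move=> mu' c0 s0 cs us [K [cK /integrableP[mF iF]]].
have [r r0 Kr] := compact_cmod_bounded cK.
pose F z := (expL2 c u z * expL2 c u z)%E.
have mF' : measurable_fun setT F by exact: measurable_expL2_sqr.
have F0 z : (0 <= F z)%E by exact: expL2_sqr_ge0.
have [k0 rk0] : exists k0 : nat, r < 2 ^+ k0.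
  exists (Num.truncn r).+1; apply: lt_le_trans (truncnS_gt r) _.
  by rewrite -natrX ler_nat; apply: ltnW; exact: ltn_expl.
have p2 k : 0 < 2 ^+ k :> R by rewrite exprn_gt0.
have p2S k : 2 ^+ k < 2 ^+ k.+1 :> R by rewrite exprS ltr_pMl// ltr1n.
(* On [Q k] one has |z|^2 <= (2^(k+1))^2 + (2^k)^2 = 5 * 4^k, and the area of [Q k] is 4^k. *)
pose kap := expR (- (2 * c * b)) / 5.
have kap0 : 0 <= kap by rewrite divr_ge0 ?expR_ge0.
pose S k : set C := `]2 ^+ k, 2 ^+ k.+1]%classic `*` [set: R].
pose Q k : set C := `]2 ^+ k, 2 ^+ k.+1]%classic `*` `[0, 2 ^+ k]%classic.
have mS k : measurable (S k) by apply: measurable_setX_R2.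
have mQ k : measurable (Q k) by apply: measurable_setX_R2.
have IQ k : (kap%:E <= \int[leb2]_(z in S k) F z)%E.
  apply: (@le_trans _ _ (\int[leb2]_(z in Q k) F z)%E); last first.
    by apply: ge0_le_integral_subset => // z [].
  apply: (@le_trans _ _ ((kap * (4 ^+ k)^-1)%:E * leb2 (Q k))%E).
    rewrite leb2_setX// !lebesgue_measure_itv/= !lte_fin p2S p2 -!EFinB -!EFinM lee_fin.
    have -> : 4 ^+ k = 2 ^+ k * 2 ^+ k :> R by rewrite -exprMn -natrM.
    by rewrite exprS le_eqVlt; apply/orP; left; apply/eqP; field; exact: lt0r_neq0.
  apply: ge0_integral_ge_cst => //.
  - exact: measurable_funTS.
  - by rewrite mulr_ge0// invr_ge0 exprn_ge0.
  move=> z [/=]; rewrite !in_itv/= => /andP[z1 z2] /andP[z3 z4].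
  have zn : cmod z ^+ 2 <= 5 * 4 ^+ k.
    rewrite cmod_sqr.
    have h1 : z.1 ^+ 2 <= (2 * 2 ^+ k) ^+ 2.
      by rewrite ler_sqr ?nnegrE -?exprS// ltW// (lt_trans _ z1).
    have h2 : z.2 ^+ 2 <= (2 ^+ k) ^+ 2 by rewrite ler_sqr ?nnegrE// ltW.
    have -> : 4 ^+ k = (2 ^+ k) ^+ 2 :> R by rewrite expr2 -exprMn -natrM.
    by move: h1; rewrite exprMn; lra.
  have k1 : 1 <= 2 ^+ k :> R by rewrite exprn_ege1// ler1n.
  have zc1 : 1 <= cmod z.
    by apply: le_trans k1 (le_trans (ltW z1) (le_trans (ler_norm _) (norm_fst_le z))).
  have zc0 : 0 < cmod z by lra.
  have lz : 0 <= ln (cmod z) by apply: ln_ge0.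
  have := @expL2_sqr_le c u (fun z => (s * ln (cmod z) + b)%:E) z c0 (us z zc1).
  move=> /(le_trans _); apply; rewrite (expL2_sqrE _ (erefl _)) lee_fin.
  apply: (@le_trans _ _ (expR (- (2 * c * b)) * expR (- (ln (cmod z) *+ 2)))).
    rewrite /kap -mulrA ler_pM2l ?expR_gt0// expRN -lnXn// lnK ?posrE ?exprn_gt0//.
    by rewrite -invfM lef_pV2 ?posrE ?exprn_gt0 ?mulr_gt0 ?exprn_gt0.
  rewrite -expRD ler_expR.
  have : c * s * ln (cmod z) <= 1 * ln (cmod z) by rewrite ler_wpM2r.
  by lra.
(* The union of [n] consecutive strips starting at 2^k0 > r, hence disjoint from [K]; its integral
   is at least [n%:R * kap]. *)
pose B n : set C := `]2 ^+ k0, 2 ^+ (k0 + n)]%classic `*` [set: R].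
have mB n : measurable (B n) by apply: measurable_setX_R2.
have IB n : ((n%:R * kap)%:E <= \int[leb2]_(z in B n) F z)%E.
  elim: n => [|n IH]; first by rewrite mul0r; apply: integral_ge0.
  have -> : B n.+1 = B n `|` S (k0 + n)%N.
    rewrite /B /S addnS; apply/seteqP; split => z /=; rewrite !in_itv/=.
      by move=> [/andP[z1 z2] _]; have [zk|zk] := leP z.1 (2 ^+ (k0 + n)); [left|right]; split => //; rewrite ?z1.
    have kn : 2 ^+ k0 <= 2 ^+ (k0 + n) :> R by rewrite ler_weXn2l ?ler1n// leq_addr.
    move=> [[/andP[z1 z2] _]|[/andP[z1 z2] _]]; split => //; apply/andP; split => //.
      by rewrite (le_trans z2)// ltW.
    by rewrite (le_lt_trans kn).
  rewrite ge0_integral_leb2_setU//; last first.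
    apply/disj_setPS => z [[/= + _] [/= + _]]; rewrite !in_itv/= => /andP[_ z1] /andP[z2 _].
    by have := lt_le_trans z2 z1; rewrite ltxx.
  have -> : n.+1%:R * kap = n%:R * kap + kap :> R by rewrite -natr1 mulrDl mul1r.
  by rewrite EFinD leeD.
have BK n : B n `<=` ~` K.
  move=> z [/= + _]; rewrite in_itv/= => /andP[z1 _] /Kr zr.
  have := le_trans (ler_norm _) (norm_fst_le z); lra.
have mK := compact_measurable cK.
have : (\int[leb2]_(z in ~` K) F z < +oo)%E.
  suff -> : (\int[leb2]_(z in ~` K) F z = \int[leb2]_(z in ~` K) `|F z|)%E by [].
  by apply: eq_integral => z _; rewrite gee0_abs.
have kp : 0 < kap by rewrite divr_gt0 ?expR_gt0.
have H n : ((n%:R * kap)%:E <= \int[leb2]_(z in ~` K) F z)%E.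
  apply: le_trans (IB n) _; apply: ge0_le_integral_subset => //; exact: measurableC.
have I0 : (0 <= \int[leb2]_(z in ~` K) F z)%E by apply: integral_ge0.
case: (integral _ _ _) H I0 => [x| |]// H; rewrite lee_fin => x0 _.
have := H (Num.truncn (x / kap)).+1; rewrite lee_fin leNgt => /negP; apply.
by rewrite -ltr_pdivrMr// truncnS_gt.
Qed.

End Integrability.

(** * Area means *)

Section AreaMean.
Variable R : realType.
Local Notation C := (R * R)%type.
Local Notation mu := (@lebesgue_measure R).
Local Notation leb2 := (@leb2 R).
Implicit Types (r s t c rho : R) (z w a p : C) (u f : C -> \bar R).

Definition disc z r : set C := [set w | cmod (w - z) < r].

Lemma measurable_disc z r : measurable (disc z r).
Proof.
apply: measurable_open; rewrite (_ : disc z r = [set w : C | `]-oo, r[%classic (cmod (w - z))]).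
  by apply: open_cmod_preimage; exact: interval_open.
by apply/seteqP; split => w; rewrite /disc/= in_itv.
Qed.

Lemma measurable_restrict_setT (A : set C) f : measurable A -> measurable_fun setT f ->
  measurable_fun setT (f \_ A).
Proof.
by move=> mA mf; apply/(measurable_restrictT _ _).1 => //; exact: measurable_funTS.
Qed.

Lemma restrict_ge0 (A : set C) f z : (forall z, (0 <= f z)%E) -> (0 <= (f \_ A) z)%E.
Proof. by move=> f0; rewrite patchE; case: ifP. Qed.

Lemma ge0_integral_disc f z r : measurable_fun setT f -> (forall z, (0 <= f z)%E) ->
  (\int[leb2]_(w in disc z r) f w = \int[leb2]_(w in disc 0%R r) f (w + z)%R)%E.
Proof.
move=> mf f0; rewrite integral_mkcond [RHS]integral_mkcond.
rewrite -(@ge0_integral_translate R z (f \_ (disc z r))); last 2 first.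
- by apply: measurable_restrict_setT => //; exact: measurable_disc.
- by move=> w; exact: restrict_ge0.
apply: eq_integral => w _; rewrite !patchE.
have -> : (w + z \in disc z r) = (w \in disc 0%R r) => //.
by apply/idP/idP; rewrite !inE /disc/= subr0 addrK.
Qed.

(** The number pi, kept abstract: the estimates rest on its positivity and on the scaling law
    [leb2_disc]. *)
Definition disc_area : R := fine (leb2 (disc 0%R 1)).

Lemma leb2_disc01_fin : (0 < leb2 (disc 0%R 1) < +oo)%E.
Proof.
apply/andP; split.
  apply: (@lt_le_trans _ _ (leb2 (`[0, 2^-1]%classic `*` `[0, 2^-1]%classic))).
    rewrite leb2_setX// !lebesgue_measure_itv/= lte_fin invr_gt0 ltr0n/=.
    by rewrite -EFinB -EFinM lte_fin subr0 mulr_gt0.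
  apply: le_measure; rewrite ?inE; [exact: measurable_setX_R2|exact: measurable_disc|].
  move=> w [/=]; rewrite !in_itv/= => /andP[w1 w2] /andP[w3 w4].
  rewrite /disc/= subr0 -ltr_sqr ?nnegrE ?cmod_ge0// cmod_sqr.
  have : w.1 ^+ 2 <= 2^-1 ^+ 2 by rewrite ler_sqr ?nnegrE.
  have : w.2 ^+ 2 <= 2^-1 ^+ 2 by rewrite ler_sqr ?nnegrE.
  lra.
apply: (@le_lt_trans _ _ (leb2 (`[-1, 1]%classic `*` `[-1, 1]%classic))).
  apply: le_measure; rewrite ?inE; [exact: measurable_disc|exact: measurable_setX_R2|].
  move=> w; rewrite /disc/= subr0 => w1; rewrite !in_itv/= -!ler_norml.
  by split; apply: ltW; apply: le_lt_trans w1; [exact: norm_fst_le|exact: norm_snd_le].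
rewrite leb2_setX// !lebesgue_measure_itv/=; case: ifP => _; last by rewrite mule0 ltry.
by rewrite -EFinB -EFinM ltry.
Qed.

Lemma disc_area_gt0 : 0 < disc_area.
Proof. by apply: fine_gt0; exact: leb2_disc01_fin. Qed.

Lemma leb2_disc z r : 0 < r -> leb2 (disc z r) = (disc_area * r ^+ 2)%:E.
Proof.
move=> r0; have /andP[l0 loo] := leb2_disc01_fin.
have m0 : measurable_fun [set: C] (cst 1%E : C -> \bar R) by exact: measurable_cst.
have E z' r' : leb2 (disc z' r') = (\int[leb2]_(w in disc z' r') (cst 1%E : C -> \bar R) w)%E.
  by rewrite integral_cst ?mul1e//; exact: measurable_disc.
rewrite E ge0_integral_disc// integral_mkcond (@ge0_integral_dilate R r _ r0); last 2 first.
- by apply: measurable_restrict_setT => //; exact: measurable_disc.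
- by move=> w; exact: restrict_ge0.
rewrite [RHS]EFinM [RHS]muleC; congr (_ * _)%E.
rewrite fineK; last by rewrite ge0_fin_numE ?(ltW l0).
rewrite E [RHS]integral_mkcond; apply: eq_integral => w _; rewrite !patchE.
have -> : ((r * w.1, r * w.2) \in disc 0%R r) = (w \in disc 0%R 1) => //.
by apply/idP/idP; rewrite !inE /disc/= !subr0 cmod_dilate ?(ltW r0)// gtr_pMr.
Qed.

Lemma cmod_rotate t z : cmod (cos t * z.1 - sin t * z.2, sin t * z.1 + cos t * z.2) = cmod z.
Proof.
apply/eqP; rewrite -(@eqrXn2 _ 2) ?cmod_ge0// !cmod_sqr/=.
have -> : (cos t * z.1 - sin t * z.2) ^+ 2 + (sin t * z.1 + cos t * z.2) ^+ 2 =
  (cos t ^+ 2 + sin t ^+ 2) * (z.1 ^+ 2 + z.2 ^+ 2) by ring.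
by rewrite cos2Dsin2 mul1r.
Qed.

Lemma rotate_polar r s t z :
  (cos t * (r * cos s) - sin t * (r * sin s), sin t * (r * cos s) + cos t * (r * sin s)) + z
  = circle z r (t + s).
Proof. by rewrite /circle cosD sinD; congr (_, _) => /=; ring. Qed.

Lemma circle_periodic z r t : circle z r (t + 2 * pi) = circle z r t.
Proof. by rewrite /circle (mulr_natl pi 2) cosD2pi sinD2pi. Qed.

(* Averaging the rotations of the disc turns its area mean into circle means. *)
Lemma area_supermean f z rho : measurable_fun setT f -> (forall z, (0 <= f z)%E) ->
  0 < rho -> (forall r, 0 < r < rho ->
    (\int[mu]_(t in `[0%R, (2 * pi)%R]) f (circle z r t) <= (2 * pi)%:E * f z)%E) ->
  (\int[leb2]_(w in disc z rho) f w <= (disc_area * rho ^+ 2)%:E * f z)%E.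
Proof.
move=> mf f0 rho0 H; have p0 := two_pi_gt0 R.
rewrite ge0_integral_disc//.
pose g := (fun w : C => f (w + z)) \_ (disc 0%R rho).
have mfz : measurable_fun setT (fun w : C => f (w + z)).
  by apply: measurableT_comp => //; exact: measurable_fun_translate.
have mg : measurable_fun setT g.
  by apply: measurable_restrict_setT => //; exact: measurable_disc.
have g0 w : (0 <= g w)%E by apply: restrict_ge0.
have -> : (\int[leb2]_(w in disc 0%R rho) f (w + z)%R = \int[leb2]_w g w)%E.
  by rewrite integral_mkcond.
pose I : set R := `[0, 2 * pi]%classic.
have mI : measurable I by exact: measurable_itv.
have muI : mu I = (2 * pi)%:E.
  by rewrite /I lebesgue_measure_itv/= lte_fin p0 -EFinB subr0.
have icst (x : \bar R) : (\int[mu]_(t in I) x = (2 * pi)%:E * x)%E.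
  by rewrite muleC -muI; exact: (integral_cst mu mI x).
(* [G (t, w)] is [g] at [w] rotated by the angle [t]. Integration over [w] first gives 2 pi times
   the area integral; over [t] first, it gives the circle integral of radius [cmod w]. This stands
   in for polar coordinates. *)
pose G (q : R * C) := g (cos q.1 * q.2.1 - sin q.1 * q.2.2, sin q.1 * q.2.1 + cos q.1 * q.2.2).
have mcos : measurable_fun [set: R * C] (fun q : R * C => cos q.1).
  by apply: measurableT_comp => //; exact: continuous_measurable_fun (@continuous_cos R).
have msin : measurable_fun [set: R * C] (fun q : R * C => sin q.1).
  by apply: measurableT_comp => //; exact: continuous_measurable_fun (@continuous_sin R).
have m1 : measurable_fun [set: R * C] (fun q : R * C => q.2.1).
  by apply: (measurableT_comp measurable_fst); exact: measurable_snd.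
have m2 : measurable_fun [set: R * C] (fun q : R * C => q.2.2).
  by apply: (measurableT_comp measurable_snd); exact: measurable_snd.
have mG : measurable_fun setT G.
  apply: (measurableT_comp mg); apply: measurable_fun_pair.
    by apply: measurable_funB; exact: measurable_funM.
  by apply: measurable_funD; exact: measurable_funM.
pose H1 := G \_ (I `*` [set: C]).
have mH1 : measurable_fun setT H1.
  apply/(measurable_restrictT _ _).1; last exact: measurable_funTS.
  by apply: measurableX; [exact: measurable_itv|exact: measurableT].
have H10 q : (0 <= H1 q)%E by rewrite /H1 patchE; case: ifP => // _; exact: g0.
have E1 : (\int[mu]_t \int[leb2]_w H1 (t, w) = (2 * pi)%:E * \int[leb2]_w g w)%E.
  rewrite -icst.
  rewrite [RHS]integral_mkcond; apply: eq_integral => t _; rewrite patchE.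
  case: ifPn => tI.
    rewrite -[RHS](@ge0_integral_rotate R (cos t) (sin t) g (cos2Dsin2 t))//.
    apply: eq_integral => w _; rewrite /H1 patchE mem_set//; split => //; exact: set_mem.
  apply: integral0_eq => w _; rewrite /H1 patchE memNset// => -[tI' _].
  by move: tI; rewrite mem_set.
have E2 : (\int[mu]_t \int[leb2]_w H1 (t, w) = \int[leb2]_w \int[mu]_t H1 (t, w))%E.
  by have := @fubini_tonelli _ _ _ _ R mu leb2 H1; apply.
have E3 w : (\int[mu]_t H1 (t, w) = \int[mu]_(t in I) G (t, w))%E.
  rewrite [RHS]integral_mkcond; apply: eq_integral => t _; rewrite /H1 !patchE.
  congr (if _ then _ else _); apply/idP/idP; rewrite !inE; [by move=> []|by split].
have E4 w : (\int[mu]_t H1 (t, w) <= (cst ((2 * pi)%:E * f z)%E \_ (disc 0%R rho)) w)%E.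
  rewrite E3 patchE; case: ifPn => wd; last first.
    rewrite integral0_eq// => t _; rewrite /G /g patchE memNset// /disc/= subr0 cmod_rotate => wr.
    by move/negP: wd; apply; rewrite inE /disc/= subr0.
  rewrite inE /disc/= subr0 in wd.
  have [s s2 wE] := polar w.
  have GE t : G (t, w) = f (circle z (cmod w) (t + s)).
    rewrite /G /g patchE mem_set; last by rewrite /disc/= subr0 cmod_rotate.
    by rewrite [in LHS]wE/= rotate_polar.
  under eq_integral do rewrite GE.
  rewrite (@integral_periodic R (fun t => f (circle z (cmod w) t)) s)//; last 2 first.
  - by apply: (measurableT_comp mf); exact: measurable_circle.
  - by move=> t; rewrite circle_periodic.
  have [w0|w0] := eqVneq (cmod w) 0.
    rewrite w0 (eq_integral (cst (f z))) => [|t _]; last first.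
      by rewrite /circle !mul0r !addr0; case: (z).
    by rewrite -icst.
  by apply: H; rewrite wd andbT lt0r w0 cmod_ge0.
have : ((2 * pi)%:E * \int[leb2]_w g w <= (2 * pi)%:E * ((disc_area * rho ^+ 2)%:E * f z))%E.
  rewrite -E1 E2; apply: (@le_trans _ _ (\int[leb2]_w (cst ((2 * pi)%:E * f z)%E \_ (disc 0%R rho)) w)%E).
    apply: ge0_le_integral => //.
    - by move=> w _; apply: integral_ge0.
    - exact: (@measurable_fun_fubini_tonelli_G _ _ _ _ R mu H1 mH1 H10).
    - by apply: measurable_restrict_setT => //; exact: measurable_disc.
  rewrite -integral_mkcond integral_cst; last exact: measurable_disc.
  by rewrite -(leb2_disc 0%R rho0) -muleA [X in (_ * X <= _)%E]muleC.
by rewrite lee_pmul2l// lte_fin.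
Qed.

End AreaMean.

(** * Chains of points in the annulus *)

Section AnnulusPath.
Variable R : realType.
Local Notation C := (R * R)%type.
Implicit Types (r s t : R) (z w a : C).

Lemma sin_le_norm t : `|sin t| <= `|t|.
Proof.
wlog t0 : t / 0 <= t.
  move=> H; have [/H//|/ltW t0] := leP 0 t.
  by rewrite -normrN -sinN -(normrN t); apply: H; rewrite oppr_ge0.
have [|c _] := @MVT_segment R sin cos 0 t t0 (fun x _ => is_derive_sin x).
  exact/continuous_subspaceT/continuous_sin.
rewrite sin0 !subr0 => ->; rewrite normrM ler_piMl// ler_norml cos_geN1 cos_le1//.
Qed.

Lemma cmod_unit_sub s t : cmod ((cos s, sin s) - (cos t, sin t) : C) <= `|s - t|.
Proof.
rewrite -ler_sqr ?nnegrE ?cmod_ge0// real_normK ?num_real// cmod_sqr/=.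
pose d := (s - t) / 2.
have -> : (cos s - cos t) ^+ 2 + (sin s - sin t) ^+ 2 = 2 - 2 * cos (s - t).
  rewrite cosB; have := cos2Dsin2 s; have := cos2Dsin2 t => h1 h2.
  have -> : (cos s - cos t) ^+ 2 + (sin s - sin t) ^+ 2 =
    (cos s ^+ 2 + sin s ^+ 2) + (cos t ^+ 2 + sin t ^+ 2) - 2 * (cos s * cos t + sin s * sin t) by ring.
  by rewrite h1 h2; ring.
have -> : s - t = d *+ 2 by rewrite -(mulr_natr d) /d divfK.
rewrite cos_mulr2n cos2sin2.
have : sin d ^+ 2 <= d ^+ 2.
  by rewrite -(real_normK (num_real (sin d))) -(real_normK (num_real d)) ler_sqr ?nnegrE// sin_le_norm.
by rewrite !mulr2n; lra.
Qed.

Lemma cmod_polar_sub (r r' s s' : R) : 0 <= r ->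
  cmod ((r' * cos s', r' * sin s') - (r * cos s, r * sin s) : C) <=
  `|r' - r| + r * `|s' - s|.
Proof.
move=> r0.
have -> : (r' * cos s', r' * sin s') - (r * cos s, r * sin s) =
  ((r' - r) * cos s', (r' - r) * sin s') +
  (r * ((cos s', sin s') - (cos s, sin s) : C).1, r * ((cos s', sin s') - (cos s, sin s) : C).2) :> C.
  by congr (_, _) => /=; ring.
apply: le_trans (cmod_triangle _ _) _; apply: lerD.
  rewrite -(@ler_sqr R) ?nnegrE ?cmod_ge0// real_normK ?num_real// cmod_sqr/=.
  by rewrite !exprMn -mulrDr cos2Dsin2 mulr1.
by rewrite cmod_dilate// ler_wpM2l// cmod_unit_sub.
Qed.

(** Modulus and argument are interpolated linearly, which keeps the chain outside the unit disc,
    where a straight segment could fail to stay. The number of steps serves all endpoints, so the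
    Harnack constant is uniform. *)
Lemma annulus_path : exists N : nat, forall z a, cmod z = 1 -> 1 <= cmod a <= 4 ->
  exists gam : nat -> C, [/\ gam 0 = z, gam N = a,
    forall j, (j <= N)%N -> 1 <= cmod (gam j) &
    forall j, (j < N)%N -> cmod (gam j.+1 - gam j) <= 8^-1].
Proof.
(* The modulus varies by at most 3 and the angle by at most 2 pi <= 8, at radius at most 4: the
   total is 3 + 4 * 8 = 35. *)
have [e [e0 e1]] : exists e : R, 0 < e /\ 35 * e <= 8^-1 by exists (8^-1 / 35); split; lra.
have [N N0 iN] : exists2 N : nat, 0 < N%:R :> R & N%:R^-1 <= e.
  have [n _ /(_ n (leqnn n)) /= ne] := near_infty_natSinv_lt (PosNum e0).
  by exists n.+1; [rewrite ltr0n|exact: ltW].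
have N0' := lt0r_neq0 N0.
have iN0 : 0 < N%:R^-1 :> R by rewrite invr_gt0.
exists N => z a z1 /andP[a1 a4].
have [al /andP[al0 al1] zE] := polar z; have [be /andP[be0 be1] aE] := polar a.
pose rr (j : nat) : R := 1 + j%:R / N%:R * (cmod a - 1).
pose th (j : nat) : R := al + j%:R / N%:R * (be - al).
have rb (j : nat) : (j <= N)%N -> (0 <= (j%:R / N%:R : R)) && ((j%:R / N%:R : R) <= 1).
  by move=> jN; rewrite divr_ge0//= ler_pdivrMr// mul1r ler_nat.
exists (fun j => (rr j * cos (th j), rr j * sin (th j))); split.
- by rewrite /rr /th !mul0r !addr0 [RHS]zE z1.
- by rewrite /rr /th divff// !mul1r addrC subrK addrC subrK -aE.
- move=> j /rb/andP[j0 j1]; rewrite cmod_polar.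
    by rewrite lerDl mulr_ge0// subr_ge0.
  by rewrite addr_ge0// mulr_ge0// subr_ge0.
move=> j jN; have /andP[j0 j1] := rb j (ltnW jN).
have r0 : 0 <= rr j by rewrite addr_ge0// mulr_ge0// subr_ge0.
have r4 : rr j <= 4.
  have : j%:R / N%:R * (cmod a - 1) <= 1 * (cmod a - 1) by rewrite ler_wpM2r// subr_ge0.
  by rewrite /rr; lra.
apply: le_trans (cmod_polar_sub _ _ _ r0) _.
have jS : j.+1%:R = j%:R + 1 :> R by rewrite natr1.
have -> : rr j.+1 - rr j = (cmod a - 1) * N%:R^-1 by rewrite /rr jS; field.
have -> : th j.+1 - th j = (be - al) * N%:R^-1 by rewrite /th jS; field.
have pi4 : 2 * pi <= 8 :> R by have := @pihalf_lt2 R; lra.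
have h1 : `|(cmod a - 1) * N%:R^-1| <= 3 * e.
  by rewrite normrM (ger0_norm (ltW iN0)) ler_pM// ?(ltW iN0)// ger0_norm; lra.
have h2 : `|(be - al) * N%:R^-1| <= 8 * e.
  by rewrite normrM (ger0_norm (ltW iN0)) ler_pM// ?(ltW iN0)// ler_norml; lra.
have h3 : rr j * `|(be - al) * N%:R^-1| <= 4 * (8 * e).
  by apply: ler_pM.
lra.
Qed.

End AnnulusPath.

(** * The superharmonic gap *)

Section Gap.
Variable R : realType.
Local Notation C := (R * R)%type.
Local Notation mu := (@lebesgue_measure R).
Local Notation leb2 := (@leb2 R).
Local Notation D := (@disc_area R).
Implicit Types (r s t rho : R) (z w a : C).

(** The value 0 inside |z| < 1/4 makes the gap nonnegative and measurable on the whole plane, so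
    that Tonelli and the area means apply without restricting the domain. *)
Definition gap (sigma : R) (U : C -> \bar R) : C -> \bar R :=
  (fun z => (sigma * ln (cmod z))%:E - U z)%E \_ [set z | 4^-1 <= cmod z].

Variables (sigma : R) (U : C -> \bar R).
Hypothesis sigma0 : 0 <= sigma.
Hypothesis sU : subharmonic U.
Hypothesis Ule : forall z, 4^-1 <= cmod z -> (U z <= (sigma * ln (cmod z))%:E)%E.

Local Notation g := (gap sigma U).

Lemma gapE z : 4^-1 <= cmod z -> g z = ((sigma * ln (cmod z))%:E - U z)%E.
Proof. by move=> z4; rewrite /gap patchE mem_set. Qed.

Lemma gap_ge0 z : (0 <= g z)%E.
Proof.
rewrite /gap patchE; case: ifPn => //; rewrite inE/= => z4.
move: (Ule z4); case: (U z) => [y| |] uy //; last by rewrite leey.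
by rewrite -EFinB lee_fin subr_ge0 -lee_fin.
Qed.

Lemma measurable_gap : measurable_fun setT g.
Proof.
apply: measurable_restrict_setT.
  rewrite (_ : [set _ | _] = ~` disc (0 : C) 4^-1); first by apply: measurableC; exact: measurable_disc.
  by apply/seteqP; split => z; rewrite /disc/= subr0 leNgt => /negP.
apply: emeasurable_funB; last exact: subharmonic_measurable.
apply/measurable_EFinP; apply: measurable_funM => //.
apply: (measurableT_comp (@measurable_ln R)).
have -> : @cmod R = (fun w => cmod (w - 0)) by apply/funext => y; rewrite subr0.
by apply: continuous_measurable; exact: continuous_cmod.
Qed.

(** The circle stays in |z| >= 1/4 and does not enclose 0, so sigma ln |z| has the supermean
    property while [U] has the submean property: the gap is superharmonic there. *)
Lemma gap_circle z r : 0 < r -> r + 4^-1 <= cmod z ->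
  (\int[mu]_(t in `[0%R, (2 * pi)%R]) g (circle z r t) <= (2 * pi)%:E * g z)%E.
Proof.
move=> r0 rz.
have cz t : 4^-1 <= cmod (circle z r t).
  have := @cmod_circle_ge R z 0 r t (ltW r0); rewrite !subr0; lra.
have rz' : r < cmod z by lra.
under eq_integral do rewrite gapE//.
rewrite gapE; last by lra.
apply: (@supermean_sub R U (fun z => sigma * ln (cmod z)) z r sU r0).
- move=> t; apply: cvgM; first exact: cvg_cst.
  apply: (@continuous_comp _ _ _ (circle z r) (fun w => ln (cmod w)) t).
    exact: circle_continuous.
  have -> : (fun w : C => ln (cmod w)) = (fun w => ln (cmod (w - 0))).
    by apply/funext => y; rewrite subr0.
  apply: ln_cmod_continuous; apply/eqP => c0; have := cz t; rewrite c0 cmod0; lra.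
- by move=> t; exact: Ule.
have cc : continuous (fun t => ln (cmod (circle z r t))).
  move=> t; apply: (@continuous_comp _ _ _ (circle z r) (fun w => ln (cmod w)) t).
    exact: circle_continuous.
  have -> : (fun w : C => ln (cmod w)) = (fun w => ln (cmod (w - 0))).
    by apply/funext => y; rewrite subr0.
  apply: ln_cmod_continuous; apply/eqP => c0; have := cz t; rewrite c0 cmod0; lra.
under eq_integral do rewrite EFinM.
rewrite integralZl//; last exact: (integrable_continuous_itv _ _ cc).
have -> : 2 * pi * (sigma * ln (cmod z)) = sigma * (2 * pi * ln (cmod z)) by ring.
rewrite [leRHS]EFinM; apply: lee_wpmul2l; first by rewrite lee_fin.
have := @ln_cmod_supermean R z 0 r; rewrite subr0 (ltW r0) rz' => /(_ isT).
rewrite [X in (X <= _)%E -> _](_ : _ =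
  (\int[mu]_(t in `[0%R, (2 * pi)%R]) (ln (cmod (circle z r t)))%:E)%E)//.
by apply: eq_integral => t _; rewrite subr0.
Qed.

Lemma gap_area z rho : 0 < rho -> rho + 4^-1 <= cmod z ->
  (\int[leb2]_(w in disc z rho) g w <= (D * rho ^+ 2)%:E * g z)%E.
Proof.
move=> rho0 rz; apply: area_supermean => //; first exact: measurable_gap.
  exact: gap_ge0.
by move=> r /andP[r0 rrho]; apply: gap_circle => //; lra.
Qed.

Lemma disc_subset z w r s : cmod (z - w) + r <= s -> disc z r `<=` disc w s.
Proof.
by move=> rs x; rewrite /disc/= => xz; have := cmod_dist_triangle z x w; lra.
Qed.

Lemma gap_disc_mono z w r s : cmod (z - w) + r <= s ->
  (\int[leb2]_(x in disc z r) g x <= \int[leb2]_(x in disc w s) g x)%E.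
Proof.
move=> rs; apply: ge0_le_integral_subset.
- exact: measurable_disc.
- exact: measurable_disc.
- exact: measurable_gap.
- exact: gap_ge0.
- exact: disc_subset.
Qed.

Lemma gap_disc_ge z r k : 0 < r -> 0 <= k -> (forall w, cmod (w - z) < r -> (k%:E <= g w)%E) ->
  ((k * (D * r ^+ 2))%:E <= \int[leb2]_(x in disc z r) g x)%E.
Proof.
move=> r0 k0 kg; rewrite EFinM -(leb2_disc z r0); apply: ge0_integral_ge_cst => //.
- exact: measurable_disc.
- by apply: measurable_funTS; exact: measurable_gap.
Qed.

(** Were the gap at least 17 c on the disc of radius 1/8 about [z'], its mass there would be 17 c D
    / 64, while the disc of radius 1/2 about [z] contains that disc and carries at most c D / 4 = 16
    c D / 64. The point is only near [z'] because the gap may be [+oo] at [z'] itself. *)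
Lemma gap_step z z' c : 0 < c -> (g z <= c%:E)%E -> cmod (z' - z) <= 4^-1 -> 3 / 4 <= cmod z ->
  exists2 w, cmod (w - z') <= 8^-1 & (g w <= (17 * c)%:E)%E.
Proof.
move=> c0 gz zz z34; apply: contrapT => /forall2NP H.
have {}H w : cmod (w - z') < 8^-1 -> ((17 * c)%:E <= g w)%E.
  by move=> /ltW wz; have [|/negP] := H w; [rewrite wz|rewrite -ltNge => /ltW].
have c17 : 0 <= 17 * c by lra.
have h8 : 0 < 8^-1 :> R by lra.
have h2 : 0 < 2^-1 :> R by lra.
have h1 := gap_disc_ge h8 c17 H.
have : (\int[leb2]_(x in disc z' 8^-1) g x <= \int[leb2]_(x in disc z 2^-1) g x)%E.
  by apply: gap_disc_mono; lra.
move=> /(le_trans h1) {h1}.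
have h3 : 2^-1 + 4^-1 <= cmod z by lra.
move=> /le_trans /(_ (gap_area h2 h3)).
have D0 := @disc_area_gt0 R.
have Dp : (0 <= (D * 2^-1 ^+ 2)%:E)%E by rewrite lee_fin mulr_ge0 ?(ltW D0)// exprn_ge0.
move=> /le_trans /(_ (lee_wpmul2l Dp gz)).
by rewrite -EFinM lee_fin; have := mulr_gt0 D0 c0; lra.
Qed.

End Gap.

(* Each step of the chain from [z] to [a] enlarges the bound by a factor 17. *)
Lemma gap_harnack (R : realType) : exists2 K : R, 0 < K &
  forall (sigma : R) (U : R * R -> \bar R), 0 <= sigma -> subharmonic U ->
    (forall z, 4^-1 <= cmod z -> (U z <= (sigma * ln (cmod z))%:E)%E) ->
  forall (z : R * R) e, 0 < e -> cmod z = 1 -> (gap sigma U z <= e%:E)%E ->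
  forall a, 1 <= cmod a <= 4 ->
    (\int[leb2 (R:=R)]_(w in disc a (3 / 8)%R) gap sigma U w <= (K * e)%:E)%E.
Proof.
have [N HN] := annulus_path R.
have D0 := @disc_area_gt0 R.
exists (disc_area R / 4 * 17 ^+ N); first by rewrite mulr_gt0// ?divr_gt0// exprn_gt0.
move=> sigma U s0 sU Ule z e e0 z1 gz a a14.
have [gam [g0 gN g1 gS]] := HN z a z1 a14.
(* A point within 1/8 of [gam j] is within 1/4 of [gam j.+1] and has modulus at least 7/8, as
   [gap_step] asks. *)
have H j : (j <= N)%N -> exists2 w, cmod (w - gam j) <= 8^-1 & (gap sigma U w <= (17 ^+ j * e)%:E)%E.
  elim: j => [_|j IH jN].
    by exists z; [rewrite g0 subrr cmod0 invr_ge0|rewrite expr0 mul1r].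
  have [w wj gw] := IH (ltnW jN).
  have [||| w' w'j gw'] := @gap_step R sigma U s0 sU Ule w (gam j.+1) _ _ gw.
  - by rewrite mulr_gt0// exprn_gt0.
  - have := cmod_dist_triangle (gam j) (gam j.+1) w; rewrite (cmodC (gam j) w).
    by have := gS j jN; lra.
  - have := cmod_dist_triangle w (gam j) 0; rewrite !subr0 cmodC.
    by have := g1 j (ltnW jN); lra.
  by exists w' => //; rewrite exprS -mulrA.
have [w wa gw] := H N (leqnn N); rewrite gN in wa.
have aw := cmod_dist_triangle w a 0; rewrite !subr0 cmodC in aw.
have /andP[a1 _] := a14.
have h2 : 0 < 2^-1 :> R by lra.
have h3 : 2^-1 + 4^-1 <= cmod w by lra.
apply: (@le_trans _ _ (\int[leb2 (R:=R)]_(x in disc w 2^-1) gap sigma U x)%E).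
  by apply: gap_disc_mono => //; rewrite cmodC; lra.
apply: le_trans (gap_area s0 sU Ule h2 h3) _.
have Dp : (0 <= (disc_area R * 2^-1 ^+ 2)%:E)%E by rewrite lee_fin mulr_ge0 ?(ltW D0)// exprn_ge0.
apply: le_trans (lee_wpmul2l Dp gw) _.
by rewrite -EFinM lee_fin le_eqVlt; apply/orP; left; apply/eqP; field.
Qed.

(** * Disc means and level sets of the gap *)

Section GapLocal.
Variable R : realType.
Local Notation C := (R * R)%type.
Local Notation mu := (@lebesgue_measure R).
Local Notation leb2 := (@leb2 R).
Local Notation D := (@disc_area R).
Implicit Types (r s t rho : R) (z w : C).

Lemma ln4_ge1 : 1 <= ln 4 :> R.
Proof.
have h : 2^-1 <= expR (- 2^-1) :> R by have := @expR_ge1Dx R (- 2^-1); lra.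
rewrite -[leLHS]expRK ler_ln ?posrE ?expR_gt0//.
rewrite [X in expR X](_ : _ = - (- 2^-1 + - 2^-1) :> R); last by field.
rewrite expRN expRD.
rewrite -[leRHS]invrK.
rewrite lef_pV2 ?posrE ?mulr_gt0 ?expR_gt0//.
have -> : 4^-1 = 2^-1 * 2^-1 :> R by field.
by apply: ler_pM.
Qed.

Variables (sigma : R) (U : C -> \bar R).
Hypothesis sigma0 : 0 <= sigma.
Hypothesis sU : subharmonic U.
Hypothesis Ule : forall z, 4^-1 <= cmod z -> (U z <= (sigma * ln (cmod z))%:E)%E.
Local Notation g := (gap sigma U).

Let g0 z : (0 <= g z)%E. Proof. exact: gap_ge0. Qed.
Let mg : measurable_fun setT g. Proof. exact: measurable_gap. Qed.

(* The radius is slightly smaller than [rho], so that the disc stays inside the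
   disc of radius [rho] about any point at distance at most [rho ^+ 2]. *)
Definition gap_mean rho z : \bar R :=
  (((D * rho ^+ 2)^-1)%:E * \int[leb2]_(w in disc z (rho - rho ^+ 2)) g w)%E.

Let rho_fact rho : 0 < rho <= 16^-1 -> 0 < rho ^+ 2 <= rho / 16.
Proof.
by move=> /andP[r0 r1]; rewrite exprn_gt0//= expr2 ler_pM2l.
Qed.

Lemma gap_mean_ge0 rho z : (0 <= gap_mean rho z)%E.
Proof.
rewrite /gap_mean mule_ge0//; last by apply: integral_ge0.
by rewrite lee_fin invr_ge0 mulr_ge0 ?sqr_ge0// ltW// disc_area_gt0.
Qed.

Lemma gap_mean_le rho z w : 0 < rho <= 16^-1 -> 7 / 8 <= cmod z ->
  cmod (w - z) <= rho ^+ 2 -> (gap_mean rho z <= g w)%E.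
Proof.
move=> rho16 z78 wz; have /andP[r20 r2] := rho_fact rho16; have /andP[r0 r1] := rho16.
have D0 := @disc_area_gt0 R.
have K0 : 0 < D * rho ^+ 2 by rewrite mulr_gt0.
have h : (\int[leb2]_(x in disc z (rho - rho ^+ 2)) g x <= \int[leb2]_(x in disc w rho) g x)%E.
  by apply: gap_disc_mono => //; rewrite cmodC; lra.
have rw : rho + 4^-1 <= cmod w.
  by have := cmod_dist_triangle w z 0; rewrite !subr0 cmodC; lra.
have {}h := le_trans h (gap_area sigma0 sU Ule r0 rw).
have Kp : (0 <= ((D * rho ^+ 2)^-1)%:E :> \bar R)%E by rewrite lee_fin invr_ge0 ltW.
rewrite /gap_mean; apply: le_trans (lee_wpmul2l Kp h) _.
by rewrite muleA -EFinM mulVf ?lt0r_neq0// mul1e.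
Qed.

(** A capacity estimate. If the mean exceeds [lam], then by [gap_mean_le] the gap is at least [lam]
    on the disc of radius rho^2, and comparison with a logarithm spreads this to a lower bound
    [k = lam / L] on the disc of radius 1/16. That disc has area D / 256 and its mass is at most
    [delta], hence lam <= 256 delta L / D. *)
Lemma gap_mean_bound rho z a delta : 0 < rho <= 16^-1 -> 1 <= cmod a ->
  cmod (z - a) <= 8^-1 -> (\int[leb2]_(x in disc a (3 / 8)) g x <= delta%:E)%E ->
  (gap_mean rho z <= (256 * delta / D * (ln 4^-1 - 2 * ln rho))%:E)%E.
Proof.
move=> rho16 a1 za gd; have /andP[r20 r2] := rho_fact rho16; have /andP[r0 r1] := rho16.
have D0 := @disc_area_gt0 R.
have za' := cmod_dist_triangle z a 0; rewrite !subr0 cmodC in za'.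
have z78 : 7 / 8 <= cmod z by lra.
have d0 : 0 <= delta by rewrite -lee_fin; apply: le_trans gd; apply: integral_ge0.
pose L := ln 4^-1 - 2 * ln rho; rewrite -/L.
have l4 := ln4_ge1.
have lr2 : ln (rho ^+ 2) = 2 * ln rho by rewrite lnXn// mulr_natl.
have L1 : 1 <= L.
  have : ln (rho ^+ 2) <= ln ((4 * 4)^-1).
    by rewrite ler_ln ?posrE ?invr_gt0//; lra.
  by rewrite lr2 lnV ?posrE// lnM ?posrE// /L lnV ?posrE//; lra.
have L0 : 0 < L by lra.
rewrite leNgt; apply/negP => /ereal_real_between[lam /andP[]].
rewrite lte_fin => bl /ltW lV.
have lam0 : 0 < lam.
  have h0 : 0 <= delta / D * L by rewrite mulr_ge0 ?(ltW L0)// divr_ge0// ltW.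
  have e : 256 * delta / D * L = 256 * (delta / D * L) by ring.
  by rewrite e in bl; lra.
(* The slope for which k (ln 4^-1 - ln |w - z|) is 0 at distance 1/4 and [lam] at distance rho^2. *)
pose k := lam / L.
have k0 : 0 < k by rewrite divr_gt0.
have kL : k * L = lam by rewrite /k divfK// lt0r_neq0.
have klam : k <= lam by rewrite /k ler_pdivrMr// ler_peMr// ltW.
have wz w : cmod (w - z) <= 4^-1 -> 4^-1 <= cmod w.
  by move=> h; have := cmod_dist_triangle w z 0; rewrite !subr0 cmodC; lra.
have near w : cmod (w - z) <= rho ^+ 2 -> (lam%:E <= g w)%E.
  by move=> h; apply: le_trans lV _; exact: gap_mean_le.
(* The lower bound for the gap, rewritten as an upper bound for [U]: the term in sigma ln |w| is the
   one with the outside pole, placed at 0. *)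
have far w : rho ^+ 2 <= cmod (w - z) <= 4^-1 ->
    (U w <= (k * - ln 4^-1 + k * ln (cmod (w - z)) + sigma * ln (cmod (w - 0)))%:E)%E.
  apply: (@annulus_principle R U z 0 (rho ^+ 2) 4^-1) => //.
  - exact: ltW.
  - move=> x /andP[_ /wz]; apply: contraTneq => ->.
    by rewrite cmod0 -ltNge invr_gt0.
  move=> x [xz|xz]; rewrite xz subr0; last first.
    apply: le_trans (Ule _) _; first by apply: wz; rewrite xz.
    by rewrite lee_fin mulrN addNr add0r.
  have := near x; rewrite xz lexx => /(_ isT).
  rewrite gapE; last by apply: wz; rewrite xz; lra.
  rewrite lr2; have -> : k * - ln 4^-1 + k * (2 * ln rho) + sigma * ln (cmod x) =
    sigma * ln (cmod x) - lam by rewrite -kL /L; ring.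
  case: (U x) => [y| |]//; last by rewrite leNye.
  by rewrite -EFinB !lee_fin; lra.
have gk w : cmod (w - z) < 16^-1 -> (k%:E <= g w)%E.
  move=> w16; have [wr|rw] := leP (cmod (w - z)) (rho ^+ 2).
    by apply: le_trans (near w wr); rewrite lee_fin.
  have := far w; rewrite (ltW rw) subr0 => /(_ _).
  have -> : cmod (w - z) <= 4^-1 by lra.
  move=> /(_ isT); rewrite gapE; last by apply: wz; lra.
  have h : ln (cmod (w - z)) <= ln 4^-1 - 1.
    have c0 : 0 < cmod (w - z) by lra.
    apply: (@le_trans _ _ (ln (4 * 4)^-1)).
      by rewrite ler_ln ?posrE ?invr_gt0//; lra.
    by rewrite !lnV ?posrE// lnM ?posrE//; lra.
  have {}h : k * ln (cmod (w - z)) <= k * (ln 4^-1 - 1) by rewrite ler_pM2l.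
  case: (U w) => [y| |]//; last by rewrite leey.
  by rewrite -EFinB !lee_fin; lra.
have i16 : 0 < 16^-1 :> R by rewrite invr_gt0.
have := gap_disc_ge sU i16 (ltW k0) gk.
have : (\int[leb2]_(x in disc z 16^-1) g x <= \int[leb2]_(x in disc a (3 / 8)) g x)%E.
  by apply: gap_disc_mono => //; lra.
move=> h1 /le_trans /(_ h1) /le_trans /(_ gd); rewrite lee_fin.
have -> : k * (D * 16^-1 ^+ 2) = lam * (D / 256 / L) by rewrite /k; field; rewrite lt0r_neq0.
rewrite leNgt => /negP; apply.
have -> : delta = (256 * delta / D * L) * (D / 256 / L) by field; rewrite !lt0r_neq0.
have p256 : 0 < D / 256 by lra.
by rewrite (ltr_pM2r (divr_gt0 p256 L0)).
Qed.

(** A tent supported within distance 1/8 of [a] and above 1/16 on the disc of radius 1/16. Being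
    1-Lipschitz, it varies by at most rho at distance rho, so averaging it at that scale costs
    O(rho). *)
Definition cutoff (a z : C) : R := Num.max 0 (8^-1 - cmod (z - a)).

Lemma cutoff_ge0 a z : 0 <= cutoff a z. Proof. by rewrite le_max lexx. Qed.

Lemma cutoff_le a z : cutoff a z <= 8^-1.
Proof. by rewrite ge_max invr_ge0 ler0n/= gerBl cmod_ge0. Qed.

Lemma cutoff_out a z : 8^-1 <= cmod (z - a) -> cutoff a z = 0.
Proof. by move=> h; rewrite /cutoff max_l// subr_le0. Qed.

Lemma cutoff_lip a z w : cutoff a w - cmod (z - w) <= cutoff a z.
Proof.
rewrite lerBlDr ge_max addr_ge0 ?cutoff_ge0 ?cmod_ge0//=.
have := cmod_dist_triangle w z a; have : 8^-1 - cmod (z - a) <= cutoff a z by rewrite le_max lexx orbT.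
lra.
Qed.

Lemma measurable_cutoff a : measurable_fun setT (cutoff a).
Proof.
apply: measurable_maxr => //; apply: measurable_funB => //.
by apply: continuous_measurable; exact: continuous_cmod.
Qed.

Let mchi a : measurable_fun setT (fun z : C => (cutoff a z)%:E).
Proof. by apply/measurable_EFinP; exact: measurable_cutoff. Qed.

Let chi0 a z : (0 <= (cutoff a z)%:E)%E.
Proof. by rewrite lee_fin cutoff_ge0. Qed.

Lemma ge0_fubini_leb2 (F : C * C -> \bar R) : measurable_fun setT F -> (forall q, (0 <= F q)%E) ->
  (\int[leb2]_z \int[leb2]_w F (z, w) = \int[leb2]_w \int[leb2]_z F (z, w))%E.
Proof. by have := @fubini_tonelli _ _ _ _ R leb2 leb2 F; apply. Qed.

(** Written as a function of [w - z] so that it is jointly measurable and symmetric, which is what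
    exchanging the two integrations requires. *)
Definition disc_ind r (z w : C) : \bar R := ((cst 1%E : C -> \bar R) \_ (disc (0 : C) r)) (w - z)%R.

Lemma disc_ind_ge0 r z w : (0 <= disc_ind r z w)%E.
Proof. by rewrite /disc_ind patchE; case: ifP. Qed.

Lemma measurable_disc_ind r : measurable_fun [set: C * C] (fun q : C * C => disc_ind r q.1 q.2).
Proof.
have m1 : measurable_fun setT ((cst 1%E : C -> \bar R) \_ (disc (0 : C) r)).
  by apply: measurable_restrict_setT => //; exact: measurable_disc.
apply: (measurableT_comp m1 (_ : measurable_fun _ (fun q : C * C => (q.2.1 - q.1.1, q.2.2 - q.1.2)))).
apply: measurable_fun_pair; apply: measurable_funB.
- by apply: (measurableT_comp measurable_fst); exact: measurable_snd.
- by apply: (measurableT_comp measurable_fst); exact: measurable_fst.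
- by apply: (measurableT_comp measurable_snd); exact: measurable_snd.
- by apply: (measurableT_comp measurable_snd); exact: measurable_fst.
Qed.

Lemma disc_indC r z w : disc_ind r z w = disc_ind r w z.
Proof.
rewrite /disc_ind !patchE; congr (if _ then _ else _).
by apply/idP/idP; rewrite !inE /disc/= !subr0 cmodC.
Qed.

Lemma measurable_disc_ind1 r z : measurable_fun setT (fun w => disc_ind r z w).
Proof.
apply: (measurableT_comp _ (measurable_fun_translate (- z))).
by apply: measurable_restrict_setT; [exact: measurable_disc|exact: measurable_cst].
Qed.

Lemma measurable_disc_ind2 r w : measurable_fun setT (fun z => disc_ind r z w).
Proof. by under eq_fun do rewrite disc_indC; exact: measurable_disc_ind1. Qed.

Lemma integral_disc_ind r z (f : C -> \bar R) : measurable_fun setT f -> (forall w, (0 <= f w)%E) ->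
  (\int[leb2]_w (f w * disc_ind r z w) = \int[leb2]_(w in disc z r) f w)%E.
Proof.
move=> mf f0; rewrite [RHS]integral_mkcond; apply: eq_integral => w _.
rewrite /disc_ind !patchE.
have -> : (w - z \in disc (0 : C) r) = (w \in disc z r).
  by apply/idP/idP; rewrite !inE /disc/= subr0.
by case: ifP; rewrite ?mule1 ?mule0.
Qed.

Lemma integral_disc_ind_sym r w (f : C -> \bar R) : measurable_fun setT f -> (forall w, (0 <= f w)%E) ->
  (\int[leb2]_z (f z * disc_ind r z w) = \int[leb2]_(z in disc w r) f z)%E.
Proof.
move=> mf f0; rewrite [RHS]integral_mkcond; apply: eq_integral => z _.
rewrite /disc_ind !patchE.
have -> : (w - z \in disc (0 : C) r) = (z \in disc w r).
  by apply/idP/idP; rewrite !inE /disc/= subr0 cmodC.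
by case: ifP; rewrite ?mule1 ?mule0.
Qed.

Lemma measurable_gap_mean rho : measurable_fun setT (gap_mean rho).
Proof.
apply: measurable_funeM.
pose F (q : C * C) := (g q.2 * disc_ind (rho - rho ^+ 2) q.1 q.2)%E.
have mF : measurable_fun setT F.
  apply: emeasurable_funM; last exact: measurable_disc_ind.
  by apply: (measurableT_comp mg); exact: measurable_snd.
have F0 q : (0 <= F q)%E by rewrite mule_ge0// disc_ind_ge0.
have := @measurable_fun_fubini_tonelli_F _ _ _ _ R leb2 F mF F0.
apply: eq_measurable_fun => z _.
by rewrite /fubini_F /F/= integral_disc_ind.
Qed.

Let cut rho a z : \bar R := (Num.max 0 (cutoff a z - rho))%:E.

Let mcut rho a : measurable_fun setT (cut rho a).
Proof.
apply/measurable_EFinP; apply: measurable_maxr => //; apply: measurable_funB => //.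
exact: measurable_cutoff.
Qed.

Let cut0 rho a z : (0 <= cut rho a z)%E.
Proof. by rewrite lee_fin le_max lexx. Qed.

Let mgcut rho a : measurable_fun setT (fun w => (g w * cut rho a w)%E).
Proof. by apply: emeasurable_funM; [exact: mg|exact: mcut]. Qed.

Let mchig a : measurable_fun setT (fun w => ((cutoff a w)%:E * g w)%E).
Proof. by apply: emeasurable_funM; [exact: mchi|exact: mg]. Qed.

(** Tonelli moves the averaging from the gap to the cutoff, which on a disc of radius at most rho
    about [w] is no less than its value at [w] minus rho. The factor (1 - rho)^2 is the ratio of
    (rho - rho^2)^2 to rho^2. *)
Lemma cutoff_gap_mean_ge rho a : 0 < rho <= 16^-1 ->
  (((1 - rho) ^+ 2)%:E * \int[leb2]_w (g w * cut rho a w) <=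
   \int[leb2]_z ((cutoff a z)%:E * gap_mean rho z))%E.
Proof.
move=> rho16; have /andP[r20 r2] := rho_fact rho16; have /andP[r0 r1] := rho16.
have D0 := @disc_area_gt0 R.
have K0 : 0 < D * rho ^+ 2 by rewrite mulr_gt0.
pose r := rho - rho ^+ 2.
have rp : 0 < r by rewrite /r; lra.
have rE : r ^+ 2 = rho ^+ 2 * (1 - rho) ^+ 2 by rewrite /r; ring.
pose F (q : C * C) := ((cutoff a q.1)%:E * (g q.2 * disc_ind r q.1 q.2))%E.
have mF : measurable_fun setT F.
  apply: emeasurable_funM; first by apply: (measurableT_comp (mchi a)); exact: measurable_fst.
  apply: emeasurable_funM; last exact: measurable_disc_ind.
  by apply: (measurableT_comp mg); exact: measurable_snd.
have F0 q : (0 <= F q)%E by rewrite !mule_ge0// disc_ind_ge0.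
have E1 : (\int[leb2]_z ((cutoff a z)%:E * gap_mean rho z) =
    ((D * rho ^+ 2)^-1)%:E * \int[leb2]_z \int[leb2]_w F (z, w))%E.
  rewrite -ge0_integralZl//; last 3 first.
  - exact: (@measurable_fun_fubini_tonelli_F _ _ _ _ R leb2 F mF F0).
  - by move=> z _; apply: integral_ge0.
  - by rewrite lee_fin invr_ge0 ltW.
  apply: eq_integral => z _; rewrite /F/= ge0_integralZl//; last 2 first.
  - by apply: emeasurable_funM; [exact: mg|exact: measurable_disc_ind1].
  - by move=> w _; rewrite mule_ge0// disc_ind_ge0.
  by rewrite integral_disc_ind// /gap_mean muleCA.
rewrite E1 ge0_fubini_leb2//.
have KV : (0 <= ((D * rho ^+ 2)^-1)%:E :> \bar R)%E by rewrite lee_fin invr_ge0 ltW.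
rewrite (_ : (((1 - rho) ^+ 2)%:E = ((D * rho ^+ 2)^-1)%:E * (D * r ^+ 2)%:E)%E); last first.
  by rewrite -EFinM rE; congr EFin; field; rewrite !lt0r_neq0.
rewrite -muleA lee_wpmul2l// -ge0_integralZl//; last 3 first.
- exact: mgcut.
- by move=> w _; rewrite mule_ge0.
- by rewrite lee_fin mulr_ge0 ?sqr_ge0// ltW.
apply: ge0_le_integral => //.
- by move=> w _; rewrite !mule_ge0// lee_fin mulr_ge0 ?sqr_ge0// ltW.
- by apply: measurable_funeM; exact: mgcut.
- exact: (@measurable_fun_fubini_tonelli_G _ _ _ _ R leb2 F mF F0).
move=> w _; rewrite /F/=.
have -> : (\int[leb2]_z ((cutoff a z)%:E * (g w * disc_ind r z w)) =
    g w * \int[leb2]_(z in disc w r) (cutoff a z)%:E)%E.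
  rewrite -integral_disc_ind_sym// -ge0_integralZl//; last 2 first.
  - by apply: emeasurable_funM; [exact: mchi|exact: measurable_disc_ind2].
  - by move=> z _; rewrite mule_ge0// disc_ind_ge0.
  by apply: eq_integral => z _; rewrite muleCA.
rewrite muleCA lee_wpmul2l//.
rewrite -(leb2_disc w rp) muleC; apply: ge0_integral_ge_cst.
- exact: measurable_disc.
- exact: measurable_funTS.
- by rewrite le_max lexx.
move=> z; rewrite /disc/= lee_fin => zw; rewrite ge_max cutoff_ge0/=.
by have := cutoff_lip a z w; rewrite /r in zw; lra.
Qed.

(** Lowering the cutoff by rho on its support costs at most rho delta, and the factor (1 - rho)^2 >=
    1 - 2 rho costs at most 2 rho delta. *)
Lemma cutoff_gap_le rho a delta : 0 < rho <= 16^-1 ->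
  (\int[leb2]_(x in disc a (3 / 8)) g x <= delta%:E)%E ->
  (\int[leb2]_z ((cutoff a z)%:E * g z) <=
   \int[leb2]_z ((cutoff a z)%:E * gap_mean rho z) + (3 * rho * delta)%:E)%E.
Proof.
move=> rho16 gd; have /andP[r20 r2] := rho_fact rho16; have /andP[r0 r1] := rho16.
have h8 : (\int[leb2]_(x in disc a 8^-1) g x <= delta%:E)%E.
  by apply: le_trans gd; apply: gap_disc_mono => //; rewrite subrr cmod0; lra.
have d0 : 0 <= delta by rewrite -lee_fin; apply: le_trans gd; apply: integral_ge0.
have g8 w : (g w * cut rho a w <= (g \_ (disc a 8^-1)) w)%E.
  rewrite patchE; case: ifPn => wa.
    rewrite -[leRHS]mule1 lee_wpmul2l// lee_fin ge_max ler01/=.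
    by have := cutoff_le a w; lra.
  rewrite /cut cutoff_out; last by rewrite leNgt; apply: contra wa; rewrite inE.
  by rewrite max_l ?mule0//; lra.
have mg8 : measurable_fun setT (g \_ (disc a 8^-1)).
  by apply: measurable_restrict_setT => //; exact: measurable_disc.
have X0 : (0 <= \int[leb2]_w (g w * cut rho a w))%E.
  by apply: integral_ge0 => w _; rewrite mule_ge0.
have Xd : (\int[leb2]_w (g w * cut rho a w) <= delta%:E)%E.
  apply: le_trans h8; rewrite [leRHS]integral_mkcond; apply: ge0_le_integral => //.
  - by move=> w _; rewrite mule_ge0.
  - exact: mgcut.
have h1 : (\int[leb2]_z ((cutoff a z)%:E * g z) <=
    \int[leb2]_w (g w * cut rho a w) + (rho * delta)%:E)%E.
  apply: (@le_trans _ _ (\int[leb2]_w (g w * cut rho a w + rho%:E * (g \_ (disc a 8^-1)) w))%E).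
    apply: ge0_le_integral => //.
    - by move=> w _; rewrite mule_ge0.
    - exact: mchig.
    - by apply: emeasurable_funD; [exact: mgcut|exact: measurable_funeM].
    move=> w _; rewrite patchE; case: ifPn => wa.
      rewrite muleC (muleC rho%:E) -ge0_muleDr//; last by rewrite lee_fin ltW.
      rewrite lee_wpmul2l// -EFinD lee_fin.
      by rewrite -lerBlDr le_max lexx orbT.
    rewrite mule0 adde0 cutoff_out; last by rewrite leNgt; apply: contra wa; rewrite inE.
    by rewrite mul0e mule_ge0.
  rewrite ge0_integralD//; last 4 first.
  - by move=> w _; rewrite mule_ge0.
  - exact: mgcut.
  - by move=> w _; rewrite mule_ge0 ?restrict_ge0// lee_fin ltW.
  - exact: measurable_funeM.
  rewrite leeD2l// ge0_integralZl//; last 2 first.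
  - by move=> w _; exact: restrict_ge0.
  - by rewrite lee_fin ltW.
  by rewrite -integral_mkcond EFinM lee_wpmul2l// lee_fin ltW.
apply: le_trans h1 _.
have := cutoff_gap_mean_ge a rho16.
have Y0 : (0 <= \int[leb2]_z ((cutoff a z)%:E * gap_mean rho z))%E.
  by apply: integral_ge0 => z _; rewrite mule_ge0// gap_mean_ge0.
suff key (X Y : \bar R) : (0 <= X)%E -> (X <= delta%:E)%E -> (0 <= Y)%E ->
    (((1 - rho) ^+ 2)%:E * X <= Y)%E -> (X + (rho * delta)%:E <= Y + (3 * rho * delta)%:E)%E.
  exact: key.
case: X => [x| |] x0 xd; [|by move: xd; rewrite leye_eq|by []].
case: Y => [y| |] y0 h; [|by rewrite /= leey|by []].
rewrite !lee_fin in x0 xd *; rewrite -EFinM lee_fin in h.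
have : 0 <= rho ^+ 2 * x by rewrite mulr_ge0// ltW.
have : rho * x <= rho * delta by rewrite ler_pM2l.
lra.
Qed.

(* On the level set [g] exceeds its disc means by 1, while the weighted integrals
   of [g] and of its disc means differ by [O (rho * delta)]. *)
Lemma gap_level_set rho a delta Lam : 0 < rho <= 16^-1 -> 1 <= cmod a ->
  (\int[leb2]_(x in disc a (3 / 8)) g x <= delta%:E)%E ->
  (forall z, cmod (z - a) <= 8^-1 -> (gap_mean rho z <= Lam%:E)%E) ->
  (leb2 (disc a 16^-1 `&` [set z | ((Lam + 1)%:E < g z)%E]) <= (48 * rho * delta)%:E)%E.
Proof.
move=> rho16 a1 gd VL; have /andP[r20 r2] := rho_fact rho16; have /andP[r0 r1] := rho16.
pose E := disc a 16^-1 `&` [set z | ((Lam + 1)%:E < g z)%E].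
have mE : measurable E.
  apply: measurableI; first exact: measurable_disc.
  by have := mg measurableT (emeasurable_itv `](Lam + 1)%:E, +oo[);
    rewrite setTI => h; rewrite (_ : [set _ | _] = g @^-1` `](Lam + 1)%:E, +oo[%classic)//;
    apply/seteqP; split => z /=; rewrite in_itv/= andbT.
have L0 : 0 <= Lam.
  by rewrite -lee_fin; apply: le_trans (VL a _); rewrite ?gap_mean_ge0// subrr cmod0 invr_ge0.
pose Y := (\int[leb2]_z ((cutoff a z)%:E * gap_mean rho z))%E.
have mY : measurable_fun setT (fun z => ((cutoff a z)%:E * gap_mean rho z)%E).
  by apply: emeasurable_funM => //; exact: measurable_gap_mean.
have Y0 z : (0 <= (cutoff a z)%:E * gap_mean rho z)%E by rewrite mule_ge0// gap_mean_ge0.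
have mI : measurable_fun setT (cst (16^-1)%:E \_ E : C -> \bar R).
  exact: measurable_restrict_setT.
have I0 z : (0 <= (cst (16^-1)%:E \_ E) z :> \bar R)%E.
  by rewrite patchE; case: ifP => // _; rewrite lee_fin invr_ge0.
have Yfin : (Y < +oo)%E.
  apply: (@le_lt_trans _ _ (\int[leb2]_z (cst (8^-1 * Lam)%:E \_ (disc a 8^-1)) z)%E).
    apply: ge0_le_integral => //.
      by apply: measurable_restrict_setT => //; exact: measurable_disc.
    move=> z _; rewrite patchE; case: ifPn => za; last first.
      rewrite cutoff_out ?mul0e//; rewrite leNgt; apply: contra za; rewrite inE//.
    rewrite EFinM; apply: lee_pmul => //; first exact: gap_mean_ge0.
      by rewrite lee_fin cutoff_le.
    by apply: VL; rewrite inE/disc/= in za; exact: ltW.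
  rewrite -integral_mkcond integral_cst; last exact: measurable_disc.
  have l8 : (leb2 (disc a 8^-1) < +oo)%E by rewrite leb2_disc ?invr_gt0// ltry.
  by apply: lte_mul_pinfty; rewrite ?lee_fin ?mulr_ge0 ?invr_ge0.
(* On the support of the cutoff the gap dominates its mean, and on [E] it does so by 1 with weight
   at least 1/16. Cancelling the finite [Y] against [cutoff_gap_le] leaves the measure of [E] at
   most 16 * 3 rho delta. *)
have h : (Y + (16^-1)%:E * leb2 E <= \int[leb2]_z ((cutoff a z)%:E * g z))%E.
  rewrite -integral_cst// [X in (_ + X)%E]integral_mkcond -ge0_integralD//.
  apply: ge0_le_integral => //.
  - by move=> z _; rewrite adde_ge0.
  - by apply: emeasurable_funD; [exact: mY|exact: mI].
  - exact: mchig.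
  move=> z _; rewrite patchE; case: ifPn => zE.
    move: zE; rewrite inE /E/disc/= => -[za gz].
    have c16 : 16^-1 <= cutoff a z by rewrite le_max; apply/orP; right; lra.
    apply: (@le_trans _ _ ((cutoff a z)%:E * (gap_mean rho z + 1))%E).
      rewrite ge0_muleDr ?gap_mean_ge0// leeD2l// mule1 lee_fin//.
    rewrite lee_wpmul2l//; apply: le_trans (ltW gz); rewrite EFinD leeD2r//.
    by apply: VL; lra.
  rewrite adde0; have [za|za] := leP (8^-1) (cmod (z - a)).
    by rewrite cutoff_out// !mul0e.
  rewrite lee_wpmul2l//; apply: gap_mean_le => //; last by rewrite subrr cmod0 ltW.
  by have := cmod_dist_triangle z a 0; rewrite !subr0 cmodC; lra.
have := le_trans h (cutoff_gap_le rho16 gd); rewrite -/Y -/E.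
have Y0' : (0 <= Y)%E by apply: integral_ge0.
move: Yfin Y0'; case: Y {h} => [y| |]// _ _.
rewrite leeD2lE// => h'.
have -> : (48 * rho * delta)%:E = (16%:E * (3 * rho * delta)%:E)%E :> \bar R.
  by rewrite -EFinM; congr EFin; ring.
by rewrite -lee_pdivrMl//.
Qed.

End GapLocal.

(** * Exponential integrability of the gap *)

Section Series.
Variable R : realType.
Implicit Types (q A : R).

Lemma nneseries_le (v : nat -> \bar R) (M : \bar R) : (forall k, (0 <= v k)%E) ->
  (forall n, (\sum_(0 <= k < n) v k <= M)%E) -> (\sum_(0 <= k <oo) v k <= M)%E.
Proof.
move=> v0 vM; apply: lime_le; first exact: is_cvg_nneseries.
by apply: nearW => n; exact: vM.
Qed.

Lemma nneseries_term (v : nat -> \bar R) k : (forall k, (0 <= v k)%E) ->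
  (v k <= \sum_(0 <= k <oo) v k)%E.
Proof.
move=> v0; apply: le_trans (nneseries_lim_ge k.+1 (fun k _ _ => v0 k)).
by rewrite big_nat_recr//= leeDr// sume_ge0.
Qed.

Lemma geometric_eseries_le A q : 0 <= A -> 0 <= q < 1 ->
  (\sum_(0 <= k <oo) (A * q ^+ k)%:E <= (A / (1 - q))%:E)%E.
Proof.
move=> A0 /andP[q0 q1]; have q1' : 0 < 1 - q by rewrite subr_gt0.
apply: nneseries_le => [k|n]; first by rewrite lee_fin mulr_ge0// exprn_ge0.
suff -> : (\sum_(0 <= k < n) (A * q ^+ k)%:E = (A / (1 - q) * (1 - q ^+ n))%:E)%E.
  rewrite lee_fin ler_piMr ?divr_ge0 ?(ltW q1')// gerBl exprn_ge0//.
elim: n => [|n IH]; first by rewrite big_geq// expr0 subrr mulr0.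
rewrite big_nat_recr//= IH -EFinD exprSr; congr EFin.
by field; rewrite lt0r_neq0.
Qed.

End Series.

(** Taking rho = 2^-(k+4), levels that grow linearly in [k] with slope [B] have level sets of
    measure at most 3 / 2^k. Over such a layer exp (p g) grows like exp (p B k), so the sum
    converges once exp (p B) <= 3/2, with ratio 3/4. *)
Lemma gap_exp_integral (R : realType) (p : R) : 0 < p ->
  exists2 delta : R, 0 < delta & exists2 K : R, 0 <= K &
  forall (sigma : R) (U : R * R -> \bar R), 0 <= sigma -> subharmonic U ->
    (forall z, 4^-1 <= cmod z -> (U z <= (sigma * ln (cmod z))%:E)%E) ->
  forall a, 1 <= cmod a ->
    (\int[leb2 (R:=R)]_(w in disc a (3 / 8)%R) gap sigma U w <= delta%:E)%E ->
    (\int[leb2 (R:=R)]_(w in disc a 16^-1%R) expeR (p%:E * gap sigma U w) <= K%:E)%E.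
Proof.
move=> p0; have D0 := @disc_area_gt0 R; pose D := disc_area R.
have l32 : 0 < ln (3 / 2) :> R by apply: ln_gt0; lra.
(* The 256 / D comes from [gap_mean_bound] and the 2 from rho^2 under the logarithm; [B = delta / e]
   is then the growth of the disc means per halving of rho. *)
have [e [e0 BE]] : exists e, 0 < e /\ forall d, 256 * d / D * 2 = d / e.
  exists (D / 512); split=> [|d]; first by rewrite /D; lra.
  by field; rewrite lt0r_neq0.
have lp0 : 0 < ln (3 / 2) / p by exact: divr_gt0.
pose delta := Num.min 1 (e * (ln (3 / 2) / p)).
have d0 : 0 < delta by rewrite lt_min ltr01 mulr_gt0.
have d1 : delta <= 1 by rewrite ge_min lexx.
pose B := delta / e.
have B0 : 0 < B by exact: divr_gt0.
have pB : p * B <= ln (3 / 2).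
  rewrite mulrC -ler_pdivlMr// ler_pdivrMr// mulrC.
  by rewrite /delta ge_min lexx orbT.
have ln2 : 0 <= ln (2 : R) <= 1.
  rewrite ln_ge0 ?ler1n//= -[leRHS]expRK ler_ln ?posrE ?expR_gt0//.
  by have := @expR_ge1Dx R 1; lra.
have l32' : ln (3 / 2) <= 1 :> R.
  have /andP[_ l2] := ln2; apply: le_trans l2; rewrite ler_ln ?posrE//; lra.
have e32 : expR (p * B) <= 3 / 2.
  have h32 : 0 < 3 / 2 :> R by lra.
  by rewrite -[leRHS]lnK ?posrE// ler_expR.
exists delta => //; pose A := expR (p * (B * 5 + 1)) * 3.
have A0 : 0 <= A by rewrite mulr_ge0 ?expR_ge0.
exists (expR (p * (B * 4 + 1)) * (D * 16^-1 ^+ 2) + A / (1 - 3 / 4)).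
  by rewrite addr_ge0 ?mulr_ge0 ?expR_ge0 ?sqr_ge0 ?(ltW D0)// invr_ge0; lra.
move=> sigma U s0 sU Ule a a1 gd.
pose g := gap sigma U.
have g0 z : (0 <= g z)%E by exact: gap_ge0.
have mg : measurable_fun setT g by exact: measurable_gap.
(* The shift 4 reflects rho <= 1/16, and the final 1 is the excess over the disc mean in
   [gap_level_set]. *)
pose Lam (k : nat) : R := B * (k%:R + 4) + 1.
pose E (k : nat) := [set z : R * R | ((Lam k)%:E < g z)%E].
have mE k : measurable (E k).
  have := mg measurableT _ (emeasurable_itv `](Lam k)%:E, +oo[).
  rewrite setTI => h; rewrite (_ : E k = g @^-1` `](Lam k)%:E, +oo[%classic)//.
  by apply/seteqP; split => z; rewrite /E/= in_itv/= andbT.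
have mEd k : (leb2 (R:=R) (disc a 16^-1 `&` E k) <= (3 / 2 ^+ k)%:E)%E.
  pose rho : R := (2 ^+ (k + 4))^-1.
  have r0 : 0 < rho by rewrite invr_gt0 exprn_gt0.
  have r16 : rho <= 16^-1.
    rewrite lef_pV2 ?posrE ?exprn_gt0// exprD.
    have : 1 <= 2 ^+ k :> R by rewrite exprn_ege1// ler1n.
    have -> : 2 ^+ 4 = 16 :> R by rewrite -natrX.
    lra.
  have rho16 : 0 < rho <= 16^-1 by rewrite r0.
  have VL z : cmod (z - a) <= 8^-1 -> (gap_mean sigma U rho z <= (B * (k%:R + 4))%:E)%E.
    move=> za; apply: le_trans (gap_mean_bound s0 sU Ule rho16 a1 za gd) _.
    rewrite lee_fin.
    have -> : 256 * delta / disc_area R = B / 2 by rewrite /B -BE mulfK.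
    have -> : ln rho = - ((k%:R + 4) * ln 2).
      by rewrite lnV ?posrE ?exprn_gt0// lnXn// -natrD mulr_natl.
    have l4 := @ln4_ge1 R; rewrite lnV ?posrE//.
    have k4 : 0 <= k%:R + 4 :> R by rewrite addr_ge0.
    have /andP[_ l2] := ln2.
    have h : (k%:R + 4) * ln 2 <= (k%:R + 4) * 1 :> R by exact: ler_wpM2l.
    have h2 : - ln 4 - 2 * - ((k%:R + 4) * ln 2) <= 2 * (k%:R + 4) :> R by lra.
    have B2 : 0 <= B / 2 by lra.
    apply: le_trans (ler_wpM2l B2 h2) _; lra.
  apply: le_trans (gap_level_set s0 sU Ule rho16 a1 gd VL) _.
  rewrite lee_fin /rho exprD invfM.
  have -> : 2 ^+ 4 = 16 :> R by rewrite -natrX.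
  have k0 : 0 < (2 ^+ k)^-1 :> R by rewrite invr_gt0 exprn_gt0.
  have : (2 ^+ k)^-1 * delta <= (2 ^+ k)^-1 * 1 by rewrite ler_pM2l.
  lra.
pose ck (k : nat) : \bar R := (expR (p * (B * (k%:R + 5) + 1)))%:E.
pose tk (k : nat) : R * R -> \bar R := (cst (ck k) : R * R -> \bar R) \_ (E k).
have ck0 k : (0 <= ck k)%E by rewrite lee_fin expR_ge0.
have ck1 k : (1 <= ck k)%E.
  rewrite lee_fin -expR0 ler_expR mulr_ge0 ?(ltW p0)// addr_ge0// mulr_ge0 ?(ltW B0)//.
have tk0 k z : (0 <= tk k z)%E by apply: restrict_ge0 => w; exact: ck0.
have mtk k : measurable_fun setT (tk k).
  by apply: measurable_restrict_setT => //; exact: mE.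
(* Let j be the first level with g <= Lam j. If j = 0 the constant term suffices; otherwise z lies
   in [E (j - 1)], whose weight [ck (j - 1)] is exp (p Lam j), whence the 5. If there is no such
   level, every term is at least 1 and the sum is infinite. *)
have pw z : (expeR (p%:E * g z) <= (expR (p * (B * 4 + 1)))%:E + \sum_(0 <= k <oo) tk k z)%E.
  have S0 : (0 <= \sum_(0 <= k <oo) tk k z)%E by exact: nneseries_ge0.
  have [H|] := pselect (exists k, (g z <= (Lam k)%:E)%E).
    have ex (x : \bar R) (y : R) : (x <= y%:E)%E ->
        (expeR (p%:E * x) <= (expR (p * y))%:E)%E.
      move=> xy; rewrite -[leRHS]/(expeR (p * y)%:E) lee_expeR EFinM.
      by rewrite lee_wpmul2l// lee_fin ltW.
    case: (ex_minnP H) => -[|k] gk kmin.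
      apply: (@le_trans _ _ (expR (p * (B * 4 + 1)))%:E); last by rewrite leeDl.
      by apply: ex; rewrite -[4]add0r; exact: gk.
    apply: (@le_trans _ _ (tk k z)); last first.
      apply: le_trans (nneseries_term k (fun k => tk0 k z)) _.
      by rewrite leeDr// lee_fin expR_ge0.
    rewrite /tk patchE mem_set; last first.
      by rewrite /E/= ltNge; apply/negP => /kmin; rewrite ltnn.
    apply: ex; apply: le_trans gk _.
    have kS : k.+1%:R = k%:R + 1 :> R by rewrite natr1.
    by rewrite lee_fin /Lam kS; lra.
  move=> /forallNP H.
  have zE k : E k z by rewrite /E/= ltNge; apply/negP; exact: H.
  suff -> : (\sum_(0 <= k <oo) tk k z = +oo)%E by rewrite addey// leey.
  have Sn n : (n%:R%:E <= \sum_(0 <= k <oo) tk k z)%E.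
    apply: le_trans (nneseries_lim_ge n (fun k _ _ => tk0 k z)).
    elim: n => [|n IH]; first by rewrite big_geq.
    rewrite big_nat_recr//= -natr1 EFinD leeD//.
    by rewrite /tk patchE (mem_set (zE n)); exact: ck1.
  case: (\sum_(0 <= k <oo) tk k z)%E S0 Sn => [x| |]// x0 Sn.
  have := Sn (Num.truncn x).+1; rewrite lee_fin leNgt truncnS_gt//.
have md := measurable_disc a (16^-1 : R).
have mF : measurable_fun setT (fun z => expeR (p%:E * g z)).
  by apply: (measurableT_comp (@measurable_expeR R)); exact: measurable_funeM.
have mS : measurable_fun setT (fun z => \sum_(0 <= k <oo) tk k z)%E.
  by apply: ge0_emeasurable_sum.
apply: (@le_trans _ _ (\int[leb2 (R:=R)]_(z in disc a 16^-1)
    ((expR (p * (B * 4 + 1)))%:E + \sum_(0 <= k <oo) tk k z))%E).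
  apply: ge0_le_integral => //.
  - by move=> z _; exact: expeR_ge0.
  - exact: measurable_funTS.
  - by apply: measurable_funTS; apply: emeasurable_funD.
rewrite ge0_integralD; [|exact: md|by move=> z _; rewrite lee_fin expR_ge0|
  exact: measurable_cst|by move=> z _; exact: nneseries_ge0|exact: measurable_funTS].
rewrite EFinD; apply: leeD.
  have i16 : 0 < 16^-1 :> R by rewrite invr_gt0.
  by rewrite integral_cst// EFinM -(leb2_disc a i16).
rewrite integral_nneseries; [|exact: md|by move=> k; exact: measurable_funTS (mtk k)|by move=> k z _; exact: tk0].
apply: le_trans (_ : (\sum_(0 <= k <oo) (A * (3 / 4) ^+ k)%:E <= _)%E); last first.
  by apply: geometric_eseries_le => //; apply/andP; split; lra.
apply: lee_nneseries => [k _ _|k _]; first exact: integral_ge0.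
rewrite -integral_mkcondr integral_cst; last exact: (measurableI _ _ md (mE k)).
apply: le_trans (lee_wpmul2l (ck0 k) (mEd k)) _.
rewrite -EFinM lee_fin.
have -> : p * (B * (k%:R + 5) + 1) = p * (B * 5 + 1) + k%:R * (p * B) by ring.
rewrite expRD expRM_natl.
have -> : (3 / 4) ^+ k = (3 / 2) ^+ k * (2 ^+ k)^-1 :> R.
  by rewrite -exprVn -exprMn; congr (_ ^+ k); field.
have h : expR (p * B) ^+ k <= (3 / 2) ^+ k by rewrite lerXn2r ?nnegrE ?expR_ge0//; lra.
have k0 : 0 < (2 ^+ k)^-1 :> R by rewrite invr_gt0 exprn_gt0.
have {}h : expR (p * (B * 5 + 1)) * 3 * (2 ^+ k)^-1 * expR (p * B) ^+ k <=
  expR (p * (B * 5 + 1)) * 3 * (2 ^+ k)^-1 * (3 / 2) ^+ k.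
  by apply: ler_wpM2l => //; rewrite !mulr_ge0 ?expR_ge0// ltW.
by rewrite /A; lra.
Qed.

(** * Finite covers by small discs *)

Section FiniteCover.
Variable R : realType.
Local Notation C := (R * R)%type.

(** Near-covering compactness along the filter of finite lists of points of [K], directed by
    inclusion. *)
Lemma compact_finite_cover (K : set C) (e : R) : compact K -> 0 < e ->
  exists s : seq C, (forall a, a \in s -> K a) /\
    forall z, K z -> exists2 a, a \in s & cmod (z - a) < e.
Proof.
move=> cK e0.
pose F : set_system (seq C) := fun P => exists2 s0 : seq C, (forall a, a \in s0 -> K a) &
  forall s : seq C, (forall a, a \in s -> K a) -> {subset s0 <= s} -> P s.
have FF : Filter F.
  split.
  - by exists [::].
  - move=> P Q [s sK sP] [s' s'K sQ]; exists (s ++ s').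
      by move=> a; rewrite mem_cat => /orP[/sK|/s'K].
    move=> t tK st; split; [apply: sP|apply: sQ] => // a sa; apply: st;
      by rewrite mem_cat sa ?orbT.
  - by move=> P Q PQ [s sK sP]; exists s => // t tK st; apply: PQ; exact: sP.
move: cK => /compact_near_coveringP /(_ _ F (fun s z => exists2 a, a \in s & cmod (z - a) < e) FF) [].
  move=> z Kz.
  exists ([set w | cmod (w - z) < e], [set s : seq C | z \in s]) => /=.
    split; first by apply/nbhs_cmodP; exists e.
    exists [:: z]; first by move=> a; rewrite inE => /eqP ->.
    by move=> s _; apply; rewrite mem_head.
  by move=> [w s] [/= wz zs]; exists z.
move=> s sK sP; exists s; split => // z Kz; exact: (sP s sK (fun _ h => h) z Kz).
Qed.

End FiniteCover.

(** * Rescaled annuli *)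

Section Dilation.
Variable R : realType.
Local Notation C := (R * R)%type.
Local Notation mu := (@lebesgue_measure R).
Implicit Types (r b : R) (z : C) (u : C -> \bar R).

Lemma subharmonic_bounded_circle u z r : subharmonic u -> 0 < r ->
  exists b : R, forall t, (u (circle z r t) <= b%:E)%E.
Proof.
move=> su r0; have [ult uu _ _] := su.
have [||w Kw wmax] := @usc_attains_max R u _ (@compact_annulus R z r r).
- by exists (circle z r 0); rewrite /= (cmod_circle_sub _ _ (ltW r0)) lexx.
- by move=> w b _ /uu[V nV Vu]; apply: filterS nV.
have cK t : r <= cmod (circle z r t - z) <= r by rewrite (cmod_circle_sub _ _ (ltW r0)) lexx.
case uw : (u w) (ult w) => [x| |]// _.
  by exists x => t; rewrite -uw; apply: wmax; exact: cK.
by exists 0 => t; apply: le_trans (wmax _ (cK t)) _; rewrite uw leNye.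
Qed.

(** [supermean_sub] with a constant b >= u bounds the integral of b - u by 2 pi (b - u z), which is
    finite. It lets a constant be split off the circle integral in [subharmonic_dilate]. *)
Lemma subharmonic_integrable_circle u z r : subharmonic u -> 0 < r -> u z <> -oo%E ->
  mu.-integrable `[0, 2 * pi] (fun t => u (circle z r t)).
Proof.
move=> su r0 uz; have [b ub] := subharmonic_bounded_circle z su r0.
have [ult _ _ _] := su.
have cb : continuous (fun t : R => (cst b : C -> R) (circle z r t)) by move=> t; exact: cvg_cst.
have := @supermean_sub R u (cst b) z r su r0 cb ub.
rewrite integral_itv_cst ?(ltW (two_pi_gt0 R))// subr0 mulrC lexx => /(_ isT) H.
have muc := subharmonic_measurable_circle z r su.
have ib := integrable_continuous_itv 0 (2 * pi) cb.
have ibu : mu.-integrable `[0, 2 * pi] (fun t => (b%:E - u (circle z r t))%E).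
  apply/integrableP; split.
    by apply: measurable_funTS; exact: emeasurable_funB.
  rewrite (_ : (\int[mu]_(t in `[0%R, (2 * pi)%R]) `|b%:E - u (circle z r t)|)%E =
      (\int[mu]_(t in `[0%R, (2 * pi)%R]) (b%:E - u (circle z r t)))%E); last first.
    apply: eq_integral => t _; rewrite gee0_abs//.
    move: (ub t); case: (u _) => [x| |]// h; last by rewrite leey.
    by rewrite -EFinB lee_fin subr_ge0 -lee_fin.
  apply: le_lt_trans H _.
  by case: (u z) uz (ult z) => [x| |]// _ _; rewrite -EFinB -EFinM ltry.
have : mu.-integrable `[0, 2 * pi] (fun t => (b%:E - (b%:E - u (circle z r t)))%E).
  exact: integrableB.
apply: eq_integrable => // t _ /=.
by case: (u (circle z r t)) (ult (circle z r t)) => [x| |]// _; rewrite -!EFinB; congr EFin; lra.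
Qed.

Lemma subharmonic_dilate u r b : subharmonic u -> 0 < r ->
  subharmonic (fun z : C => (u (r * z.1, r * z.2)%R - b%:E)%E).
Proof.
move=> su r0; have [ult uu [z0 uz0] _] := su.
split.
- by move=> z; rewrite lteBlDr// addey// ult.
- move=> z a; rewrite lteBlDr// -EFinD => /uu[V /nbhs_cmodP[e e0 eV] Vu].
  exists [set w | cmod (w - z) < e / r].
    by apply/nbhs_cmodP; exists (e / r) => //; rewrite divr_gt0.
  move=> w we; rewrite lteBlDr// -EFinD; apply: Vu; apply: eV.
  have -> : (r * w.1, r * w.2) - (r * z.1, r * z.2) = (r * (w - z).1, r * (w - z).2) :> C.
    by congr (_, _) => /=; ring.
  by rewrite cmod_dilate ?(ltW r0)// mulrC -ltr_pdivlMr.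
- exists (r^-1 * z0.1, r^-1 * z0.2).
  rewrite /= !mulVKf ?lt0r_neq0// -surjective_pairing.
  by move: uz0; case: (u z0) => [x| |]// _; rewrite -EFinB ltNyr.
move=> z s s0; pose rz : C := (r * z.1, r * z.2).
rewrite -/rz.
have [->|uz] := eqVneq (u rz) -oo%E; first by rewrite leNye.
have rs0 : 0 < r * s by rewrite mulr_gt0.
have iu := subharmonic_integrable_circle su rs0 (elimN eqP uz).
rewrite (_ : (\int[mu]_(t in _) _)%E =
  (\int[mu]_(t in `[0%R, (2 * pi)%R]) (u (circle rz (r * s) t) - b%:E))%E); last first.
  apply: eq_integral => t _; congr (u _ - _)%E; rewrite /circle/=.
  by congr (_, _); ring.
have ib : mu.-integrable `[0, 2 * pi] (EFin \o (cst b : R -> R)).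
  by apply: integrable_continuous_itv => t; exact: cvg_cst.
rewrite integralB// integral_itv_cst ?(ltW (two_pi_gt0 R))// subr0.
have := subharmonic_circle rz su rs0.
have : (\int[mu]_(t in `[0%R, (2 * pi)%R]) u (circle rz (r * s) t))%E \is a fin_num.
  exact: integrable_fin_num.
have p0 := lt0r_neq0 (two_pi_gt0 R).
move=> /fineK <-; set m := fine _.
rewrite -EFinB -!EFinM => /leeB/(_ (lexx b%:E)) /le_trans; apply.
by rewrite -EFinB lee_fin mulrBr mulrCA mulVf// mulr1.
Qed.

End Dilation.

(** * Integrals over finite and countable covers *)

Section Covers.
Variable R : realType.
Local Notation C := (R * R)%type.
Implicit Types (A : set C) (f : C -> \bar R).

Lemma ge0_integral_le_finite_cover A (s : seq C) (e K : R) f : measurable A ->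
  measurable_fun setT f -> (forall z, (0 <= f z)%E) -> 0 <= K ->
  (forall z, A z -> exists2 a, a \in s & cmod (z - a) < e) ->
  (forall a, a \in s -> (\int[leb2 (R:=R)]_(z in disc a e) f z <= K%:E)%E) ->
  (\int[leb2 (R:=R)]_(z in A) f z <= (K *+ size s)%:E)%E.
Proof.
move=> + mf f0 K0; elim: s A => [|a s IH] A mA As sK.
  rewrite (_ : A = set0) ?integral_set0//.
  by apply/seteqP; split => // z /As[].
have md := measurable_disc a e.
rewrite -(setUIDK A (disc a e)) ge0_integral_leb2_setU//; last 3 first.
- exact: measurableI.
- exact: measurableD.
- by apply/disj_set2P; rewrite setDE setIACA setICr setI0.
rewrite /= mulrS EFinD; apply: leeD.
  apply: le_trans (sK a (mem_head _ _)).
  apply: ge0_le_integral_subset => //; exact: measurableI.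
apply: IH; first exact: measurableD.
  move=> z [/As[b]]; rewrite inE => /orP[/eqP -> zb /(_ zb)//|sb zb _].
  by exists b.
by move=> b sb; apply: sK; rewrite inE sb orbT.
Qed.

Lemma ge0_integral_le_bigcup A (B : nat -> set C) f : measurable A ->
  (forall k, measurable (B k)) -> measurable_fun setT f -> (forall z, (0 <= f z)%E) ->
  A `<=` \bigcup_k B k ->
  (\int[leb2 (R:=R)]_(z in A) f z <=
   \sum_(0 <= k <oo) \int[leb2 (R:=R)]_(z in B k) f z)%E.
Proof.
move=> mA mB mf f0 AB.
have fB0 k z : (0 <= (f \_ (B k)) z)%E by exact: restrict_ge0.
have mfB k : measurable_fun setT (f \_ (B k)) by exact: measurable_restrict_setT.
have mS : measurable_fun setT (fun z => \sum_(0 <= k <oo) (f \_ (B k)) z)%E.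
  by apply: ge0_emeasurable_sum.
apply: (@le_trans _ _ (\int[leb2 (R:=R)]_(z in A) \sum_(0 <= k <oo) (f \_ (B k)) z)%E).
  apply: ge0_le_integral => //.
  - exact: measurable_funTS.
  - exact: (measurable_funTS mS).
  move=> z /AB[k _ Bz]; apply: le_trans (nneseries_term k (fun k => fB0 k z)).
  by rewrite patchE mem_set.
rewrite integral_nneseries; [|exact: mA|by move=> k; exact: measurable_funTS (mfB k)|by move=> k z _; exact: fB0].
apply: lee_nneseries => [k _ _|k _]; first exact: integral_ge0.
rewrite -integral_mkcondr; apply: ge0_le_integral_subset => //; exact: measurableI.
Qed.

End Covers.

(** * The exponential integral over one annulus *)

Section AnnulusIntegral.
Variable R : realType.
Local Notation C := (R * R)%type.

Lemma measurable_annulus (r1 r2 : R) : measurable [set z : C | r1 <= cmod z <= r2].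
Proof.
rewrite (_ : [set _ | _] = [set z : C | r1 <= cmod (z - 0) <= r2]).
  exact: compact_measurable (@compact_annulus R 0 r1 r2).
by apply/seteqP; split => z /=; rewrite subr0.
Qed.

(** With [e = d / H], the Harnack bound gives mass at most [d] on each disc of radius 3/8 centred in
    the annulus, as [gap_exp_integral] asks; finitely many discs of radius 1/16 cover the annulus.
    On |z| >= 1 the gap dominates -U because sigma ln |z| >= 0. *)
Lemma normalized_annulus_integral (p : R) : 0 < p ->
  exists2 e : R, 0 < e & exists2 K : R, 0 <= K &
  forall (sigma : R) (U : C -> \bar R), 0 <= sigma -> subharmonic U ->
    (forall z, 4^-1 <= cmod z -> (U z <= (sigma * ln (cmod z))%:E)%E) ->
  forall z0, cmod z0 = 1 -> ((- e)%:E <= U z0)%E ->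
  (\int[leb2 (R:=R)]_(z in [set z : C | (1 <= cmod z <= 4)%R])
     expeR (- (p%:E * U z)) <= K%:E)%E.
Proof.
move=> p0; have [d d0 [K K0 HK]] := gap_exp_integral p0.
have [H H0 HH] := gap_harnack R.
have [|s [sA As]] := @compact_finite_cover R _ 16^-1 (@compact_annulus R 0 1 4).
  by rewrite invr_gt0.
exists (d / H); first exact: divr_gt0.
exists (K *+ size s); first exact: mulrn_wge0.
move=> sigma U s0 sU Ule z0 z01 Uz0.
have g0 z : (0 <= gap sigma U z)%E by exact: gap_ge0.
have mg : measurable_fun setT (gap sigma U) by exact: measurable_gap.
have mF : measurable_fun setT (fun z => expeR (p%:E * gap sigma U z)).
  by apply: (measurableT_comp (@measurable_expeR R)); exact: measurable_funeM.
have mU := subharmonic_measurable sU.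
have mA := @measurable_annulus 1 4.
apply: (@le_trans _ _ (\int[leb2 (R:=R)]_(z in [set z : C | (1 <= cmod z <= 4)%R])
     expeR (p%:E * gap sigma U z))%E).
  apply: ge0_le_integral => //.
  - by move=> z _; exact: expeR_ge0.
  - by apply: measurable_funTS; exact: (measurable_expL2 p mU).
  - exact: measurable_funTS.
  move=> z /= /andP[z1 _]; rewrite lee_expeR -muleN lee_wpmul2l ?lee_fin ?(ltW p0)//.
  rewrite gapE; last by apply: le_trans z1; lra.
  by rewrite leeDr// lee_fin mulr_ge0// ln_ge0.
apply: (@ge0_integral_le_finite_cover _ _ s 16^-1) => //.
- by move=> z; exact: expeR_ge0.
- by move=> z /= zA; apply: As; rewrite /= subr0.
move=> a /sA /=; rewrite subr0 => a14.
apply: (HK _ _ s0 sU Ule); first by case/andP: a14.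
have dH : 0 < d / H by exact: divr_gt0.
have -> : d = H * (d / H) by rewrite mulrCA divff ?mulr1// lt0r_neq0.
apply: (HH _ _ s0 sU Ule z0) => //.
rewrite gapE z01; last lra.
by rewrite ln1 mulr0 add0e leeNl.
Qed.

(** Dilation by [r] contributes the Jacobian [r ^+ 2], and subtracting [m] contributes exp (- p
    m). *)
Lemma annulus_integral (p : R) : 0 < p ->
  exists2 e : R, 0 < e & exists2 K : R, 0 <= K &
  forall (sigma : R) (u : C -> \bar R) (r m : R), 0 <= sigma -> subharmonic u -> 0 < r ->
    (forall z, r / 4 <= cmod z -> (u z <= (m + sigma * (ln (cmod z) - ln r))%:E)%E) ->
  forall z0, cmod z0 = r -> ((m - e)%:E <= u z0)%E ->
  (\int[leb2 (R:=R)]_(z in [set z : C | (r <= cmod z <= r * 4)%R])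
     expeR (- (p%:E * u z)) <= (r ^+ 2 * expR (- (p * m)) * K)%:E)%E.
Proof.
move=> p0; have [e e0 [K K0 HK]] := normalized_annulus_integral p0.
exists e => //; exists K => // sigma u r m s0 su r0 ule z0 z0r uz0.
pose U z := (u (r * z.1, r * z.2)%R - m%:E)%E.
have sU : subharmonic U by exact: subharmonic_dilate.
have mU := subharmonic_measurable sU.
have mu' := subharmonic_measurable su.
have Ule z : 4^-1 <= cmod z -> (U z <= (sigma * ln (cmod z))%:E)%E.
  move=> z4; rewrite /U leeBlDr// -EFinD.
  have z0' : 0 < cmod z by apply: lt_le_trans z4; rewrite invr_gt0.
  apply: le_trans (ule _ _) _; rewrite cmod_dilate ?(ltW r0)//.
    by rewrite ler_pM2l.
  by rewrite lnM ?posrE// lee_fin; lra.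
have z0E : (r * (r^-1 * z0.1), r * (r^-1 * z0.2)) = z0.
  by rewrite !mulVKf ?lt0r_neq0// -surjective_pairing.
have z1 : cmod (r^-1 * z0.1, r^-1 * z0.2) = 1.
  by rewrite cmod_dilate ?invr_ge0 ?(ltW r0)// z0r mulVf// lt0r_neq0.
have Uz0 : ((- e)%:E <= U (r^-1 * z0.1, r^-1 * z0.2)%R)%E.
  rewrite (_ : U _ = u z0 - m%:E)%E; last by rewrite /U/= z0E.
  by rewrite leeBrDr// -EFinD addrC.
have := HK sigma U s0 sU Ule _ z1 Uz0.
rewrite integral_mkcond [X in _ -> (X <= _)%E]integral_mkcond => HA.
have mF : measurable_fun setT (fun z => expeR (- (p%:E * u z))).
  exact: (measurable_expL2 p mu').
have mA r1 r2 := @measurable_annulus r1 r2.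
rewrite (ge0_integral_dilate r0); first last.
- by move=> z; apply: restrict_ge0 => w; exact: expeR_ge0.
- by apply: measurable_restrict_setT => //; exact: mA.
have E0 : (0 <= (expR (- (p * m)))%:E)%E by rewrite lee_fin expR_ge0.
rewrite (_ : (\int[leb2 (R:=R)]_z _)%E = ((expR (- (p * m)))%:E *
   \int[leb2 (R:=R)]_z ((fun z => expeR (- (p%:E * U z))) \_
       [set z : C | (1 <= cmod z <= 4)%R]) z)%E); last first.
  rewrite -ge0_integralZl//; first last.
  - by move=> z _; apply: restrict_ge0 => w; exact: expeR_ge0.
  - apply: measurable_restrict_setT; first exact: mA.
    exact: (measurable_expL2 p mU).
  apply: eq_integral => z _; rewrite !patchE.
  have -> : ((r * z.1, r * z.2) \in [set z : C | r <= cmod z <= r * 4]) =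
      (z \in [set z : C | 1 <= cmod z <= 4]).
    apply/idP/idP; rewrite !inE/= cmod_dilate ?(ltW r0)//;
      by rewrite ler_pM2l// -{1}[r]mulr1 ler_pM2l.
  case: ifP => _; last by rewrite mule0.
  rewrite -[(expR _)%:E]/(expeR (- (p * m))%:E) -expeRD /U.
  case: (u _) => [x| |].
  - rewrite -[RHS]/(expR (- (p * m) - p * (x - m)))%:E -[LHS]/(expR (- (p * x)))%:E.
    by congr (expR _)%:E; ring.
  - by rewrite /= gt0_muley ?lte_fin.
  - by rewrite /= gt0_muleNy ?lte_fin.
apply: le_trans (lee_wpmul2l _ (lee_wpmul2l E0 HA)) _; first by rewrite lee_fin sqr_ge0.
by rewrite -!EFinM mulrA.
Qed.

End AnnulusIntegral.

(** * Convergence above the critical exponent *)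

Section SupercriticalExponent.
Variable R : realType.
Local Notation C := (R * R)%type.

Lemma L2_infty_gt (u : C -> \bar R) (s c : R) : subharmonic u -> 0 < s ->
  logtype u = s%:E -> s^-1 < c -> L2_infty (expL2 c u).
Proof.
move=> su s0 us sc; have si0 : 0 < s^-1 by rewrite invr_gt0.
have c0 : 0 < c by exact: lt_trans sc.
pose p := 2 * c; have p0 : 0 < p by rewrite mulr_gt0.
have ps2 : 0 < p * s - 2.
  have : s * s^-1 < s * c by rewrite ltr_pM2l.
  by rewrite divff ?lt0r_neq0// /p; lra.
have l4 := @ln4_ge1 R; have l40 : 0 < ln (4 : R) by lra.
have [e e0 [K K0 HK]] := annulus_integral p0.
have [M [Mex Mle Mgr]] := circle_max_growth su s0 us.
(* The first term makes the gap small enough for [annulus_integral]; the second spends at most half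
   of the margin (p s - 2) ln 4, so that [q < 1]. *)
pose e1 := Num.min e ((p * s - 2) * ln 4 / 2 / p).
have e10 : 0 < e1 by rewrite lt_min e0 !divr_gt0// mulr_gt0.
have pe1 : p * e1 <= (p * s - 2) * ln 4 / 2.
  by rewrite mulrC -ler_pdivlMr// /e1 ge_min lexx orbT.
have e1e : e1 <= e by rewrite /e1 ge_min lexx.
have [k0 Hk0] := Mgr _ e10.
pose m j := M (4 ^+ (k0 + j)).
have mge j : m 0%N + j%:R * (s * ln 4 - e1) <= m j.
  elim: j => [|j IH]; first by rewrite mul0r addr0.
  have := Hk0 (k0 + j)%N (leq_addr _ _); rewrite -addnS -/(m j) -/(m j.+1) -[j.+1%:R]natr1.
  lra.
have r40 j : 0 < 4 ^+ j :> R by rewrite exprn_gt0.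
(* One power above the circle on which [m j] is taken: the growth bound from that circle then holds
   on |z| >= r / 4. *)
pose r j : R := 4 ^+ (k0 + j).+1.
have rE j : r j = r 0%N * 4 ^+ j by rewrite /r addn0 -exprD addSn.
pose B j := [set z : C | r j <= cmod z <= r j * 4].
pose F z := (expL2 c u z * expL2 c u z)%E.
have FE z : F z = expeR (- (p%:E * u z)).
  rewrite /F /expL2 expeR_sqr /p; case: (u z) => [x| |].
  - by rewrite -!EFinM -!EFinN -EFinD; congr (expR _)%:E; ring.
  - by rewrite !gt0_muley ?lte_fin// mulr_gt0.
  - by rewrite !gt0_muleNy ?lte_fin// mulr_gt0.
(* Per step the Jacobian grows by 4^2 = exp (2 ln 4), and exp (- p m) shrinks by at least exp (- p
   (s ln 4 - e1)) according to [mge]. *)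
pose q := expR (2 * ln 4 - p * (s * ln 4 - e1)).
pose A := r 0%N ^+ 2 * expR (- (p * (m 0%N + s * ln 4))) * K.
have IB j : (\int[leb2 (R:=R)]_(z in B j) F z <= (A * q ^+ j)%:E)%E.
  have [z0 z0r uz0] := Mex (r j) (r40 _).
  under eq_integral do rewrite FE.
  apply: le_trans (HK s u (r j) (m j + s * ln 4) (ltW s0) su (r40 _) _ z0 z0r _) _.
  - move=> z; rewrite /r exprS mulrC mulKf// => rz.
    apply: le_trans (Mle _ _ (r40 _) rz) _.
    by rewrite lee_fin lnM ?posrE// /m; lra.
  - rewrite uz0 lee_fin; have := Hk0 (k0 + j)%N (leq_addr _ _).
    by rewrite -/(m j) -/(r j); lra.
  have E4 : (4 ^+ j) ^+ 2 = expR (j%:R * (2 * ln 4)) :> R.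
    rewrite -exprM mulnC exprM expRM_natl; congr (_ ^+ j).
    by rewrite -[X in _ = expR X]/(2%:R * ln 4) expRM_natl lnK ?posrE.
  rewrite lee_fin /A /q -expRM_natl (rE j) exprMn E4.
  have alg (a x y z w k : R) : 0 <= a -> 0 <= k -> x * y <= z * w ->
      a * x * y * k <= a * z * k * w.
    by move=> a0 k0' h; have := ler_wpM2l (mulr_ge0 a0 k0') h; lra.
  apply: alg; rewrite ?exprn_ge0 ?(ltW (r40 _))// -!expRD ler_expR.
  have h : p * (m 0%N + j%:R * (s * ln 4 - e1)) <= p * m j by rewrite ler_pM2l.
  lra.
exists [set z : C | 0 <= cmod (z - 0) <= r 0%N]; split; first exact: compact_annulus.
have mu' := subharmonic_measurable su.
have mF : measurable_fun setT F by exact: measurable_expL2_sqr.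
have F0 z : (0 <= F z)%E by exact: expL2_sqr_ge0.
have mK : measurable [set z : C | 0 <= cmod (z - 0) <= r 0%N].
  exact: compact_measurable (@compact_annulus R 0 0 (r 0%N)).
apply/integrableP; split; first exact: measurable_funTS.
under eq_integral do rewrite (gee0_abs (F0 _)).
apply: (@le_lt_trans _ _ (A / (1 - q))%:E); last exact: ltry.
apply: le_trans (@ge0_integral_le_bigcup R _ B F _ _ mF F0 _) _.
- exact: measurableC.
- by move=> k; exact: measurable_annulus.
- move=> z /= /negP; rewrite subr0 cmod_ge0/= -ltNge => rz.
  have [|k /andP[k1 k2]] := @expr4_interval R (cmod z / r 0%N).
    by rewrite ler_pdivlMr ?r40// mul1r ltW.
  exists k => //; rewrite /B/= rE.
  rewrite ler_pdivlMr ?r40// in k1; rewrite ler_pdivrMr ?r40// in k2.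
  by rewrite mulrC k1 (le_trans k2)// exprS; lra.
have A0 : 0 <= A by rewrite /A !mulr_ge0 ?expR_ge0 ?exprn_ge0 ?(ltW (r40 _)).
have q01 : 0 <= q < 1.
  by rewrite expR_ge0/= /q expR_lt1; have := mulr_gt0 ps2 l40; lra.
apply: le_trans (geometric_eseries_le A0 q01).
by apply: lee_nneseries => [k _ _|k _]; [exact: integral_ge0|exact: IB].
Qed.

End SupercriticalExponent.

(** * The integrability sets and the critical exponent *)

Lemma einv_lt_set (R : realType) (s : R) : 0 < s ->
  [set c : R | (einv s%:E < c%:E)%E] = [set c | s^-1 < c].
Proof. by move=> s0; apply/seteqP; split => c /=; rewrite /einv gt_eqF// lte_fin. Qed.

Lemma ereal_inf_itv_oy (R : realType) (a : R) :
  ereal_inf [set c%:E | c in [set c : R | a < c]] = a%:E.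
Proof.
apply/le_anti/andP; split.
  apply/lee_addgt0Pr => e e0; apply: ereal_inf_lbound.
  by exists (a + e); rewrite /= ?ltrDl.
by apply: le_ereal_inf_tmp => _ [c /= ac <-]; rewrite lee_fin ltW.
Qed.

Lemma measurable_uplus (R : realType) (u : R * R -> \bar R) :
  measurable_fun setT u -> measurable_fun setT (uplus u).
Proof. by move=> mu; apply: measurable_maxe. Qed.

(** A logarithmic upper bound for [u] passes to its positive part with constant |b|, so
    [not_L2_infty] excludes both sets at once. Allowing [s = 0] covers constant [u], where the
    conclusion becomes absurd. *)
Lemma L2_exps_log_bounded (R : realType) (u : R * R -> \bar R) (s b : R) :
  measurable_fun setT u -> 0 <= s ->
  (forall z, 1 <= cmod z -> (u z <= (s * ln (cmod z) + b)%:E)%E) ->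
  forall c, L2_exps (uplus u) c \/ L2_exps u c -> 1 < c * s.
Proof.
move=> mu s0 us c uc; rewrite ltNge; apply/negP => cs.
have mup := measurable_uplus mu.
have upL z : 1 <= cmod z -> (uplus u z <= (s * ln (cmod z) + `|b|)%:E)%E.
  move=> z1; rewrite /uplus ge_max; apply/andP; split.
    by apply: le_trans (us z z1) _; rewrite lee_fin lerD2l ler_norm.
  by rewrite lee_fin addr_ge0// mulr_ge0// ln_ge0.
case: uc => -[c0 Lc].
  exact: (not_L2_infty mup c0 s0 cs upL Lc).
exact: (not_L2_infty mu c0 s0 cs us Lc).
Qed.

Theorem theorem4p1 (R : realType) (u : R * R -> \bar R) :
  LPSH u ->
  [/\ c_infty u = einv (logtype u),
      c_hat_infty u = einv (logtype u) &
      ((exists z w, u z <> u w) ->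
        L2_exps u = L2_exps (uplus u) /\
        L2_exps u = [set c : R | (einv (logtype u) < c%:E)%E])].
Proof.
move=> [su ut]; have mu := subharmonic_measurable su.
have [u0|u0] := leP (logtype u) 0%E.
  (* Nonpositive type means constant, and the constant is real because a subharmonic function is not
     identically [-oo]. Both sets are then empty and both infima [+oo]. *)
  have ucst z w : u z = u w by apply/le_anti/andP; split; exact: liouville.
  have [k uk] : exists k : R, forall z, u z = k%:E.
    have [ult _ [z0 uz0] _] := su.
    by case uE : (u z0) (ult z0) uz0 => [k| |]// _ _; exists k => z; rewrite -uE.
  have -> : logtype u = 0%E by rewrite -(logtype_cst k); congr logtype; apply/funext.
  have uz c : L2_exps (uplus u) c \/ L2_exps u c -> 1 < c * 0.
    by apply: (@L2_exps_log_bounded R u 0 k) => // z _; rewrite uk mul0r add0r.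
  have E1 : L2_exps u = set0.
    by apply/seteqP; split => // c h; have := uz c (or_intror h); lra.
  have E2 : L2_exps (uplus u) = set0.
    by apply/seteqP; split => // c h; have := uz c (or_introl h); lra.
  split; last by move=> [z [w]]; rewrite (ucst z w).
  - by rewrite /c_infty E1 image_set0 ereal_inf0/= eqxx.
  - by rewrite /c_hat_infty /c_infty E2 image_set0 ereal_inf0/= eqxx.
case us : (logtype u) u0 ut => [s| |]// s0 _; rewrite lte_fin in s0.
have [M [_ Mle _]] := circle_max_growth su s0 us.
have ule z : 1 <= cmod z -> (u z <= (s * ln (cmod z) + M 1)%:E)%E.
  by move=> z1; apply: le_trans (Mle 1 z ltr01 z1) _; rewrite ln1 subr0 addrC.
have Lgt := L2_exps_log_bounded mu (ltW s0) ule.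
have L1 : L2_exps u = [set c | s^-1 < c].
  apply/seteqP; split => c /= h.
    by have := Lgt c (or_intror h); rewrite -div1r ltr_pdivrMr.
  split; first by apply: lt_trans h; rewrite invr_gt0.
  exact: L2_infty_gt us h.
have L2 : L2_exps (uplus u) = [set c | s^-1 < c].
  apply/seteqP; split => c h.
    by have := Lgt c (or_introl h); rewrite /= -div1r ltr_pdivrMr.
  (* Passing to the larger function [uplus u] only decreases the integrand, so membership for [u] is
     inherited. *)
  move: h; rewrite -L1 => -[c0 Lc]; split => //.
  apply: (L2_infty_le c0 (measurable_uplus mu)) Lc => z.
  by rewrite /uplus le_max lexx.
rewrite /c_hat_infty /c_infty L1 L2 ereal_inf_itv_oy einv_lt_set// /einv gt_eqF//.
Qed.
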